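(* Let $\alpha$ be a countable ordinal, let $\psi_\alpha$ be the $\mathcal{L}_{\omega_1,\omega}$-sentence defined in the context, and let $(\mathbf{K}_\alpha,\prec_{\mathbf{K}_\alpha})$ be the class of models of $\psi_\alpha$ with the substructure relation. (1) $(\mathbf{K}_\alpha,\prec_{\mathbf{K}_\alpha})$ fails the joint embedding property (JEP) in all cardinals. (2) (a) Suppose $0<\alpha<\omega$ and $\kappa$ is an infinite cardinal that belongs to $\mathrm{Spec}(\psi_\alpha)$. Then: - if $\kappa\le\aleph_\alpha$, $(\mathbf{K}_\alpha,\prec_{\mathbf{K}_\alpha})$ does not satisfy the amalgamation property (AP) for $\kappa$; - if $\aleph_{\alpha+1}\le\kappa\le2^{\aleph_\alpha}$: if there exists a $(\mu,\aleph_\alpha,\kappa)$-Kurepa tree for some $\mu\le\aleph_\alpha$, then AP fails for $\kappa$; otherwise AP holds for $\kappa$; - if $\kappa>2^{\aleph_\alpha}$, then $(\mathbf{K}_\alpha,\prec_{\mathbf{K}_\alpha})$ satisfies AP for $\kappa$. (b) If $\alpha\ge\omega$, then $(\mathbf{K}_\alpha,\prec_{\mathbf{K}_\alpha})$ fails AP in all cardinalities.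
   Context: The sentence $\psi_\alpha$. Fix a countable ordinal $\alpha$. The vocabulary $\tau$ has constants $0$ and $c_n$ ($n\in\omega$), unary predicates $L_\beta$ ($0\le\beta\le\alpha+1$), binary relation symbols $S,V,T$ and $<_\beta$ ($1\le\beta\le\alpha+1$), and ternary relation symbols $F_\beta$ ($0\le\beta\le\alpha$) and $G$. Write $V(a)=\{x: V(a,x)\}$. Saying that $F(x,\cdot,\cdot)$ is a surjection from $A$ to $B$ means that $\{(y,z):F(x,y,z)\}$ is the graph of a surjection $A\to B$. $\psi_\alpha$ is the $\mathcal{L}_{\omega_1,\omega}(\tau)$-sentence that is the conjunction of the following requirements. (a) $L_{\alpha+1}$ is linearly ordered by $<_{\alpha+1}$ with minimum $0$; it may or may not have a maximum element. Every non-maximum $a\in L_{\alpha+1}$ has an immediate successor $b$, and $S(a,b)$ expresses that $b$ is the successor of $a$. The maximum, if it exists, is called $m$ and is not a successor. (b) For $a\in L_{\alpha+1}$, $V(a)$ is the set of nodes at level $a$; it is disjoint from every $L_\beta$, and $V(a)\cap V(b)=\emptyset$ for $a\ne b$. The universe is the union of all the $L_\beta$ and all the $V(a)$. (c) $T$ is a tree ordering on $V=\bigcup_{a\in L_{\alpha+1}}V(a)$. If $T(x,y)$, then the level of $x$ is strictly below the level of $y$. If $y\in V(a)$ and $b<_{\alpha+1}a$, there is $x\in V(b)$ with $T(x,y)$. If $a$ is a limit (neither a successor nor $0$), two distinct elements of $V(a)$ do not have the same $T$-predecessors. The tree is pruned (every node is contained in a maximal branch). If $m$ exists, the elements of $V(m)$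 play the role of maximal branches through the tree (a model need not contain all maximal branches). (d) $\forall x\,(L_0(x)\leftrightarrow\bigvee_n x=c_n)$, so $L_0$ has size $\aleph_0$. (e) Each $L_\beta$, $1\le\beta\le\alpha$, is linearly ordered by $<_\beta$ and may or may not have a maximum. For limit $\beta$, $L_\beta=\bigcup_{\gamma<\beta}L_\gamma$ (the order $<_\beta$ being unrelated to the previous orders). (f) For $\beta<\alpha$ and every $x\in L_{\beta+1}$, $F_\beta(x,\cdot,\cdot)$ is a surjection from $L_\beta$ to $\{b\in L_{\beta+1}: b\le_{\beta+1}x\}$. (g) For every $x\in L_{\alpha+1}$ that is not the maximum of $L_{\alpha+1}$, $F_\alpha(x,\cdot,\cdot)$ is a surjection from $L_\alpha$ to $\{b\in L_{\alpha+1}:b\le_{\alpha+1}x\}$ and $G(x,\cdot,\cdot)$ is a surjection from $L_\alpha$ to $V(x)$. $\mathbf{K}_\alpha$ is the class of all models of $\psi_\alpha$, and $M\prec_{\mathbf{K}_\alpha}N$ means that $M$ is a substructure of $N$. $\mathrm{Spec}(\psi_\alpha)$ is the class of cardinals $\kappa$ such that $\psi_\alpha$ has a model of size $\kappa$. JEP for $\kappa$: any two models in $\mathbf{K}_\alpha$ of size $\kappa$ can be embedded (as substructures) into a common $N\in\mathbf{K}_\alpha$. AP for $\kappa$: whenever $M_0\prec_{\mathbf{K}_\alpha}M_1,M_2$ are in $\mathbf{K}_\alpha$ of size $\kappa$, there are $N\in\mathbf{K}_\alpha$ and embeddings of $M_1$ and $M_2$ into $N$ agreeing on $M_0$. For $\kappa\ge\lambda\ge\mu$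 and $\kappa>\mu$, a $(\mu,\lambda,\kappa)$-Kurepa tree is a tree of height $\mu$, each level of which has $<\lambda$ elements, and with $\kappa$ branches of height $\mu$ ($\mu,\lambda,\kappa$ infinite cardinals).
   Formalization: The maximum m of L_{α+1}, if it exists, is required to be a limit (m = 0 is excluded, since then V(0) is arbitrary and AP fails above 2^{ℵ_α}); F_β and G hold only at the arguments described; JEP and AP failure is claimed for cardinals in Spec(ψ_α). *)

(* Defs.v *)
From mathcomp Require Import all_boot all_order.
From mathcomp Require Import boolp classical_sets functions cardinality wochoice.

Set Implicit Arguments.
Unset Strict Implicit.
Unset Printing Implicit Defensive.

Local Open Scope classical_set_scope.
Local Open Scope card_scope.

(* Cardinals are represented by types, compared with #<= and #=; on types    *)
(* |T| < |U| is ~ ([set: U] #<= [set: T]).                                   *)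

Section Cardinals.

Lemma card_leTP (T U : Type) :
  ([set: T] #<= [set: U]) <-> exists f : T -> U, injective f.
Proof.
split=> [/card_leP[g]|[f fI]].
  exists (fun x => \val (g (SigSub (@mem_set _ setT x I)))) => x y /val_inj gxy.
  have := 'inj_g (mem_set I) (mem_set I) gxy.
  by move=> /(congr1 val).
have [g] : $|{injfun [set: T] >-> [set: U]}|.
  by apply/injfunPex; exists f => // x y _ _; apply: fI.
exact: inj_card_le.
Qed.

Lemma card_least (I : Type) (i0 : I) (X : I -> Type) :
  exists i, forall j, [set: X i] #<= [set: X j].
Proof.
pose P (S : set (forall i, X i)) :=
  forall f g i, S f -> S g -> f i = g i -> f = g.
have [|S [PS Smax]] := @Zorn_bigcup _ P.
  move=> F FP Ftot f g i [A FA Af] [B FB Bg].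
  have [AB|BA] := Ftot _ _ FA FB.
  - by apply: (FP _ FB) => //; apply: AB.
  - by apply: (FP _ FA) => //; apply: BA.
have [i iS] : exists i, forall x, exists f, S f /\ f i = x.
  apply: contrapT => /forallNP Snsurj.
  have {}Snsurj i : exists x, forall f, S f -> f i <> x.
    have /existsNP[x /forallNP xP] := Snsurj i.
    by exists x => f Sf fx; apply: (xP f).
  pose h i := projT1 (cid (Snsurj i)).
  have hP i f : S f -> f i <> h i by rewrite /h; case: cid => /= x; apply.
  apply: (Smax (S `|` [set h])); last first.
    move=> f g i [Sf|->] [Sg|->] fg //; first exact: PS fg.
    - by case: (hP i f Sf).
    - by case: (hP i g Sg).
  split; first by move=> f Sf; left.
  by move=> /(_ h (or_intror erefl)) Sh; apply: (hP i0 h Sh).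
exists i => j; pose k x := projT1 (cid (iS x)).
have kP x : S (k x) /\ k x i = x by rewrite /k; case: cid.
apply/card_leTP; exists (fun x => k x j) => x y kxy.
have [[Sx <-] [Sy <-]] := (kP x, kP y).
by rewrite (PS _ _ _ Sx Sy kxy).
Qed.

Lemma card_total (T U : Type) :
  [set: T] #<= [set: U] \/ [set: U] #<= [set: T].
Proof.
have [[] le] := card_least true (fun b : bool => if b then T else U).
- by left; apply: (le false).
- by right; apply: (le true).
Qed.

Lemma card_succ_subproof (T : Type) : exists C : set (set T),
  ~ (C #<= [set: T]) /\
  forall W : Type, ~ ([set: W] #<= [set: T]) -> C #<= [set: W].
Proof.
pose I := {C : set (set T) | ~ (C #<= [set: T])}.
have TT : ~ ([set: set T] #<= [set: T]).
  move=> /card_leTP[f fI]; pose D := [set f A | A in [set A | ~ A (f A)]].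
  have [DfD|nDfD] := pselect (D (f D)); last by apply: (nDfD); exists D.
  by have [A /= AfA /fI AD] := DfD; apply: AfA; rewrite AD.
have [[C CT] Cle] := card_least (exist _ setT TT : I) (fun i : I => sval i).
exists C; split=> // W WT.
have [WP|PW] := card_total W (set T); last first.
  apply: card_le_trans PW; exact: card_leT.
have [f fI] := (card_leTP _ _).1 WP.
have WfW : range f #= [set: W] by apply: inj_card_eq => x y _ _ /fI.
have fWT : ~ (range f #<= [set: T]) by rewrite (card_le_eql WfW).
have := Cle (exist _ (range f) fWT).
rewrite /= (card_le_eql (card_setT C)) (card_le_eqr (card_setT (range f))).
by rewrite (card_le_eqr WfW).
Qed.

(* a type whose cardinality is the successor cardinal of |T| *)
Definition card_succ (T : Type) : Type := projT1 (cid (card_succ_subproof T)).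

Lemma card_succP (T : Type) :
  ~ ([set: card_succ T] #<= [set: T]) /\
  forall W : Type, ~ ([set: W] #<= [set: T]) -> [set: card_succ T] #<= [set: W].
Proof.
rewrite /card_succ; case: cid => C /= [CT CW].
split; first by rewrite (card_le_eql (card_setT C)).
by move=> W WT; rewrite (card_le_eql (card_setT C)); apply: CW.
Qed.

Fixpoint aleph (n : nat) : Type :=
  if n is m.+1 then card_succ (aleph m) else nat.

End Cardinals.

Definition slt (T : Type) (r : rel T) : rel T := fun x y => r x y && ~~ r y x.

Definition below (T : Type) (r : rel T) (x : T) : set T := [set y | slt r y x].

Definition order_iso (T U : Type) (r : rel T) (A : set T)
    (s : rel U) (B : set U) : Prop :=
  exists f : T -> U,
    set_bij A B f /\ forall x y, A x -> A y -> r x y = s (f x) (f y).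

Section KurepaTrees.

(* A cardinal as an ordinal: a well-order all of whose proper initial segments
   are smaller in cardinality. *)
Definition initial_order (M : Type) (r : rel M) : Prop :=
  well_order r /\ forall a, ~ ([set: M] #<= below r a).

Variables (X : Type) (t : rel X).

Definition tree_order : Prop :=
  partial_order t /\ forall x, {in <= below t x, well_order t}.

Variables (M : Type) (r : rel M).

(* the nodes whose set of predecessors has order type [a], where [a] is an
   element of the ordinal [(M, r)] *)
Definition tree_level (a : M) : set X :=
  [set x | order_iso t (below t x) r (below r a)].

Definition tree_has_height : Prop :=
  (forall a, tree_level a !=set0) /\ (forall x, exists a, tree_level a x).

Definition tree_branch : set (set X) :=
  [set B | [/\ total_on B t,
               forall C : set X, total_on C t -> B `<=` C -> C = B &
               order_iso t B r [set: M]]].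

End KurepaTrees.

(* There is a (|Mu|, |La|, |Ka|)-Kurepa tree.  "With |Ka| branches" is read as:
   there are |Ka| many distinct branches of height |Mu|, i.e. at least |Ka|. *)
Definition kurepa_tree_exists (Mu La Ka : Type) : Prop :=
  [/\ infinite_set [set: Mu], [set: Mu] #<= [set: La],
      [set: La] #<= [set: Ka] & ~ ([set: Ka] #<= [set: Mu])] /\
  exists (r : rel Mu) (X : Type) (t : rel X),
    [/\ initial_order r, tree_order t, tree_has_height t r,
        forall a, ~ ([set: La] #<= tree_level t r a) &
        [set: Ka] #<= tree_branch t r].

(* The logic L_{omega_1, omega} over vocabularies of relation symbols and
   constants. *)

Record vocabulary : Type := Vocabulary {
  csymb : Type;
  rsymb : Type;
  arity : rsymb -> nat }.

Record structure (tau : vocabulary) : Type := Structure {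
  universe :> Type;
  cinterp : csymb tau -> universe;
  rinterp : forall R : rsymb tau, (arity R).-tuple universe -> Prop }.

Arguments cinterp {tau} s c.
Arguments rinterp {tau} s R v.

Inductive term (tau : vocabulary) : Type :=
  | Var of nat
  | Cst of csymb tau.

Arguments Var {tau} _.
Arguments Cst {tau} _.

Inductive formula (tau : vocabulary) : Type :=
  | Eq of term tau & term tau
  | Rel (R : rsymb tau) of (arity R).-tuple (term tau)
  | Neg of formula tau
  | And of formula tau & formula tau
  | Or of formula tau & formula tau
  | Imp of formula tau & formula tau
  | Conj (J : countType) of J -> formula tau
  | Disj (J : countType) of J -> formula tau
  | All of nat & formula tau
  | Ex of nat & formula tau.

Arguments Rel {tau} R _.

Section Semantics.

Variables (tau : vocabulary) (M : structure tau).

Definition upd (v : nat -> M) (n : nat) (x : M) : nat -> M :=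
  fun k => if k == n then x else v k.

Definition term_val (v : nat -> M) (s : term tau) : M :=
  match s with Var n => v n | Cst c => cinterp M c end.

Fixpoint sat (v : nat -> M) (phi : formula tau) : Prop :=
  match phi with
  | Eq s u => term_val v s = term_val v u
  | Rel R s => rinterp M R (map_tuple (term_val v) s)
  | Neg f => ~ sat v f
  | And f g => sat v f /\ sat v g
  | Or f g => sat v f \/ sat v g
  | Imp f g => sat v f -> sat v g
  | Conj J F => forall i : J, sat v (F i)
  | Disj J F => exists i : J, sat v (F i)
  | All n f => forall x, sat (upd v n x) f
  | Ex n f => exists x, sat (upd v n x) f
  end.

Definition models (phi : formula tau) : Prop := forall v, sat v phi.

End Semantics.

Definition Iff (tau : vocabulary) (f g : formula tau) : formula tau :=
  And (Imp f g) (Imp g f).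

Declare Scope logic_scope.
Delimit Scope logic_scope with logic.
Bind Scope logic_scope with formula.
Reserved Notation "f :=> g" (at level 98, right associativity).
Reserved Notation "f <:=> g" (at level 98, right associativity).
Notation "~ f" := (Neg f) : logic_scope.
Notation "f /\ g" := (And f g) : logic_scope.
Notation "f \/ g" := (Or f g) : logic_scope.
Notation "f :=> g" := (Imp f g) : logic_scope.
Notation "f <:=> g" := (Iff f g) : logic_scope.

Definition embedding (tau : vocabulary) (M N : structure tau) (f : M -> N) :
    Prop :=
  [/\ injective f,
      forall c, f (cinterp M c) = cinterp N c &
      forall (R : rsymb tau) (v : (arity R).-tuple M),
        rinterp M R v <-> rinterp N R (map_tuple f v)].

(* For the class of models of [phi] ordered by the substructure relation.  The
   inclusion of a substructure M0 in M is given, up to isomorphism, as an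
   embedding of M0 into M. *)
Section ModelClass.

Variables (tau : vocabulary) (phi : formula tau) (K : Type).

Definition model_of_size (M : structure tau) : Prop :=
  models M phi /\ [set: M] #= [set: K].

Definition Spec : Prop := exists M, model_of_size M.

Definition JEP : Prop :=
  forall M1 M2 : structure tau, model_of_size M1 -> model_of_size M2 ->
  exists (N : structure tau) (g1 : M1 -> N) (g2 : M2 -> N),
    [/\ models N phi, embedding g1 & embedding g2].

Definition AP : Prop :=
  forall (M0 M1 M2 : structure tau) (f1 : M0 -> M1) (f2 : M0 -> M2),
  model_of_size M0 -> model_of_size M1 -> model_of_size M2 ->
  embedding f1 -> embedding f2 ->
  exists (N : structure tau) (g1 : M1 -> N) (g2 : M2 -> N),
    [/\ models N phi, embedding g1, embedding g2 &
        forall x, g1 (f1 x) = g2 (f2 x)].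

End ModelClass.

(* Countable ordinals as well-orders; the elements of an ordinal stand for the
   smaller ordinals. *)
Record cordinal : Type := COrdinal {
  ord_sort :> countType;
  ord_le : rel ord_sort;
  ord_wo : well_order ord_le }.

Arguments ord_le {c}.

Definition osucc_le (a : cordinal) : rel (option a) := fun x y =>
  match x, y with
  | _, None => true
  | None, Some _ => false
  | Some b, Some c => ord_le b c
  end.

Lemma osucc_wo (a : cordinal) : well_order (@osucc_le a).
Proof.
move=> A [x Ax]; pose B : {pred a} := [pred b | Some b \in A].
have [[b Bb]|nB] := pselect (exists b, b \in B).
  have [c [[Bc minc] uc]] := @ord_wo a B (ex_intro _ b Bb).
  exists (Some c); split; first by split=> // -[d|] //=; apply: minc.
  move=> [d|] [Ad mind]; last by have := mind _ Bc.
  by congr Some; apply: uc; split=> // e Be; apply: (mind (Some e)).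
have An y : y \in A -> y = None.
  by case: y => // b Ab; case: nB; exists b.
have A0 : None \in A by rewrite -(An x Ax).
exists None; split; first by split=> // y /An ->.
by move=> y [/An ->].
Qed.

Definition osucc (a : cordinal) : cordinal := COrdinal (@osucc_wo a).

Section PsiAlpha.

Variable alpha : cordinal.

(* The ordinals beta <= alpha + 1 are the elements of alpha + 2: [None] is
   alpha + 1, [Some None] is alpha, and [Some (Some b)] are those below alpha. *)
Definition label : countType := osucc (osucc alpha).

Definition label_lt (b c : label) : bool :=
  slt (@ord_le (osucc (osucc alpha))) b c.
Definition label_pos (b : label) : bool := `[< exists c, label_lt c b >].
Definition label_succ (b c : label) : bool :=
  `[< label_lt b c /\ ~ exists d, label_lt b d /\ label_lt d c >].
Definition label_limit (c : label) : bool :=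
  label_pos c && `[< ~ exists b, label_succ b c >].

Definition pos_label : countType := {b : label | label_pos b}.

Definition alpha0 : label := Some None.
Definition alpha1 : label := None.
Definition palpha1 : pos_label :=
  exist _ alpha1 (asboolT (ex_intro (fun c => label_lt c alpha1) alpha0 erefl)).

Variant psi_constant : Type := zero_symb | c_symb of nat.

Variant psi_relation : Type :=
  | L_symb of label                 (* beta <= alpha + 1 *)
  | lt_symb of pos_label            (* 1 <= beta <= alpha + 1 *)
  | F_symb of osucc alpha           (* beta <= alpha *)
  | G_symb | S_symb | V_symb | T_symb.

Definition psi_arity (R : psi_relation) : nat :=
  match R with
  | L_symb _ => 1
  | lt_symb _ | S_symb | V_symb | T_symb => 2
  | F_symb _ | G_symb => 3
  end.

Definition psi_voc : vocabulary :=
  @Vocabulary psi_constant psi_relation psi_arity.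

Local Notation tm := (term psi_voc).
Local Notation fm := (formula psi_voc).

Definition at_0 : tm := @Cst psi_voc zero_symb.
Definition at_c (n : nat) : tm := @Cst psi_voc (c_symb n).
Definition at_L (b : label) (s : tm) : fm := @Rel psi_voc (L_symb b) [tuple s].
Definition at_lt (b : pos_label) (s u : tm) : fm :=
  @Rel psi_voc (lt_symb b) [tuple s; u].
Definition at_F (b : osucc alpha) (s u w : tm) : fm :=
  @Rel psi_voc (F_symb b) [tuple s; u; w].
Definition at_G (s u w : tm) : fm := @Rel psi_voc G_symb [tuple s; u; w].
Definition at_S (s u : tm) : fm := @Rel psi_voc S_symb [tuple s; u].
Definition at_V (s u : tm) : fm := @Rel psi_voc V_symb [tuple s; u].
Definition at_T (s u : tm) : fm := @Rel psi_voc T_symb [tuple s; u].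

(* Variables are named: [w] is reserved for the quantifiers inside the
   abbreviations [psi_nonmax] and [psi_limit]. *)
Definition psi_var (n : nat) : tm := Var n.
Local Coercion psi_var : nat >-> term.

Local Notation Zero := at_0.
Local Notation C := at_c.
Local Notation L := at_L.
Local Notation Lt := at_lt.
Local Notation F := at_F.
Local Notation G := at_G.
Local Notation S := at_S.
Local Notation V := at_V.
Local Notation T := at_T.
Local Notation x := 0.
Local Notation y := 1.
Local Notation z := 2.
Local Notation w := 3.
Local Notation a := 4.
Local Notation b := 5.

Local Open Scope logic_scope.
Local Notation "s == u" := (@Eq psi_voc s u) : logic_scope.

(* On elements of L_(alpha+1). *)
Definition psi_nonmax (s : tm) : fm := Ex w (Lt palpha1 s w).
Definition psi_limit (s : tm) : fm := ~ (s == Zero) /\ ~ Ex w (S w s).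

Definition psi_linear_order (be : pos_label) : fm :=
  All x (All y (Lt be x y :=> L (val be) x /\ L (val be) y)) /\
  All x (~ Lt be x x) /\
  All x (All y (All z (Lt be x y /\ Lt be y z :=> Lt be x z))) /\
  All x (All y (L (val be) x /\ L (val be) y :=>
    x == y \/ Lt be x y \/ Lt be y x)).

Definition psi_surjection (R : tm -> tm -> fm) (A B : tm -> fm) : fm :=
  All y (All z (R y z :=> A y /\ B z)) /\
  All y (A y :=> Ex z (R y z)) /\
  All y (All z (All w (R y z /\ R y w :=> z == w))) /\
  All z (B z :=> Ex y (R y z)).

(* The set of s in L_be with s <=_be u. *)
Definition psi_initial_segment (be : pos_label) (u s : tm) : fm :=
  L (val be) s /\ (s == u \/ Lt be s u).

(* The last clause makes m, the maximum of L_(alpha+1) if it exists, a limit: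
   m = 0 is excluded as well, since then V(0) would be an arbitrary set. *)
Definition psi_a : fm :=
  psi_linear_order palpha1 /\
  L alpha1 Zero /\
  All x (L alpha1 x :=> x == Zero \/ Lt palpha1 Zero x) /\
  All x (All y (S x y <:=>
    Lt palpha1 x y /\ ~ Ex z (Lt palpha1 x z /\ Lt palpha1 z y))) /\
  All x (L alpha1 x /\ psi_nonmax x :=> Ex y (S x y)) /\
  All x (L alpha1 x /\ ~ psi_nonmax x :=> psi_limit x).

Definition psi_b : fm :=
  All a (All x (V a x :=> L alpha1 a)) /\
  All a (All x (V a x :=> Conj (fun be : label => ~ L be x))) /\
  All a (All b (All x (V a x /\ V b x :=> a == b))) /\
  All x (Disj (fun be : label => L be x) \/ Ex a (V a x)).

(* The last clause is prunedness in its first-order form: every node has an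
   extension at every higher level, hence one in V(m) if m exists. *)
Definition psi_c : fm :=
  All x (All y (T x y :=> Ex a (Ex b (V a x /\ V b y /\ Lt palpha1 a b)))) /\
  All x (All y (All z (T x y /\ T y z :=> T x z))) /\
  All x (All y (All z (T x z /\ T y z :=> x == y \/ T x y \/ T y x))) /\
  All a (All b (All y (V a y /\ Lt palpha1 b a :=> Ex x (V b x /\ T x y)))) /\
  All a (All x (All y (L alpha1 a /\ psi_limit a /\ V a x /\ V a y /\
    All z (T z x <:=> T z y) :=> x == y))) /\
  All a (All b (All x (V a x /\ Lt palpha1 a b :=> Ex y (V b y /\ T x y)))).

(* The only label [be] with [~~ label_pos be] is the ordinal 0.  The second
   clause makes L_0 infinite. *)
Definition psi_d : fm :=
  Conj (fun be : {be : label | ~~ label_pos be} =>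
    All x (L (val be) x <:=> Disj (fun n : nat => x == C n))) /\
  Conj (fun p : {p : nat * nat | p.1 != p.2} => ~ (C (val p).1 == C (val p).2)).

Definition psi_e : fm :=
  Conj (fun be : {be : pos_label | val be != alpha1} => psi_linear_order (val be)) /\
  Conj (fun be : {be : label | label_limit be} =>
    All x (L (val be) x <:=>
      Disj (fun ga : {ga : label | label_lt ga (val be)} => L (val ga) x))).

(* Here [p] ranges over the pairs (beta, beta + 1) with beta < alpha.  F_beta
   and G hold of no triple other than the ones required. *)
Definition psi_f : fm :=
  Conj (fun p : {p : alpha * pos_label |
                 label_succ (Some (Some p.1)) (val p.2)} =>
    let be := (val p).1 in let be1 := (val p).2 in
    All x (All y (All z (F (Some be) x y z :=> L (val be1) x))) /\
    All x (L (val be1) x :=>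
      psi_surjection (F (Some be) x) (L (Some (Some be)))
        (psi_initial_segment be1 x))).

Definition psi_g : fm :=
  All x (All y (All z (F None x y z \/ G x y z :=> L alpha1 x /\ psi_nonmax x))) /\
  All x (L alpha1 x /\ psi_nonmax x :=>
    psi_surjection (F None x) (L alpha0) (psi_initial_segment palpha1 x) /\
    psi_surjection (G x) (L alpha0) (V x)).

Definition psi : fm :=
  psi_a /\ psi_b /\ psi_c /\ psi_d /\ psi_e /\ psi_f /\ psi_g.

End PsiAlpha.

(* Main.v *)
Require Import Defs.
From mathcomp Require Import all_boot all_order.
From mathcomp Require Import boolp classical_sets functions cardinality wochoice.

(** The point is how much of a model is determined by [L_0], the set of the
    constants [c_n].  Since [F_b] enumerates the initial segments of
    [L_(b+1)] by [L_b], an extension that leaves [L_b] fixed can only add elements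
    to [L_(b+1)] above all the old ones, and it cannot add any if [L_(b+1)] already
    has the largest possible size, aleph_(b+1).

    Joint embedding fails because whether 0 is one of the [c_n], and which one, is
    preserved by embeddings, but can be changed in any model without changing its
    size ([jep_fails]).

    Amalgamation fails in a cardinal K as soon as some model of size K has a
    countable [L_1] ([ap_fails_of_countable_L1]).  Such an [L_1] can be extended by
    a last element in two ways that enumerate the new [L_1] differently; in an
    amalgam the two new elements would be equal, hence so would their enumerations.
    It remains to find such models.

    If alpha is infinite, replace [L_(k+1)] by [L_k] for all finite k, giving [L_1]
    an order of type omega.  Nothing is lost, because [L_omega] is a union, and the
    models of all sizes survive ([shift_good]).

    If alpha = p + 1 is finite, let [L_(k+1)] be the ordinal omega_k for k up to p
    (cut off at K).  Then [L_alpha] has size at most aleph_p, so the tree must have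
    levels of size less than aleph_alpha, and at most aleph_alpha levels below the
    maximum.  One branch suffices if K is at most aleph_alpha; for larger K, a
    Kurepa tree provides enough branches ([tree_good], [ap_fails_small],
    [ap_fails_kurepa]).

    Conversely, let alpha = p + 1 be finite, and K at least aleph_(alpha+1).  If a
    model of size K has an [L_alpha] of size less than aleph_alpha, all but at most
    aleph_alpha of its elements are branches at the level of the maximum
    ([small_model]); so K is at most 2^aleph_alpha, and the tree, restricted to a
    cofinal sequence of levels, is a Kurepa tree ([kurepa_of_model]).  If there is
    no such model, then all [L_b] have their largest possible size in all models of
    size K.  By the first remark, an extension leaves the sets [L_b] fixed, and
    also the tree below the maximum; it can only add a maximum and elements of its
    level ([L_rigid], [nonmax_rigid]).  Two such extensions are amalgamated by
    identifying their maxima and their branches with the same nodes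
    ([amalgam_exists]). *)

Set Implicit Arguments.
Unset Strict Implicit.
Unset Printing Implicit Defensive.

Local Open Scope classical_set_scope.
Local Open Scope card_scope.

(** * Cardinal arithmetic *)

(** Injections between sets are handled through relations, so that no default
    value is needed for a function between empty or unpointed types. *)
Lemma card_le_rel (T U : Type) (A : set T) (B : set U) :
  A #<= B <-> exists R : T -> U -> Prop,
    (forall x, A x -> exists y, B y /\ R x y) /\
    (forall x x' y, A x -> A x' -> R x y -> R x' y -> x = x').
Proof.
rewrite (card_le_eql (card_setT_sym A)) (card_le_eqr (card_setT_sym B)).
split.
  move=> /card_leTP[f fI].
  exists (fun x y => exists u : A, val u = x /\ val (f u) = y); split.
    move=> x Ax; pose u : A := SigSub (mem_set Ax).
    exists (val (f u)); split; last by exists u.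
    by have := valP (f u); rewrite inE.
  by move=> x x' y _ _ [u [<- <-]] [v [<- /val_inj/fI->]].
move=> [R [Rt RI]]; apply/card_leTP.
have ex (u : A) : exists v : B, R (val u) (val v).
  have [|y [By Ry]] := Rt (val u); first by have := valP u; rewrite inE.
  by exists (SigSub (mem_set By)).
exists (fun u => projT1 (cid (ex u))) => u v.
case: cid => /= y Ry; case: cid => /= z Rz yz; apply/val_inj.
apply: (RI _ _ (val y)) => //; last by rewrite yz.
  by have := valP u; rewrite inE.
by have := valP v; rewrite inE.
Qed.

Lemma card_le_fun (T U : Type) (A : set T) (B : set U) (f : T -> U) :
  (forall x, A x -> B (f x)) ->
  (forall x y, A x -> A y -> f x = f y -> x = y) -> A #<= B.
Proof.
move=> AB fI; apply/card_le_rel; exists (fun x y => y = f x); split.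
  by move=> x Ax; exists (f x); split=> //; apply: AB.
by move=> x x' y Ax Ax' -> /fI; apply.
Qed.

Lemma card_le_funE (T U : Type) (A : set T) (B : set U) (u0 : U) :
  A #<= B -> exists f : T -> U, (forall x, A x -> B (f x)) /\
    (forall x y, A x -> A y -> f x = f y -> x = y).
Proof.
move=> /card_le_rel[R [Rt RI]].
have ex x : exists y, A x -> B y /\ R x y.
  have [/Rt[y ?]|nA] := pselect (A x); first by exists y.
  by exists u0.
exists (fun x => projT1 (cid (ex x))); split.
  by move=> x; case: cid => /= y h Ax; have [] := h Ax.
move=> x y; case: cid => /= u hu; case: cid => /= v hv Ax Ay uv.
have [[_ Rx] [_ Ry]] := (hu Ax, hv Ay).
by apply: (RI _ _ u) => //; rewrite uv.
Qed.

Lemma card_le_surj (T U : Type) (A : set T) (B : set U) (R : U -> T -> Prop) :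
  (forall x, A x -> exists y, B y /\ R y x) ->
  (forall y x x', R y x -> R y x' -> x = x') -> A #<= B.
Proof.
move=> Rs Rf; apply/card_le_rel; exists (fun x y => R y x).
by split=> // x x' y _ _; apply: Rf.
Qed.

Lemma card_le_totalset (T U : Type) (A : set T) (B : set U) :
  A #<= B \/ B #<= A.
Proof.
have := card_total A B.
rewrite (card_le_eql (card_setT A)) (card_le_eqr (card_setT B)).
by rewrite (card_le_eql (card_setT B)) (card_le_eqr (card_setT A)).
Qed.

Lemma not_card_leW (T U : Type) (A : set T) (B : set U) :
  ~ (A #<= B) -> B #<= A.
Proof. by have [->|] := card_le_totalset A B. Qed.

Lemma infinite_natP (T : Type) : infinite_set [set: T] ->
  exists c : nat -> T, injective c.
Proof. by move=> /infiniteP/card_leTP. Qed.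

Section CardinalSquare.

Variable T : Type.

(* [G] is the graph of a relation pairing the square of [dom G] injectively
   into [dom G]. *)
Let dom (G : set (T * T * T)) : set T := [set x | exists z, G (x, x, z)].
Let pairing (G : set (T * T * T)) :=
  [/\ forall p p' z, G (p, z) -> G (p', z) -> p = p',
      forall x y z, G (x, y, z) -> [/\ dom G x, dom G y & dom G z] &
      forall x y, dom G x -> dom G y -> exists z, G (x, y, z)].

Let pairing_bigcup (F : set (set (T * T * T))) :
  (forall G, F G -> pairing G) -> total_on F subset ->
  pairing (\bigcup_(G in F) G).
Proof.
move=> FP Ftot; split.
- move=> p p' z [G FG Gp] [H FH Hp].
  have [GH|HG] := Ftot _ _ FG FH.
    by have [I _ _] := FP _ FH; apply: I Hp; apply: GH.
  by have [I _ _] := FP _ FG; apply: I Gp _; apply: HG.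
- move=> x y z [G FG Gp]; have [_ D _] := FP _ FG.
  have [[a ?] [b ?] [c ?]] := D _ _ _ Gp.
  by split; [exists a, G|exists b, G|exists c, G].
- move=> x y [a [G FG Gx]] [b [H FH Hy]].
  have [GH|HG] := Ftot _ _ FG FH.
    have [_ _ E] := FP _ FH.
    have [||z] := E x y; first by exists a; apply: GH.
      by exists b.
    by exists z, H.
  have [_ _ E] := FP _ FG.
  have [||z] := E x y; first by exists a.
    by exists b; apply: HG.
  by exists z, G.
Qed.

(* A pairing whose domain is no larger than its complement is extended by a
   disjoint copy of its domain. *)
Let pairing_extend (G : set (T * T * T)) (a0 a1 : T) :
  pairing G -> dom G a0 -> dom G a1 -> a0 <> a1 ->
  dom G #<= ~` dom G ->
  exists G', [/\ pairing G', G `<=` G' & ~ (G' `<=` G)].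
Proof.
move=> [GI GD GE] a0D a1D a01 /(card_le_funE a0)[k [kC kI]].
have exg x y : exists z, dom G x -> dom G y -> G (x, y, z).
  have [[xD yD]|nD] := pselect (dom G x /\ dom G y).
    by have [z ?] := GE _ _ xD yD; exists z.
  by exists x => xD yD; case: nD.
pose g x y := projT1 (cid (exg x y)).
have gP x y : dom G x -> dom G y -> G (x, y, g x y).
  by rewrite /g; case: cid.
have gD x y : dom G x -> dom G y -> dom G (g x y).
  by move=> xD yD; have [] := GD _ _ _ (gP _ _ xD yD).
have gI x y x' y' : dom G x -> dom G y -> dom G x' -> dom G y' ->
    g x y = g x' y' -> x = x' /\ y = y'.
  move=> xD yD xD' yD' gg; have := gP _ _ xD yD; rewrite gg => h.
  by have [] := GI _ _ _ h (gP _ _ xD' yD').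
(* [h x u]: the element [u] of [dom G] codes the element [x] of the enlarged
   domain *)
pose h x u := (dom G x /\ u = g a0 x) \/
              (exists w, [/\ dom G w, x = k w & u = g a1 w]).
pose D' x := dom G x \/ exists w, dom G w /\ x = k w.
have hE x : D' x -> exists u, h x u.
  by case=> [xD|[w [wD ->]]]; [exists (g a0 x); left|
    exists (g a1 w); right; exists w].
have hD x u : h x u -> D' x /\ dom G u.
  case=> [[xD ->]|[w [wD -> ->]]]; split; try exact: gD.
    by left.
  by right; exists w.
have hI x x' u : h x u -> h x' u -> x = x'.
  case=> [[xD ->]|[w [wD -> ->]]] [[xD' /gI[]]|[w' [wD' -> /gI[]]]] //.
    by move=> aa; case: a01.
  by move=> _ ->.
pose N p := exists u v, [/\ h p.1.1 u, h p.1.2 v,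
    ~ (dom G p.1.1 /\ dom G p.1.2) & p.2 = k (g u v)].
pose G' := G `|` N.
have GG' : G `<=` G' by move=> p; left.
have D'G x : D' x -> dom G' x.
  move=> xD'; have [[z Gz]|nxD] := pselect (dom G x); first by exists z; left.
  have [u hu] := hE _ xD'; exists (k (g u u)); right; exists u, u.
  by split=> //= -[].
have dG' x : dom G' x -> D' x.
  case=> z [Gz|[u [v [/= hu _ _ _]]]]; first by left; exists z.
  by have [] := hD _ _ hu.
have ND p z : N (p, z) -> exists w, dom G w /\ z = k w.
  move=> [u [v [/= hu hv _ ->]]]; exists (g u v); split=> //.
  by apply: gD; [have [] := hD _ _ hu|have [] := hD _ _ hv].
exists G'; split=> //; last first.
  move=> G'G; apply: (kC _ a0D).
  have [|z /G'G ?] := D'G (k a0); first by right; exists a0.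
  by exists z.
split.
- have GN p p' z : G (p, z) -> N (p', z) -> False.
    move: p => [x y] /GD[_ _ zD] /ND[w [wD zE]].
    by apply: (kC _ wD); rewrite -zE.
  move=> p p' z [Gp|Np] [Gp'|Np'].
  + exact: GI Gp'.
  + by case: (GN _ _ _ Gp Np').
  + by case: (GN _ _ _ Gp' Np).
  + move: p p' Np Np' => [x y] [x' y'] [u [v [/= hu hv _ ->]]].
    move=> [u' [v' [/= hu' hv' _]]] /kI.
    have [[_ uD] [_ vD]] := (hD _ _ hu, hD _ _ hv).
    have [[_ uD'] [_ vD']] := (hD _ _ hu', hD _ _ hv').
    move=> /(_ (gD _ _ uD vD) (gD _ _ uD' vD')) /gI[] // uu vv.
    by rewrite (hI _ _ _ hu (_ : h x' u)) ?uu// (hI _ _ _ hv (_ : h y' v)) ?vv.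
- move=> x y z [Gp|Np].
    by have [? ? ?] := GD _ _ _ Gp; split; apply: D'G; left.
  split; apply: D'G; last by right; apply: ND Np.
    by move: Np => [u [v [/= /hD[]]]].
  by move: Np => [u [v [/= _ /hD[]]]].
- move=> x y /dG' xD /dG' yD.
  have [[xG yG]|nG] := pselect (dom G x /\ dom G y).
    by have [z ?] := GE _ _ xG yG; exists z; left.
  have [[u hu] [v hv]] := (hE _ xD, hE _ yD).
  by exists (k (g u v)); right; exists u, v.
Qed.

(** Zorn's lemma gives a maximal pairing above one with countable domain;
    its domain has full cardinality, since otherwise it could be extended. *)
Theorem card_square : infinite_set [set: T] -> [set: T * T] #<= [set: T].
Proof.
move=> /infinite_natP[c cI].
have [e eI] : exists e : nat * nat -> nat, injective e.
  by apply/card_leTP; have := card_nat2; rewrite card_eq_le => /andP[].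
pose G0 : set (T * T * T) :=
  [set p | exists i j, p = (c i, c j, c (e (i, j)))].
have G0d x : dom G0 x <-> exists i, x = c i.
  split=> [[z [i [j [-> _ _]]]]|[i ->]]; first by exists i.
  by exists (c (e (i, i))), i, i.
have G0P : pairing G0.
  split.
  - by move=> p p' z [i [j [-> ->]]] [i' [j' [-> /cI/eI[-> ->]]]].
  - move=> x y z [i [j [-> -> ->]]]; split; apply/G0d; by eexists.
  - move=> x y /G0d[i ->] /G0d[j ->]; by exists (c (e (i, j))), i, j.
have [|G [GP Gmax]] := @Zorn_bigcup _ [set G | pairing (G0 `|` G)].
  move=> F FP Ftot /=; have [->|/eqP/set0P[G1 FG1]] := pselect (F = set0).
    by rewrite bigcup_set0 setU0.
  rewrite (_ : _ `|` _ = \bigcup_(G in [set G0 `|` G | G in F]) G); last first.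
    apply/seteqP; split=> p /=.
      move=> [G0p|[G FG Gp]]; first by exists (G0 `|` G1); [exists G1|left].
      by exists (G0 `|` G); [exists G|right].
    move=> [_ [G FG <-] [|Gp]]; first by left.
    by right; exists G.
  apply: pairing_bigcup; first by move=> _ [G FG <-]; apply: FP.
  move=> _ _ [G FG <-] [H FH <-].
  by have [GH|HG] := Ftot _ _ FG FH; [left|right]; apply: setUS.
have H0 : forall i, dom (G0 `|` G) (c i).
  move=> i; have /G0d[z Gz] : exists j, c i = c j by exists i.
  by exists z; left.
move: (GP) => [GI GD GE].
have [DC|CD] := card_le_totalset (dom (G0 `|` G)) (~` dom (G0 `|` G)).
  have [|G' [G'P GG' nG']] :=
      pairing_extend GP (H0 0) (H0 1) _ DC; first by move=> /cI.
  have G0G' : G0 `|` G' = G'.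
    by apply/setUidPr => p ?; apply: GG'; left.
  case: (Gmax G'); last by rewrite /= G0G'.
  split; first by move=> p ?; apply: GG'; right.
  by move=> G'G; apply: nG' => p /G'G; right.
pose D := dom (G0 `|` G).
have DD : [set p : T * T | D p.1 /\ D p.2] #<= D.
  apply/card_le_rel; exists (fun p z => (G0 `|` G) (p, z)); split.
    move=> [x y] [/= xD yD]; have [z Gz] := GE _ _ xD yD.
    by exists z; split=> //; have [] := GD _ _ _ Gz.
  by move=> p p' z _ _; apply: GI.
have TD : [set: T] #<= D.
  apply: card_le_trans DD.
  have [k [kD kI]] := card_le_funE (c 0) CD.
  have ck : c 0 <> c 1 by move=> /cI.
  pose f x := if pselect (D x) then (c 0, x) else (c 1, k x).
  apply: (@card_le_fun _ _ _ _ f) => [x _|x y _ _]; rewrite /f.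
    case: pselect => [xD|nxD]; split=> //=; try exact: H0.
    exact: kD.
  case: pselect => xD; case: pselect => yD [].
  - by [].
  - by move=> /ck.
  - by move=> /esym/ck.
  - by move=> /kI; apply.
apply: card_le_trans (card_leT D); apply: card_le_trans DD.
have [k [kD kI]] := card_le_funE (c 0) TD.
apply: (@card_le_fun _ _ _ _ (fun p => (k p.1, k p.2))).
  by move=> p _; split; apply: kD.
by move=> [x y] [x' y'] _ _ [/= /kI-> // /kI->].
Qed.

End CardinalSquare.

Section InfiniteType.

Variable T : Type.
Hypothesis Tinf : infinite_set [set: T].

Lemma card_le_countable (U : Type) (A : set U) :
  A #<= [set: nat] -> A #<= [set: T].
Proof. by move=> /card_le_trans; apply; apply/infiniteP. Qed.

Lemma card_le_bigcup (I U : Type) (D : set I) (F : I -> set U) :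
  D #<= [set: T] -> (forall i, D i -> F i #<= [set: T]) ->
  \bigcup_(i in D) F i #<= [set: T].
Proof.
have [c _] := infinite_natP Tinf.
move=> /(card_le_funE (c 0))[d [_ dI]] FT.
have ex i : exists f : U -> T, D i ->
    forall x y, F i x -> F i y -> f x = f y -> x = y.
  have [/FT/(card_le_funE (c 0))[f [_ fI]]|nD] := pselect (D i).
    by exists f.
  by exists (fun=> c 0).
pose f i := projT1 (cid (ex i)).
have fI i : D i -> forall x y, F i x -> F i y -> f i x = f i y -> x = y.
  by rewrite /f; case: cid.
apply: card_le_trans (card_square Tinf); apply/card_le_rel.
exists (fun x p => exists i, [/\ D i, F i x & p = (d i, f i x)]); split.
  by move=> x [i Di Fx]; exists (d i, f i x); split=> //; exists i.
move=> x y p _ _ [i [Di Fx ->]] [j [Dj Fy [/dI ij]]].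
by move: Fy; rewrite -ij// => Fy /fI; apply.
Qed.

Lemma card_le_setU (U : Type) (A B : set U) :
  A #<= [set: T] -> B #<= [set: T] -> A `|` B #<= [set: T].
Proof.
move=> AT BT.
have : \bigcup_(b in [set: bool]) (if b then A else B) #<= [set: T].
  apply: card_le_bigcup; last by case.
  exact/card_le_countable/countableP.
apply: card_le_trans; apply: subset_card_le => x [Ax|Bx].
  by exists true.
by exists false.
Qed.

Lemma card_le_add1 (U : Type) (A : set U) (x : U) :
  A #<= [set: T] -> [set y | A y \/ y = x] #<= [set: T].
Proof.
move=> AT; have : A `|` [set x] #<= [set: T].
  by apply: card_le_setU => //; apply/card_le_countable/countable1.
by apply: card_le_trans; apply: subset_card_le => y [?|->]; [left|right].
Qed.

(** A subset of size [T] is either bounded, and then a segment has size [T], or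
    cofinal, and then the segments below its elements cover everything. *)
Lemma card_le_short_segments (U : Type) (L : set U) (le : U -> U -> Prop) :
  (forall x y, L x -> L y -> le x y \/ le y x) ->
  (forall x, L x -> ~ ([set: T] #<= [set y | L y /\ le y x])) ->
  L #<= [set: T].
Proof.
move=> tot short; have [//|TL] := card_le_totalset L [set: T].
have [c _] := infinite_natP Tinf.
have [u0 Lu0] : exists u, L u.
  by have [R [Rt _]] := (card_le_rel _ _).1 TL; have [u []] := Rt (c 0) I; exists u.
have [g [gL gI]] := card_le_funE u0 TL.
have [[x Lx xg]|nb] :
    (exists2 x, L x & forall t, le (g t) x) \/
    (forall x, L x -> exists t, le x (g t)).
  have [|nb] := pselect (exists2 x, L x & forall t, le (g t) x); first by left.
  right=> x Lx; apply: contrapT => nt; apply: nb; exists x => // t.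
  by have [//|xt] := tot (g t) x (gL t I) Lx; case: nt; exists t.
  case: (short x Lx).
  apply: (@card_le_fun _ _ _ _ g) => [t _|t t' _ _ /gI]; last exact.
  by split; [apply: gL|].
have : \bigcup_(t in [set: T]) [set y | L y /\ le y (g t)] #<= [set: T].
  apply: card_le_bigcup => // t _.
  exact: not_card_leW (short _ (gL t I)).
apply: card_le_trans; apply: subset_card_le => x Lx.
by have [t ?] := nb x Lx; exists t.
Qed.

End InfiniteType.

Lemma infinite_of_no_last (T : Type) (P : T -> Prop) (lt : T -> T -> Prop) :
  (forall x, ~ lt x x) -> (forall x y z, lt x y -> lt y z -> lt x z) ->
  (exists x, P x) -> (forall x, P x -> exists y, P y /\ lt x y) ->
  infinite_set [set: T].
Proof.
move=> irr tr [x0 Px0] nolast.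
have ex x : exists y, P x -> P y /\ lt x y.
  by have [/nolast[y ?]|nP] := pselect (P x); [exists y|exists x].
pose next x := projT1 (cid (ex x)).
have nextP x : P x -> P (next x) /\ lt x (next x) by rewrite /next; case: cid.
pose f k := iter k next x0.
have fP k : P (f k) by elim: k => //= k /nextP[].
have flt i j : i < j -> lt (f i) (f j).
  elim: j => // j IH; have fS := (nextP _ (fP j)).2.
  by rewrite ltnS leq_eqVlt => /predU1P[->//|/IH/tr]; apply.
apply/infiniteP/card_leTP; exists f => i j fij.
by case: (ltngtP i j) => // /flt; rewrite fij => /irr.
Qed.

(** [B] is not below [T], so it is infinite and absorbs [A]. *)
Lemma card_lt_setU (T U : Type) (A B : set U) : infinite_set [set: T] ->
  A `|` B = [set: U] -> [set: T] #<= [set: U] -> A #<= [set: T] ->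
  ~ ([set: U] #<= [set: T]) -> [set: U] #<= B.
Proof.
move=> Tinf AB TU AT UT.
have [BT|TB] := card_le_totalset B [set: T].
  by case: UT; rewrite -AB; apply: card_le_setU.
have BTI : infinite_set [set: B].
  apply/infiniteP; rewrite (card_le_eqr (card_setT B)).
  by apply: card_le_trans TB; apply/infiniteP.
rewrite -(card_le_eqr (card_setT B)) -AB; apply: card_le_setU => //.
  by rewrite (card_le_eqr (card_setT B)); apply: card_le_trans TB.
by rewrite (card_le_eqr (card_setT B)).
Qed.

(** * The alephs *)

Lemma card_succ_le (T U : Type) (A : set U) :
  ~ ([set: card_succ T] #<= A) -> A #<= [set: T].
Proof.
move=> sA; apply: contrapT => AT; apply: sA.
rewrite -(card_le_eqr (card_setT A)); apply: (card_succP T).2.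
by rewrite (card_le_eql (card_setT A)).
Qed.

Lemma card_succ_gt (T U : Type) (A : set U) :
  A #<= [set: T] -> ~ ([set: card_succ T] #<= A).
Proof. by move=> AT /card_le_trans/(_ AT); apply: (card_succP T).1. Qed.

Lemma card_powerset_gt (T : Type) : ~ ([set: set T] #<= [set: T]).
Proof.
move=> /card_leTP[f fI]; pose A := [set f B | B in [set B | ~ B (f B)]].
have [AfA|nAfA] := pselect (A (f A)); last by apply: (nAfA); exists A.
by have [B /= BfB /fI BA] := AfA; apply: BfB; rewrite BA.
Qed.

Lemma aleph_leS n : [set: aleph n] #<= [set: aleph n.+1].
Proof. exact/not_card_leW/(card_succP _).1. Qed.

Lemma aleph_le m n : m <= n -> [set: aleph m] #<= [set: aleph n].
Proof.
elim: n => [|n IH]; first by rewrite leqn0 => /eqP->.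
rewrite leq_eqVlt => /predU1P[->//|/IH mn].
exact: card_le_trans (aleph_leS n).
Qed.

Lemma aleph_infinite n : infinite_set [set: aleph n].
Proof. exact/infiniteP/(aleph_le (leq0n n)). Qed.

(** * Well-orders *)

Section WellOrder.

Variables (T : Type) (r : rel T).
Hypothesis wo : well_order r.

Lemma wo_least (P : set T) : P !=set0 -> exists2 x, P x & forall y, P y -> r x y.
Proof.
move=> [x Px]; have [|y [[yP ymin] _]] := wo (A := [pred x | `[< P x >]]).
  by exists x; apply/asboolP.
exists y; first exact/asboolP/yP.
by move=> z Pz; apply: ymin; apply/asboolP.
Qed.

Lemma wo_total x y : r x y \/ r y x.
Proof.
have [|z] := @wo_least [set z | z = x \/ z = y]; first by exists x; left.
by case=> -> h; [left|right]; apply: h; [right|left].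
Qed.

Lemma wo_refl x : r x x.
Proof. by case: (wo_total x x). Qed.

Lemma wo_antisym x y : r x y -> r y x -> x = y.
Proof.
move=> xy yx.
have [|z [_ u]] := wo (A := [pred z | `[< z = x \/ z = y >]]).
  by exists x; apply/asboolP; left.
have zx : z = x.
  apply: u; split; first by apply/asboolP; left.
  by move=> w /asboolP[]->//; apply: wo_refl.
have zy : z = y.
  apply: u; split; first by apply/asboolP; right.
  by move=> w /asboolP[]->//; apply: wo_refl.
by rewrite -zx.
Qed.

Lemma wo_trans x y z : r x y -> r y z -> r x z.
Proof.
move=> xy yz.
have [|w] := @wo_least [set w | [\/ w = x, w = y | w = z]].
  by exists x; constructor 1.
case=> -> h.
- by apply: h; constructor 3.
- by rewrite (wo_antisym xy)//; apply: h; constructor 1.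
- by rewrite -(wo_antisym yz)//; apply: h; constructor 2.
Qed.

Lemma slt_def x y : slt r x y <-> r x y /\ x <> y.
Proof.
rewrite /slt; split=> [/andP[xy yx]|[xy nxy]].
  by split=> // e; move: yx; rewrite e wo_refl.
by rewrite xy; apply/negP => yx; apply: nxy; apply: wo_antisym.
Qed.

Lemma slt_wo_irr x : ~ slt r x x. Proof. by move=> /slt_def[]. Qed.

Lemma slt_wo_trans x y z : slt r x y -> slt r y z -> slt r x z.
Proof.
move=> /slt_def[xy nxy] /slt_def[yz nyz]; apply/slt_def; split.
  exact: wo_trans yz.
by move=> e; apply: nyz; apply: wo_antisym => //; rewrite -e.
Qed.

Lemma slt_wo_total x y : [\/ slt r x y, x = y | slt r y x].
Proof.
have [->|xy] := pselect (x = y); first by constructor 2.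
have [h|h] := wo_total x y.
  by constructor 1; apply/slt_def.
by constructor 3; apply/slt_def; split=> // e; apply: xy.
Qed.

Lemma sltW x y : slt r x y -> r x y. Proof. by case/slt_def. Qed.

Lemma sltNge x y : slt r x y <-> ~ r y x.
Proof.
split=> [/andP[_ /negP]//|yx]; apply/slt_def; split.
  by have [] := wo_total x y.
by move=> e; apply: yx; rewrite e wo_refl.
Qed.

Lemma wo_ind (P : T -> Prop) :
  (forall x, (forall y, slt r y x -> P y) -> P x) -> forall x, P x.
Proof.
move=> IH; apply: contrapT => /existsNP nP.
have [x nPx xmin] := wo_least nP; apply: nPx; apply: IH => y yx.
by apply: contrapT => /xmin xy; move: yx => /sltNge.
Qed.

End WellOrder.

Lemma well_orderI (T : Type) (r : rel T) :
  (forall x y, r x y -> r y x -> x = y) ->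
  (forall P : set T, P !=set0 -> exists2 x, P x & forall y, P y -> r x y) ->
  well_order r.
Proof.
move=> anti least A [a Aa]; have [|x Ax xmin] := least [set x | x \in A].
  by exists a.
exists x; split=> [|y [Ay ymin]]; first by split.
by apply: anti; [apply: xmin|apply: ymin].
Qed.

Lemma well_order_pullback (T U : Type) (r : rel U) (f : T -> U) :
  well_order r -> injective f -> well_order (fun x y => r (f x) (f y)).
Proof.
move=> wo fI; apply: well_orderI => [x y xy yx|P [x Px]].
  by apply: fI; apply: (wo_antisym wo).
have [|_ [y Py <-] ymin] := wo_least wo (P := f @` P).
  by exists (f x); exists x.
by exists y => // z Pz; apply: ymin; exists z.
Qed.

(** The least initial segment of a well-order that is as large as [T] receives an
    injection of [T]; pulling the order back along it, onto or not, makes the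
    initial segments smaller than [T]. *)
Lemma initial_order_exists (T : Type) : exists r : rel T, initial_order r.
Proof.
have [r wo] := well_ordering_principle {classic T}.
have [[a Ta]|nT] := pselect (exists a, [set: T] #<= below r a); last first.
  by exists r; split=> // a Ta; apply: nT; exists a.
have [|b Tb bmin] := wo_least wo (P := [set a | [set: T] #<= below r a]).
  by exists a.
have [f [fb fI]] := card_le_funE a Tb.
have {}fI : injective f by move=> x y /fI; apply.
exists (fun x y => r (f x) (f y)); split; first exact: well_order_pullback fI.
move=> x Tx; suff : [set: T] #<= below r (f x).
  by move=> /bmin bx; have /(sltNge wo) := fb x I.
apply: card_le_trans Tx _.
by apply: (@card_le_fun _ _ _ _ f) => // y z _ _ /fI.
Qed.

(** * Structures for the vocabulary of psi, and the meaning of psi *)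

Section Presentation.

Variable alpha : cordinal.

(** The interpretations of the symbols, with uncurried arguments: this is what
    constructions of models manipulate. *)
Record interp (U : Type) := Interp {
  i_zero : U;
  i_c : nat -> U;
  i_L : label alpha -> U -> Prop;
  i_lt : pos_label alpha -> U -> U -> Prop;
  i_F : osucc alpha -> U -> U -> U -> Prop;
  i_G : U -> U -> U -> Prop;
  i_S : U -> U -> Prop;
  i_V : U -> U -> Prop;
  i_T : U -> U -> Prop }.

Definition to_structure (U : Type) (D : interp U) : structure (psi_voc alpha) :=
  @Structure (psi_voc alpha) U
    (fun c => match c with zero_symb => i_zero D | c_symb n => i_c D n end)
    (fun R => match R return (psi_arity R).-tuple U -> Prop with
     | L_symb b => fun v => i_L D b (nth (i_zero D) v 0)
     | lt_symb b => fun v => i_lt D b (nth (i_zero D) v 0) (nth (i_zero D) v 1)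
     | F_symb b => fun v => i_F D b (nth (i_zero D) v 0) (nth (i_zero D) v 1)
                                    (nth (i_zero D) v 2)
     | G_symb => fun v => i_G D (nth (i_zero D) v 0) (nth (i_zero D) v 1)
                                (nth (i_zero D) v 2)
     | S_symb => fun v => i_S D (nth (i_zero D) v 0) (nth (i_zero D) v 1)
     | V_symb => fun v => i_V D (nth (i_zero D) v 0) (nth (i_zero D) v 1)
     | T_symb => fun v => i_T D (nth (i_zero D) v 0) (nth (i_zero D) v 1)
     end).

(** So only structures given by an [interp] need to be considered. *)
Lemma to_structure_surj (M : structure (psi_voc alpha)) :
  exists (U : Type) (D : interp U), M = to_structure D.
Proof.
case: M => U c R /=; exists U.
exists (@Interp U (c zero_symb) (c \o c_symb)
  (fun b x => R (L_symb b) [tuple x]) (fun b x y => R (lt_symb b) [tuple x; y])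
  (fun b x y z => R (F_symb b) [tuple x; y; z])
  (fun x y z => R (G_symb _) [tuple x; y; z]) (fun x y => R (S_symb _) [tuple x; y])
  (fun x y => R (V_symb _) [tuple x; y]) (fun x y => R (T_symb _) [tuple x; y])).
congr Structure; first by apply/funext => -[].
apply: functional_extensionality_dep => -[b|b|b||||] /=;
  apply/funext; move=> [[|x [|y [|z [|w s]]]] sz] //=;
  by congr (R _ _); apply/val_inj.
Qed.

Section Semantics.

Variables (U : Type) (D : interp U).

Definition linear_order (L : U -> Prop) (lt : U -> U -> Prop) :=
  [/\ forall x y, lt x y -> L x /\ L y, forall x, ~ lt x x,
      forall x y z, lt x y -> lt y z -> lt x z &
      forall x y, L x -> L y -> [\/ x = y, lt x y | lt y x]].

Definition surjection (R : U -> U -> Prop) (A B : U -> Prop) :=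
  [/\ forall y z, R y z -> A y /\ B z, forall y, A y -> exists z, R y z,
      forall y z w, R y z -> R y w -> z = w & forall z, B z -> exists y, R y z].

Definition top_lt := i_lt D (palpha1 alpha).
Definition nonmax x := exists w, top_lt x w.
Definition limit x := x <> i_zero D /\ ~ exists w, i_S D w x.
Definition segment (b : pos_label alpha) u s :=
  i_L D (val b) s /\ (s = u \/ i_lt D b s u).
(** The [x] for which [F] enumerates the segment below [x]: the maximum of
    [L_(alpha+1)] is excepted, which is what allows it to have many predecessors
    and a large level. *)
Definition enumerated (b : label alpha) x :=
  i_L D b x /\ (b = @alpha1 alpha -> nonmax x).

(** The requirements of psi, where the requirement that every element lies in
    some [L_b] or [V(a)] is relativized to [W]: this leaves room for elements that
    are put into these sets later.  Through [enumerated], the requirement on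
    [F_alpha] is an instance of the one on the other [F_b]. *)
Record good_on (W : U -> Prop) : Prop := GoodOn {
  g_order : forall b, linear_order (i_L D (val b)) (i_lt D b);
  g_zero : i_L D (@alpha1 alpha) (i_zero D);
  g_min : forall x, i_L D (@alpha1 alpha) x -> x = i_zero D \/ top_lt (i_zero D) x;
  g_S : forall x y, i_S D x y <->
    top_lt x y /\ ~ exists z, top_lt x z /\ top_lt z y;
  g_succ : forall x, nonmax x -> exists y, i_S D x y;
  g_max : forall x, i_L D (@alpha1 alpha) x -> ~ nonmax x -> limit x;
  g_VL : forall a x, i_V D a x -> i_L D (@alpha1 alpha) a;
  g_V_notL : forall a x b, i_V D a x -> ~ i_L D b x;
  g_V_fun : forall a b x, i_V D a x -> i_V D b x -> a = b;
  g_cover : forall x, W x -> (exists b, i_L D b x) \/ exists a, i_V D a x;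
  g_TV : forall x y, i_T D x y ->
    exists a b, [/\ i_V D a x, i_V D b y & top_lt a b];
  g_T_trans : forall x y z, i_T D x y -> i_T D y z -> i_T D x z;
  g_T_tree : forall x y z, i_T D x z -> i_T D y z ->
    [\/ x = y, i_T D x y | i_T D y x];
  g_T_pred : forall a b y, i_V D a y -> top_lt b a ->
    exists x, i_V D b x /\ i_T D x y;
  g_T_limit : forall a x y, i_L D (@alpha1 alpha) a -> limit a ->
    i_V D a x -> i_V D a y -> (forall z, i_T D z x <-> i_T D z y) -> x = y;
  g_T_pruned : forall a b x, i_V D a x -> top_lt a b ->
    exists y, i_V D b y /\ i_T D x y;
  g_L0 : forall b, ~~ label_pos b -> forall x, i_L D b x <-> exists n, x = i_c D n;
  g_c_inj : injective (i_c D);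
  g_Llim : forall b, label_limit b -> forall x,
    i_L D b x <-> exists2 c, label_lt c b & i_L D c x;
  g_F_dom : forall (b : osucc alpha) (b1 : pos_label alpha),
    @label_succ alpha (Some b) (val b1) ->
    forall x y z, i_F D b x y z -> enumerated (val b1) x;
  g_F : forall (b : osucc alpha) (b1 : pos_label alpha),
    @label_succ alpha (Some b) (val b1) ->
    forall x, enumerated (val b1) x ->
    surjection (i_F D b x) (i_L D (Some b)) (segment b1 x);
  g_G_dom : forall x y z, i_G D x y z -> enumerated (@alpha1 alpha) x;
  g_G : forall x, enumerated (@alpha1 alpha) x ->
    surjection (i_G D x) (i_L D (alpha0 alpha)) (i_V D x) }.

Definition good := good_on (fun=> True).

End Semantics.

Lemma label_succ_alpha : @label_succ alpha (@alpha0 alpha) (@alpha1 alpha).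
Proof.
by apply/asboolP; split=> // -[[[d|]|] []].
Qed.

Lemma label_succ_alphaE (b : osucc alpha) :
  @label_succ alpha (Some b) None -> b = None.
Proof.
case: b => // b /asboolP[_ []]; exists (Some None); split=> //.
Qed.

Lemma alpha_top_succ (b : label alpha) : label_succ (@alpha0 alpha) b -> b = None.
Proof. by case: b => // b /asboolP[]; rewrite /label_lt /slt /=; case: b. Qed.

Lemma palpha1E (b : pos_label alpha) : val b = None -> b = palpha1 alpha.
Proof. by move=> bE; apply/val_inj. Qed.

Lemma linear_orderP (U : Type) (L : U -> Prop) (lt : U -> U -> Prop) :
  linear_order L lt <->
  (forall x y, lt x y -> L x /\ L y) /\ (forall x, ~ lt x x) /\
  (forall x y z, lt x y /\ lt y z -> lt x z) /\
  (forall x y, L x /\ L y -> x = y \/ lt x y \/ lt y x).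
Proof.
split=> [[h1 h2 h3 h4]|[h1 [h2 [h3 h4]]]].
  split=> //; split=> //; split; first by move=> x y z []; apply: h3.
  by move=> x y [Lx Ly]; case: (h4 x y Lx Ly); auto.
split=> // [x y z xy yz|x y Lx Ly]; first exact: (h3 x y z).
by case: (h4 x y (conj Lx Ly)) => [|[]]; [constructor 1|constructor 2|constructor 3].
Qed.

Lemma surjectionP (U : Type) (R : U -> U -> Prop) (A B : U -> Prop) :
  surjection R A B <->
  (forall y z, R y z -> A y /\ B z) /\ (forall y, A y -> exists z, R y z) /\
  (forall y z w, R y z /\ R y w -> z = w) /\ (forall z, B z -> exists y, R y z).
Proof.
split=> [[h1 h2 h3 h4]|[h1 [h2 [h3 h4]]]].
  by split=> //; split=> //; split=> // y z w []; apply: h3.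
by split=> // y z w yz yw; apply: (h3 y).
Qed.

Lemma models_good (U : Type) (D : interp U) :
  models (to_structure D) (psi alpha) <-> good D.
Proof.
split=> [/(_ (fun=> i_zero D))|h v].
  move=> [ha [hb [hc [hd [he [hf hg]]]]]].
  move: ha => [ha1 [ha2 [ha3 [ha4 [ha5 ha6]]]]].
  move: hb => [hb1 [hb2 [hb3 hb4]]].
  move: hc => [hc1 [hc2 [hc3 [hc4 [hc5 hc6]]]]].
  move: hd => [hd1 hd2]; move: he => [he1 he2]; move: hg => [hg1 hg2].
  split.
  - move=> b; have [/palpha1E->|bE] := pselect (val b = None).
      exact/linear_orderP/ha1.
    apply/linear_orderP; have /eqP/= bE' := bE.
    exact: (he1 (exist _ b bE')).
  - exact: ha2.
  - exact: ha3.
  - exact: ha4.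
  - move=> x [y xy]; apply: (ha5 x); split; last by exists y.
    exact: (ha1.1 _ _ xy).1.
  - by move=> x Lx nx; apply: (ha6 x).
  - exact: hb1.
  - by move=> a x b Vx; apply: (hb2 a x Vx b).
  - by move=> a b x Vax Vbx; apply: (hb3 a b x).
  - by move=> x _; apply: (hb4 x).
  - by move=> x y /(hc1 x y)[a [b [? [? ?]]]]; exists a, b.
  - by move=> x y z xy yz; apply: (hc2 x y z).
  - move=> x y z xy yz; case: (hc3 x y z (conj xy yz)) => [|[]].
    + by constructor 1.
    + by constructor 2.
    + by constructor 3.
  - by move=> a b y Vy ba; apply: (hc4 a b y).
  - by move=> a x y La la Vx Vy xy; apply: (hc5 a x y).
  - by move=> a b x Vx ab; apply: (hc6 a b x).
  - by move=> b b0; apply: (hd1 (exist _ b b0)).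
  - move=> i j ij; apply/eqP/negP => /negP nij.
    exact: (hd2 (exist _ (i, j) nij)).
  - move=> b bl x; apply: (iff_trans (he2 (exist _ b bl) x)).
    split=> [[[c cb] Lx]|[c cb Lx]]; first by exists c.
    by exists (exist _ c cb).
  - case=> [b|] b1 bb1 x y z h.
      have [h1 h2] := hf (exist _ (b, b1) bb1); split; first exact: (h1 x y z).
      by move=> E; have := bb1; rewrite E => /label_succ_alphaE.
    by have [] := hg1 x y z (or_introl h);
      rewrite (alpha_top_succ bb1).
  - case=> [b|] b1 bb1 x [Lx nx].
      have [h1 h2] := hf (exist _ (b, b1) bb1); apply/surjectionP.
      exact: (h2 x).
    move: Lx nx; have E := palpha1E (alpha_top_succ bb1); rewrite E => Lx nx.
    apply/surjectionP; apply: (hg2 x _).1; split=> //; exact: nx.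
  - by move=> x y z h; have [] := hg1 x y z (or_intror h).
  - move=> x [Lx nx]; apply/surjectionP; apply: (hg2 x _).2; split=> //.
    exact: nx.
case: h => h1 h2 h3 h4 h5 h6 h7 h8 h9 h10 h11 h12 h13 h14 h15 h16 h17 h18 h19.
move=> h20 h21 h22 h23.
split; first split; first exact/linear_orderP/h1.
  split; first exact: h2.
  split; first exact: h3.
  split; first exact: h4.
  split; first by move=> x [_ nx]; apply: h5.
  by move=> x [Lx nx]; apply: h6.
split; first split; first exact: h7.
  split; first by move=> a x Vx b; apply: (h8 a).
  split; first by move=> a b x [Vax Vbx]; apply: h9 Vbx.
  by move=> x; apply: h10.
split; first split.
    by move=> x y /h11[a [b [? ? ?]]]; exists a, b.
  split; first by move=> x y z [xy yz]; apply: h12 yz.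
  split.
    move=> x y z [xy yz]; case: (h13 _ _ _ xy yz) => ?; [left|right|right] => //.
      by left.
    by right.
  split; first by move=> a b y [Vy ba]; apply: h14 Vy ba.
  split; first by move=> a x y [La [la [Vx [Vy xy]]]]; apply: (h15 a).
  by move=> a b x [Vx ab]; apply: h16 ab.
split; first split.
    by move=> [b b0] x; apply: (h17 b b0).
  by move=> [[i j] ij] /h18 /= E; have := ij; rewrite /= E eqxx.
split; first split.
    by move=> [b b0]; apply/linear_orderP; apply: h1.
  move=> [b bl] x; apply: (iff_trans (h19 b bl x)).
  split=> [[c cb Lx]|[[c cb] Lx]]; last by exists c.
  by exists (exist _ c cb).
split.
  move=> [[b b1] /= bb1]; split.
    by move=> x y z h; have [] := h20 _ _ bb1 _ _ _ h.
  move=> x Lx; have : enumerated D (val b1) x.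
    by split=> // E; have := bb1; rewrite E => /label_succ_alphaE.
  by move=> /(h21 _ _ bb1)/surjectionP.
split.
  move=> x y z [h|/h22[Lx nx]]; last by split=> //; exact: nx.
  have [Lx nx] := h20 None (palpha1 alpha) label_succ_alpha x y z h.
  by split=> //; exact: nx.
move=> x [Lx nx]; have xE : enumerated D (@alpha1 alpha) x by [].
by split; [have /surjectionP := h21 None (palpha1 alpha) label_succ_alpha x xE|
  have /surjectionP := h23 x xE].
Qed.

Record interp_embedding (U W : Type) (D : interp U) (E : interp W)
    (f : U -> W) : Prop := InterpEmbedding {
  e_inj : injective f;
  e_zero : f (i_zero D) = i_zero E;
  e_c : forall n, f (i_c D n) = i_c E n;
  e_L : forall b x, i_L D b x <-> i_L E b (f x);
  e_lt : forall b x y, i_lt D b x y <-> i_lt E b (f x) (f y);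
  e_F : forall b x y z, i_F D b x y z <-> i_F E b (f x) (f y) (f z);
  e_G : forall x y z, i_G D x y z <-> i_G E (f x) (f y) (f z);
  e_S : forall x y, i_S D x y <-> i_S E (f x) (f y);
  e_V : forall x y, i_V D x y <-> i_V E (f x) (f y);
  e_T : forall x y, i_T D x y <-> i_T E (f x) (f y) }.

Lemma embeddingE (U W : Type) (D : interp U) (E : interp W) (f : U -> W) :
  @embedding _ (to_structure D) (to_structure E) f <-> interp_embedding D E f.
Proof.
split=> [[fI fc fR]|[fI f0 fc fL flt fF fG fS fV fT]].
  split=> //.
  - exact: (fc zero_symb).
  - by move=> n; apply: (fc (c_symb n)).
  - by move=> b x; apply: (fR (L_symb b) [tuple x]).
  - by move=> b x y; apply: (fR (lt_symb b) [tuple x; y]).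
  - by move=> b x y z; apply: (fR (F_symb b) [tuple x; y; z]).
  - by move=> x y z; apply: (fR (G_symb _) [tuple x; y; z]).
  - by move=> x y; apply: (fR (S_symb _) [tuple x; y]).
  - by move=> x y; apply: (fR (V_symb _) [tuple x; y]).
  - by move=> x y; apply: (fR (T_symb _) [tuple x; y]).
split=> //; first by case.
by case=> [b|b|b||||] [[|x [|y [|z [|w s]]]] sz] //=.
Qed.

End Presentation.

(** * Labels *)

Section Labels.

Variable alpha : cordinal.
Implicit Types b c d : label alpha.

Let wo := @ord_wo (osucc (osucc alpha)).

Lemma label_lt_irr b : ~ label_lt b b. Proof. exact: slt_wo_irr. Qed.

Lemma label_lt_trans b c d : label_lt b c -> label_lt c d -> label_lt b d.
Proof. exact: slt_wo_trans. Qed.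

Lemma label_lt_total b c : [\/ label_lt b c, b = c | label_lt c b].
Proof. exact: slt_wo_total. Qed.

Lemma label_ind (P : label alpha -> Prop) :
  (forall b, (forall c, label_lt c b -> P c) -> P b) -> forall b, P b.
Proof. exact: (wo_ind wo). Qed.

Lemma label_least (P : label alpha -> Prop) : (exists b, P b) ->
  exists2 b, P b & forall c, P c -> ~ label_lt c b.
Proof.
move=> /(wo_least wo)[b Pb bmin]; exists b => // c /bmin bc.
by move=> /(sltNge wo).
Qed.

Lemma label_posP b : label_pos b <-> exists c, label_lt c b.
Proof. by split=> /asboolP. Qed.

Lemma label_succP b c : label_succ b c <->
  label_lt b c /\ forall d, label_lt d c -> label_lt d b \/ d = b.
Proof.
split=> [/asboolP[bc nb]|[bc h]].
  split=> // d dc; case: (label_lt_total d b) => [|->|bd]; [by left|by right|].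
  by case: nb; exists d.
apply/asboolP; split=> // -[d [bd /h[db|db]]].
  exact: (label_lt_irr (label_lt_trans bd db)).
by move: bd; rewrite db; apply: label_lt_irr.
Qed.

Lemma label_succ_lt b c : label_succ b c -> label_lt b c.
Proof. by case/label_succP. Qed.

Lemma label_succ_pos b c : label_succ b c -> label_pos c.
Proof. by move=> /label_succ_lt bc; apply/label_posP; exists b. Qed.

Lemma label_succ_fun b c d : label_succ b c -> label_succ b d -> c = d.
Proof.
move=> /label_succP[bc hc] /label_succP[bd hd].
have h e e' : label_lt b e -> label_lt e e' ->
    (forall d, label_lt d e' -> label_lt d b \/ d = b) -> False.
  move=> be ee' he; case: (he _ ee') => [eb|E].
    exact: (label_lt_irr (label_lt_trans be eb)).
  by move: be; rewrite E; apply: label_lt_irr.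
by case: (label_lt_total c d) => // ?; [case: (h c d)|case: (h d c)].
Qed.

Lemma label_succ_inj b b' c : label_succ b c -> label_succ b' c -> b = b'.
Proof.
move=> /label_succP[bc h] /label_succP[bc' h'].
case: (h _ bc') => [b'b|//]; case: (h' _ bc) => [bb'|//].
by case: (label_lt_irr (label_lt_trans bb' b'b)).
Qed.

Lemma label_succ_exists (b : osucc alpha) :
  exists c : pos_label alpha, @label_succ alpha (Some b) (val c).
Proof.
have [|c bc cmin] := @label_least (label_lt (Some b)).
  by exists None.
have bcS : label_succ (Some b) c.
  apply/label_succP; split=> // d dc.
  case: (label_lt_total d (Some b)) => [|->|/cmin//]; [by left|by right].
by exists (exist _ c (label_succ_pos bcS)).
Qed.

Lemma label_cases b :
  [\/ ~~ label_pos b, exists c, label_succ c b | label_limit b].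
Proof.
have [bp|] := boolP (label_pos b); last by constructor 1.
have [|nS] := pselect (exists c, label_succ c b); first by constructor 2.
by constructor 3; rewrite /label_limit bp; apply/asboolP.
Qed.

Lemma label_limit_pos b : label_limit b -> label_pos b.
Proof. by case/andP. Qed.

Lemma label_limit_succ b c : label_succ b c -> ~ label_limit c.
Proof. by move=> bc /andP[_ /asboolP]; apply; exists b. Qed.

Lemma label_zero_exists : exists b, ~~ label_pos b.
Proof.
have [|b _ bmin] := @label_least (fun=> True); first by exists None.
exists b; apply/negP => /label_posP[c cb]; exact: (bmin c).
Qed.

Lemma label_limit_succ_lt b c d :
  label_limit c -> label_lt b c -> label_succ b d -> label_lt d c.
Proof.
move=> cl bc bd; case: (label_lt_total d c) => // [dc|cd].
  by case: (label_limit_succ bd); rewrite dc.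
have /label_succP[_ /(_ _ cd)[cb|cb]] := bd.
  by case: (label_lt_irr (label_lt_trans bc cb)).
by move: bc; rewrite cb => /label_lt_irr.
Qed.

Lemma label_zero_lt b c : ~~ label_pos b -> label_pos c -> label_lt b c.
Proof.
move=> b0 cp; case: (label_lt_total b c) => // [E|cb].
  by move: b0; rewrite E cp.
by case/negP: b0; apply/label_posP; exists c.
Qed.

Lemma alpha1_not_limit : ~ label_limit (@alpha1 alpha).
Proof. exact: label_limit_succ (label_succ_alpha alpha). Qed.

Lemma alpha1_no_succ b : ~ label_succ (@alpha1 alpha) b.
Proof. by move=> /label_succ_lt; case: b. Qed.

Lemma label_le_alpha0 b : b <> None -> label_lt b (@alpha0 alpha) \/ b = @alpha0 alpha.
Proof.
move=> bN; have /label_succP[_] := label_succ_alpha alpha; apply.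
by case: b bN.
Qed.

End Labels.

(** * Basic facts about models of psi *)

Section GoodFacts.

Variables (alpha : cordinal) (U : Type) (D : interp alpha U) (W : U -> Prop).
Hypothesis gD : good_on D W.

Lemma top_ltL x y : top_lt D x y -> i_L D None x /\ i_L D None y.
Proof. by have [h _ _ _] := g_order gD (palpha1 alpha); apply: h. Qed.

Lemma top_lt_irr x : ~ top_lt D x x.
Proof. by have [_ h _ _] := g_order gD (palpha1 alpha); apply: h. Qed.

Lemma top_lt_trans x y z : top_lt D x y -> top_lt D y z -> top_lt D x z.
Proof. by have [_ _ h _] := g_order gD (palpha1 alpha); apply: h. Qed.

Lemma top_lt_total x y : i_L D None x -> i_L D None y ->
  [\/ x = y, top_lt D x y | top_lt D y x].
Proof. by have [_ _ _ h] := g_order gD (palpha1 alpha); apply: h. Qed.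

Lemma enumerated_top x : enumerated D None x <-> nonmax D x.
Proof.
split=> [[_]|nx]; first exact.
by split=> //; have [y /top_ltL[]] := nx.
Qed.

Lemma zero_nonmax : nonmax D (i_zero D).
Proof. by apply: contrapT => /(g_max gD (g_zero gD))[]. Qed.

Lemma top_F x : nonmax D x ->
  surjection (i_F D None x) (i_L D (alpha0 alpha)) (segment D (palpha1 alpha) x).
Proof.
move=> /enumerated_top xe; apply: (g_F gD (b1 := palpha1 alpha)) => //.
exact: label_succ_alpha.
Qed.

Lemma top_G x : nonmax D x ->
  surjection (i_G D x) (i_L D (alpha0 alpha)) (i_V D x).
Proof. by move=> /enumerated_top xe; apply: (g_G gD). Qed.

Lemma alpha0_nonempty : exists x, i_L D (alpha0 alpha) x.
Proof.
have [h _ _ s] := top_F zero_nonmax.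
have [|y /h[]] := s (i_zero D); last by exists y.
by split; [apply: (g_zero gD)|left].
Qed.

Lemma level_nonempty x : nonmax D x -> exists y, i_V D x y.
Proof.
move=> /top_G[h t _ _]; have [z /t[y /h[_ ?]]] := alpha0_nonempty.
by exists y.
Qed.

End GoodFacts.

(** * Adjoining an element to some of the sets L_b *)

Section Adjoin.

Variables (alpha : cordinal) (U : Type) (D : interp alpha U) (W : U -> Prop).
Variables (x : U) (B : label alpha -> Prop) (c' : nat -> U)
  (Fx : U -> U -> Prop).

Definition adjoin_L b y := i_L D b y \/ (B b /\ y = x).

Hypothesis gD : good_on D W.
Hypothesis xV : forall a, ~ i_V D a x.
Hypothesis cover : forall y, W y \/ (exists b, adjoin_L b y).
Hypothesis B_top : ~ B None.
Hypothesis B_lim : forall b, label_limit b ->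
  (B b <-> exists2 c, label_lt c b & B c).
Hypothesis c'_inj : injective c'.
Hypothesis c'E : forall b, ~~ label_pos b ->
  forall y, adjoin_L b y <-> exists n, y = c' n.
Hypothesis B_new : forall b b1, label_succ b b1 -> B b1 ->
  [/\ ~~ label_pos b, ~ i_L D b1 x & surjection Fx (adjoin_L b) (adjoin_L b1)].

Let pick : exists p : U -> U, forall u, nonmax D u -> i_V D u (p u).
Proof.
have ex u : exists v, nonmax D u -> i_V D u v.
  have [/(level_nonempty gD)[v ?]|nu] := pselect (nonmax D u); first by exists v.
  by exists u.
by exists (fun u => projT1 (cid (ex u))) => u; case: cid.
Qed.

Let p := projT1 (cid pick).
Let pP u : nonmax D u -> i_V D u (p u).
Proof. by rewrite /p; case: cid => q /=; apply. Qed.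

(** The new element [x] goes on top of [L_b] for [b] in [B].  Where [L_b]
    parametrizes other sets, [x] is mapped to an old value, so that nothing else
    changes; only the segment below [x] itself needs a new enumeration [Fx]. *)
Definition adjoin_interp : interp alpha U := Interp (i_zero D) c' adjoin_L
  (fun b y z => i_lt D b y z \/
     [/\ B (val b), ~ i_L D (val b) x, i_L D (val b) y & z = x])
  (fun b u y z => [\/ i_F D b u y z,
     [/\ B (Some b), ~ i_L D (Some b) x, y = x, z = u &
       exists2 b1, label_succ (Some b) b1 & enumerated D b1 u] |
     exists b1, [/\ label_succ (Some b) b1, B b1, u = x & Fx y z]])
  (fun u y z => i_G D u y z \/
     [/\ B (@alpha0 alpha), ~ i_L D (@alpha0 alpha) x, y = x, nonmax D u & z = p u])
  (i_S D) (i_V D) (i_T D).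

Let D' := adjoin_interp.

Let L_top y : i_L D' None y <-> i_L D None y.
Proof. by split=> [|?]; [case=> // -[/B_top]|left]. Qed.

Let lt_top y z : top_lt D' y z <-> top_lt D y z.
Proof. by split=> [|?]; [case=> // -[/B_top]|left]. Qed.

Let nonmaxE y : nonmax D' y <-> nonmax D y.
Proof. by split=> -[z /lt_top ?]; exists z. Qed.

Let limitE y : limit D' y <-> limit D y.
Proof. by []. Qed.

Let linear b : linear_order (i_L D' (val b)) (i_lt D' b).
Proof.
have [hL hI hT hC] := g_order gD b; split.
- move=> y z [/hL[? ?]|[Bb nx Ly ->]]; first by split; left.
  by split; [left|right].
- by move=> y [/hI|[_ nx Ly yx]] //; apply: nx; rewrite -yx.
- move=> y z w [yz|[Bb nx Ly ->]] [zw|[Bb' nx' Lz wx]].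
  + by left; apply: hT zw.
  + by right; split=> //; have [] := hL _ _ yz.
  + by case: nx; have [] := hL _ _ zw.
  + by case: nx.
- move=> y z [Ly|[Bb yx]] [Lz|[Bb' zx]].
  + by case: (hC _ _ Ly Lz) => [?|?|?];
      [constructor 1|constructor 2; left|constructor 3; left].
  + have [Lx|nLx] := pselect (i_L D (val b) x).
      by rewrite zx; case: (hC _ _ Ly Lx) => [?|?|?];
        [constructor 1|constructor 2; left|constructor 3; left].
    by constructor 2; right.
  + have [Lx|nLx] := pselect (i_L D (val b) x).
      by rewrite yx; case: (hC _ _ Lx Lz) => [?|?|?];
        [constructor 1|constructor 2; left|constructor 3; left].
    by constructor 3; right.
  + by constructor 1; rewrite yx.
Qed.

Let F_good (b : osucc alpha) (b1 : pos_label alpha) :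
  label_succ (Some b) (val b1) -> forall u, enumerated D' (val b1) u ->
  surjection (i_F D' b u) (i_L D' (Some b)) (segment D' b1 u).
Proof.
move=> bb1 u [Lu nu].
have [L1u|nL1u] := pselect (i_L D (val b1) u).
  have ue : enumerated D (val b1) u by split=> // /nu/nonmaxE.
  have [h t f s] := g_F gD bb1 ue.
  have noFx b2 : label_succ (Some b) b2 -> B b2 -> u <> x.
    move=> bb2 Bb2 ux; have [_ + _] := B_new bb2 Bb2.
    by rewrite -(label_succ_fun bb1 bb2) -ux.
  split.
  - move=> y z [/h[Ly [Lz zu]]|[Bb nx -> -> _]|[b2 [bb2 Bb2 ux _]]].
    + by split; [left|split; [left|case: zu; [left|right; left]]].
    + by split; [right|split; [left|left]].
    + by case: (noFx _ bb2 Bb2).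
  - move=> y [/t[z ?]|[Bb yx]]; first by exists z; constructor 1.
    have [Lx|nLx] := pselect (i_L D (Some b) x).
      by have [z ?] := t _ Lx; exists z; constructor 1; rewrite yx.
    by exists u; constructor 2; split=> //; exists (val b1).
  - have F1 y z : i_F D b u y z -> ~ i_L D (Some b) x -> y <> x.
      by move=> /h[Ly _] nx yx; apply: nx; rewrite -yx.
    move=> y z w [yz|[Bb nx yx zu _]|[b2 [bb2 Bb2 ux _]]]; last first.
      by case: (noFx _ bb2 Bb2).
    + move=> [yw|[Bb' nx' yx' wu _]|[b3 [bb3 Bb3 ux _]]].
      * by rewrite zu; case: (F1 _ _ yw).
      * by rewrite zu.
      * by case: (noFx _ bb3 Bb3).
    + move=> [yw|[Bb' nx' yx' wu _]|[b3 [bb3 Bb3 ux _]]].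
      * exact: f yw.
      * by case: (F1 _ _ yz).
      * by case: (noFx _ bb3 Bb3).
  - move=> z [Lz zu].
    suff [y Fy] : exists y, i_F D b u y z by exists y; constructor 1.
    apply: s; split; last first.
      case: zu => [|[|[_ nx _ ux]]]; [by left|by right|].
      by case: nx; rewrite -ux.
    case: Lz => // -[Bb1 zx]; case: zu => [->//|[zu|[_ nx _ ux]]].
      by have [/(_ _ _ zu)[]] := g_order gD b1.
    by case: nx; rewrite -ux.
have [Bb1 ux] : B (val b1) /\ u = x by case: Lu.
have [b0 nx [h t f s]] := B_new bb1 Bb1.
have noF y z : ~ i_F D b u y z by move=> /(g_F_dom gD bb1)[].
have noe : ~ exists2 b2, label_succ (Some b) b2 & enumerated D b2 u.
  by move=> [b2 bb2 [+ _]]; rewrite -(label_succ_fun bb1 bb2).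
have FE y z : i_F D' b u y z <-> Fx y z.
  split=> [[/noF|[_ _ _ _ /noe]|[b2 []]]//|yz].
  by constructor 3; exists (val b1).
have segE z : segment D' b1 u z <-> adjoin_L (val b1) z.
  split=> [[]//|Lz]; split=> //; case: Lz => [Lz|[_ ->]]; last by left.
  by right; right.
split.
- by move=> y z /FE/h[Ly Lz]; split=> //; apply/segE.
- by move=> y /t[z ?]; exists z; apply/FE.
- by move=> y z w /FE yz /FE; apply: f.
- by move=> z /segE/s[y ?]; exists y; apply/FE.
Qed.

Lemma adjoin_good : good D'.
Proof.
split.
- exact: linear.
- by apply/L_top; apply: (g_zero gD).
- by move=> y /L_top/(g_min gD)[]; [left|right; apply/lt_top].
- move=> y z; apply: (iff_trans (g_S gD y z)).
  by split=> -[/lt_top yz nw]; split=> // -[w [/lt_top ? /lt_top ?]];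
    apply: nw; exists w.
- by move=> y /nonmaxE/(g_succ gD).
- by move=> y /L_top Ly ny; apply/limitE/(g_max gD) => // /nonmaxE.
- by move=> a y /(g_VL gD)/L_top.
- move=> a y b Vy [|[_ yx]]; first exact: (g_V_notL gD Vy).
  by apply: (@xV a); rewrite -yx.
- exact: (g_V_fun gD).
- move=> y _; case: (cover y) => [/(g_cover gD)[[b ?]|]|]; [|by right|by left].
  by left; exists b; left.
- by move=> y z /(g_TV gD)[a [b [? ? ?]]]; exists a, b; split=> //; apply/lt_top.
- exact: (g_T_trans gD).
- exact: (g_T_tree gD).
- by move=> a b y Vy /lt_top; apply: (g_T_pred gD Vy).
- by move=> a y z /L_top La /limitE; apply: (g_T_limit gD La).
- by move=> a b y Vy /lt_top; apply: (g_T_pruned gD Vy).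
- exact: c'E.
- exact: c'_inj.
- move=> b bl y; split.
    move=> [/(g_Llim gD bl)[c cb Lc]|[/(B_lim bl)[c cb Bc] ->]].
      by exists c => //; left.
    by exists c => //; right.
  move=> [c cb [Lc|[Bc ->]]].
    by left; apply/(g_Llim gD bl); exists c.
  by right; split=> //; apply/(B_lim bl); exists c.
- move=> b b1 bb1 u y z [/(g_F_dom gD bb1)[Lu nu]|[_ _ _ _ [b2 bb2 [Lu nu]]]|].
  + by split; [left|move=> /nu/nonmaxE].
  + by rewrite (label_succ_fun bb1 bb2); split; [left|move=> /nu/nonmaxE].
  + move=> [b2 [bb2 Bb2 -> _]]; rewrite (label_succ_fun bb1 bb2); split.
      by right.
    by move=> E; case: B_top; move: Bb2; rewrite E.
- exact: F_good.
- move=> u y z [/(g_G_dom gD)[Lu nu]|[_ _ _ nu _]].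
    by split; [apply/L_top|move=> /nu/nonmaxE].
  by split; [apply/L_top; have [? /(top_ltL gD)[]] := nu|move=> _; apply/nonmaxE].
- move=> u [/L_top Lu /(_ erefl)/nonmaxE nu].
  have [h t f s] := top_G gD nu; split.
  + move=> y z [/h[Ly Vz]|[Bb nx -> _ ->]]; first by split; [left|].
    by split; [right|apply: pP].
  + move=> y [/t[z ?]|[Bb ->]]; first by exists z; left.
    have [/t[z ?]|nLx] := pselect (i_L D (alpha0 alpha) x); first by exists z; left.
    by exists (p u); right.
  + move=> y z w [yz|[Bb nx yx _ zp]] [yw|[Bb' nx' yx' _ wp]].
    * exact: f yw.
    * by case: nx'; rewrite -yx'; have [] := h _ _ yz.
    * by case: nx; rewrite -yx; have [] := h _ _ yw.
    * by rewrite zp.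
  + by move=> z /s[y ?]; exists y; left.
Qed.

End Adjoin.

(** * Failure of joint embedding *)

Section SameLanguage.

Variable alpha : cordinal.

Lemma good_permute_constants (U : Type) (D : interp alpha U) (s : nat -> nat) :
  good D -> involutive s ->
  good (Interp (i_zero D) (i_c D \o s) (i_L D) (i_lt D) (i_F D) (i_G D) (i_S D)
               (i_V D) (i_T D)).
Proof.
move=> gD sK; case: gD => ? ? ? ? ? ? ? ? ? ? ? ? ? ? ? ? L0 cI ? ? ? ? ?.
split=> //=; last by move=> i j /cI/(inv_inj sK).
move=> b b0 x; apply: (iff_trans (L0 b b0 x)).
split=> -[n ->]; first by exists (s n); rewrite sK.
by exists (s n).
Qed.

Section AdjoinZero.

Variables (U : Type) (D : interp alpha U).
Hypothesis gD : good D.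

(** [L_0] only matters as a set of parameters and through the limit sets [L_b], so
    0 can be adjoined to it. *)
Lemma good_zero_constant : (forall n, i_zero D <> i_c D n) ->
  exists2 D' : interp alpha U, good D' & i_zero D' = i_c D' 0.
Proof.
move=> zc; pose c' n := if n is m.+1 then i_c D m else i_zero D.
pose B (b : label alpha) := ~~ label_pos b \/ label_limit b.
have Bnew b b1 : label_succ b b1 -> B b1 ->
    [/\ ~~ label_pos b, ~ i_L D b1 (i_zero D) &
     surjection (fun _ _ => False) (adjoin_L D (i_zero D) B b)
       (adjoin_L D (i_zero D) B b1)].
  move=> bb1 [/negP|/(label_limit_succ bb1)//].
  by case; apply: label_succ_pos bb1.
exists (adjoin_interp (i_zero D) B c' (fun _ _ => False) gD) => //.
apply: adjoin_good Bnew.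
- by move=> a /(g_V_notL gD); apply; apply: (g_zero gD).
- by left.
- case=> [/negP|]; last exact: alpha1_not_limit.
  by case; apply: label_succ_pos (label_succ_alpha alpha).
- move=> b bl; split=> [_|_]; last by right.
  have [b0 b0P] := label_zero_exists alpha; exists b0; last by left.
  exact: label_zero_lt (label_limit_pos bl).
- move=> [|i] [|j] //=; first by move=> /zc.
    by move=> /esym/zc.
  by move=> /(g_c_inj gD)->.
- move=> b b0 y; split.
    move=> [/(g_L0 gD b0)[n ->]|[_ ->]]; [by exists n.+1|by exists 0].
  move=> [[|n] ->]; first by right; split=> //; left.
  by left; apply/(g_L0 gD b0); exists n.
Qed.

End AdjoinZero.

(** Whether 0 is one of the constants [c_n], and which one, can be changed
    without changing the size of a model, but not by an embedding. *)
Lemma jep_fails (K : Type) : Spec (psi alpha) K -> ~ JEP (psi alpha) K.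
Proof.
move=> [M [Mpsi MK]] jep; move: Mpsi MK.
have [U [D ->]] := to_structure_surj M => /[dup] Mpsi /models_good gD UK.
have [D' gD' incompatible] : exists2 D' : interp alpha U, good D' &
    forall (V : Type) (E : interp alpha V) g g', good E ->
    interp_embedding D E g -> ~ interp_embedding D' E g'.
  have [[i zc]|nzc] := pselect (exists i, i_zero D = i_c D i).
    pose s n := if n == i then i.+1 else if n == i.+1 then i else n.
    have sK : involutive s.
      move=> n; rewrite /s; have [->|ni] := eqVneq n i.
        by rewrite eqxx -[i.+1 == i]/(i.+1 == i) gtn_eqF.
      have [->|nS] := eqVneq n i.+1; first by rewrite eqxx.
      by rewrite (negPf ni) (negPf nS).
    exists (Interp (i_zero D) (i_c D \o s) (i_L D) (i_lt D) (i_F D) (i_G D)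
              (i_S D) (i_V D) (i_T D)); first exact: good_permute_constants.
    move=> V E g g' gE gP g'P.
    have zi : i_zero E = i_c E i by rewrite -(e_zero gP) zc (e_c gP).
    have : i_zero E = i_c E i.+1.
      rewrite -(e_zero g'P) -(e_c g'P) /= zc /s eqxx.
      by rewrite gtn_eqF.
    by rewrite zi => /(g_c_inj gE)/eqP; rewrite ltn_eqF.
  have [|D' gD' zc'] := good_zero_constant gD.
    by move=> n zc; apply: nzc; exists n.
  exists D' => // V E g g' gE gP g'P; apply: nzc; exists 0.
  by apply: (e_inj gP); rewrite (e_zero gP) (e_c gP) -(e_zero g'P) zc' (e_c g'P).
have [||N [g1 [g2 []]]] := jep (to_structure D) (to_structure D').
- by split.
- by split=> //; apply/models_good.
move: g1 g2; have [V [E ->]] := to_structure_surj N.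
move=> g1 g2 /models_good gE /embeddingE g1P /embeddingE g2P.
exact: incompatible g1P g2P.
Qed.

End SameLanguage.

(** * Models with additional elements *)

Section AddPoints.

Variables (alpha : cordinal) (U Z : Type) (D : interp alpha U).

Definition lift1 (P : U -> Prop) (y : U + Z) :=
  if y is inl u then P u else False.
Definition lift2 (P : U -> U -> Prop) (y z : U + Z) :=
  if y is inl u then lift1 (P u) z else False.
Definition lift3 (P : U -> U -> U -> Prop) (y z w : U + Z) :=
  if y is inl u then lift2 (P u) z w else False.

(* [D] with extra elements [inr z] that lie in none of the sets *)
Definition add_points : interp alpha (U + Z) :=
  Interp (inl (i_zero D)) (inl \o i_c D) (fun b => lift1 (i_L D b))
    (fun b => lift2 (i_lt D b)) (fun b => lift3 (i_F D b)) (lift3 (i_G D))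
    (lift2 (i_S D)) (lift2 (i_V D)) (lift2 (i_T D)).

Hypothesis gD : good D.

Let nonmaxE u : nonmax add_points (inl u) <-> nonmax D u.
Proof. by split=> [[[w|?] //]|[w ?]]; [exists w|exists (inl w)]. Qed.

Let limitE u : limit add_points (inl u) <-> limit D u.
Proof.
split=> -[u0 nw]; split.
- by move=> E; apply: u0; rewrite E.
- by move=> [w ?]; apply: nw; exists (inl w).
- by move=> [E]; apply: u0.
- by move=> [[w|?] // ?]; apply: nw; exists w.
Qed.

Let surjectionE R A B : surjection R A B ->
  surjection (lift2 R) (lift1 A) (lift1 B).
Proof.
case=> h t f s; split.
- by move=> [y|?] [z|?] //=; apply: h.
- by move=> [y|?] //= /t[z ?]; exists (inl z).
- by move=> [y|?] [z|?] [w|?] //= yz yw; congr inl; apply: f yw.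
- by move=> [z|?] //= /s[y ?]; exists (inl y).
Qed.

Let segmentE b u : segment add_points b (inl u) = lift1 (segment D b u).
Proof.
apply/funext => -[z|?]; apply/propext; last by split=> -[].
split=> [[Lz zu]|].
  by split=> //; case: zu => [[->]|]; [left|right].
rewrite /lift1 => -[Lz zu]; split; first exact: Lz.
by case: zu => [->|zu]; [left|right].
Qed.

Lemma add_points_good : good_on add_points (fun y => exists u, y = inl u).
Proof.
split.
- move=> b; have [h i t c] := g_order gD b; split.
  + by move=> [y|?] [z|?] //=; apply: h.
  + by move=> [y|?] //=; apply: i.
  + by move=> [y|?] [z|?] [w|?] //=; apply: t.
  + move=> [y|?] [z|?] //= Ly Lz; case: (c y z Ly Lz) => [->|?|?].
    * by constructor 1.
    * by constructor 2.
    * by constructor 3.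
- exact: (g_zero gD).
- by move=> [y|?] //= /(g_min gD)[->|]; [left|right].
- move=> [x|?] [y|?]; try by split=> [|[]].
  apply: (iff_trans (g_S gD x y)); split=> -[xy nz]; split=> //.
    by move=> [[z|?] [] //] xz zy; apply: nz; exists z.
  by move=> [z [xz zy]]; apply: nz; exists (inl z).
- move=> [x|?]; last by case=> -[].
  by move=> /nonmaxE/(g_succ gD)[y ?]; exists (inl y).
- move=> [x|?] //= Lx nx; apply/limitE/(g_max gD) => //.
  by move=> /nonmaxE.
- by move=> [a|?] [x|?] //=; apply: (g_VL gD).
- by move=> [a|?] [x|?] b //=; apply: (g_V_notL gD).
- by move=> [a|?] [b|?] [x|?] //= Va Vb; congr inl; apply: (g_V_fun gD) Vb.
- move=> _ [x ->]; case: (g_cover gD (x := x)) => // -[b ?].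
    by left; exists b.
  by right; exists (inl b).
- move=> [x|?] [y|?] //= /(g_TV gD)[a [b [? ? ?]]].
  by exists (inl a), (inl b).
- by move=> [x|?] [y|?] [z|?] //=; apply: (g_T_trans gD).
- move=> [x|?] [y|?] [z|?] //= xz yz; case: (g_T_tree gD xz yz) => [->|?|?].
  + by constructor 1.
  + by constructor 2.
  + by constructor 3.
- move=> [a|?] [b|?] [y|?] //= Vy /(g_T_pred gD Vy)[x [? ?]].
  by exists (inl x).
- move=> [a|?] [x|?] [y|?] //= La /limitE la Vx Vy xy; congr inl.
  apply: (g_T_limit gD La la Vx Vy) => z; exact: (xy (inl z)).
- move=> [a|?] [b|?] [x|?] //= Vx /(g_T_pruned gD Vx)[y [? ?]].
  by exists (inl y).
- move=> b b0 [x|?]; last by split=> [|[]].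
  apply: (iff_trans (g_L0 gD b0 x)).
  by split=> -[n]; [move=> ->; exists n|case=> ->; exists n].
- by move=> i j [/(g_c_inj gD)].
- move=> b bl [x|?]; last by split=> [|[]].
  exact: (g_Llim gD bl).
- move=> b b1 bb1 [x|?] [y|?] [z|?] //= /(g_F_dom gD bb1)[Lx nx].
  by split=> // /nx/nonmaxE.
- move=> b b1 bb1 [x|?] [//= Lx nx]; rewrite segmentE.
  by apply/surjectionE/(g_F gD bb1); split=> // /nx/nonmaxE.
- move=> [x|?] [y|?] [z|?] //= /(g_G_dom gD)[Lx nx].
  by split=> // /nx/nonmaxE.
- move=> [x|?] [//= Lx nx].
  by apply/surjectionE/(g_G gD); split=> // /nx/nonmaxE.
Qed.

End AddPoints.

(** * Failure of amalgamation when L_1 is countable *)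

Section NewLastElement.

Variables (alpha : cordinal) (U : Type) (D : interp alpha U).
Hypothesis gD : good D.

Let new_point : U + unit := inr tt.
Let Dp := add_points unit D.
Let gDp : good_on Dp (fun y => exists u, y = inl u).
Proof. exact: add_points_good. Qed.

(* the ordinals 0 and 1 *)
Variables b0 b1 : label alpha.
Hypothesis b0_zero : ~~ label_pos b0.
Hypothesis b1_one : label_succ b0 b1.
Hypothesis b1_top : b1 <> None.

Variable e : nat -> U.
Hypothesis e_range : forall y, i_L D b1 y <-> exists n, y = e n.

Let B (b : label alpha) := label_succ b0 b \/ label_limit b.

(** Any enumeration [k] of the new [L_1] will do for its new last element, because
    nothing else depends on it. *)
Lemma new_last_element (k : nat -> U + unit) :
  (forall y, (exists n, y = k n) <-> y = new_point \/ @lift1 U unit (i_L D b1) y) ->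
  exists2 D' : interp alpha (U + unit), good D' &
    [/\ interp_embedding D D' (inl : U -> U + unit), i_L D' b1 new_point &
     forall (b : osucc alpha) n, b0 = Some b -> i_F D' b new_point (i_c D' n) (k n)].
Proof.
move=> k_range.
pose Fx (y z : U + unit) := exists n, y = inl (i_c D n) /\ z = k n.
have Bb1 : B b1 by left.
have Bb0 b : ~~ label_pos b -> ~ B b.
  move=> /negP b0P [/label_succ_pos|/label_limit_pos]; exact: b0P.
have adj0 b (y : U + unit) : ~~ label_pos b ->
    adjoin_L Dp new_point B b y <-> exists n, y = inl (i_c D n).
  move=> bP; split.
    case=> [|[/(Bb0 _ bP)//]]; case: y => [y|[]] //= /(g_L0 gD bP)[n ->].
    by exists n.
  by move=> [n ->]; left; apply/(g_L0 gD bP); exists n.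
have Bnew b b2 : label_succ b b2 -> B b2 ->
    [/\ ~~ label_pos b, ~ i_L Dp b2 new_point &
     surjection Fx (adjoin_L Dp new_point B b)
      (adjoin_L Dp new_point B b2)].
  move=> bb2 [b02|/(label_limit_succ bb2)//].
  have <- := label_succ_inj b02 bb2; have <- := label_succ_fun b1_one b02.
  have kL (z : U + unit) : adjoin_L Dp new_point B b1 z <-> exists n, z = k n.
    apply: iff_trans (iff_sym (k_range z)); split=> [[|[_ ->]]|[->|]].
    + by right.
    + by left.
    + by right.
    + by left.
  split=> //; split.
  + move=> y z [n [-> ->]]; split; last by apply/kL; exists n.
    by apply/adj0 => //; exists n.
  + by move=> y /adj0[]// n ->; exists (k n), n.
  + by move=> y z w [n [-> ->]] [m [[/(g_c_inj gD)->] ->]].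
  + by move=> z /kL[n ->]; exists (inl (i_c D n)), n.
have Btop : ~ B None.
  case=> [b0N|]; last exact: alpha1_not_limit.
  by apply: b1_top; apply: label_succ_fun b1_one b0N.
pose D' := adjoin_interp new_point B (inl \o i_c D) Fx gDp.
have gD' : good D'.
  apply: adjoin_good Bnew => //.
  - by move=> [a|?] /=.
  - move=> [y|[]]; first by left; exists y.
    by right; exists b1; right.
  - move=> b bl; split=> [_|_]; last by right.
    exists b1 => //; apply: label_limit_succ_lt b1_one => //.
    exact: label_zero_lt (label_limit_pos bl).
  - by move=> i j [/(g_c_inj gD)].
  - by move=> b bP y; apply: adj0.
exists D' => //; split.
- split=> //.
  + by move=> ? ? [].
  + by move=> b x; split=> [?|[|[]]] //; left.
  + by move=> b x y; split=> [?|[|[]]] //; left.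
  + move=> b x y z; split=> [?|[|[]|[? []]]] //; by constructor 1.
  + by move=> x y z; split=> [?|[|[]]] //; left.
- by right.
- move=> b n bE; constructor 3; exists b1; split=> //; first by rewrite -bE.
  by exists n.
Qed.

(** Adding a last element to [L_1] in two ways that enumerate the new [L_1]
    differently.  In an amalgam both new elements enumerate the segments below
    them using only [L_0], so they are comparable without anything new between
    them, hence equal; but then their enumerations agree. *)
Lemma ap_fails_of_countable_L1 (K : Type) : infinite_set [set: K] ->
  [set: U] #= [set: K] -> ~ AP (psi alpha) K.
Proof.
move=> Kinf UK ap.
pose k1 n : U + unit := if n is m.+1 then inl (e m) else new_point.
pose k2 n : U + unit := match n with 0 => inl (e 0) | 1 => new_point | m.+2 => inl (e m) end.
have [|D1 gD1 [e1 L1 F1]] := @new_last_element k1.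
  move=> y; split=> [[[|n] ->]|[->|]].
  - by left.
  - by right; apply/e_range; exists n.
  - by exists 0.
  - by case: y => [y|[]] //= /e_range[n ->]; exists n.+1.
have [|D2 gD2 [e2 L2 F2]] := @new_last_element k2.
  move=> y; split=> [[[|[|n]] ->]|[->|]].
  - by right; apply/e_range; exists 0.
  - by left.
  - by right; apply/e_range; exists n.
  - by exists 1.
  - by case: y => [y|[]] //= /e_range[n ->]; exists n.+2.
have oK : [set: U + unit] #= [set: K].
  have UinfK : [set: U] #<= [set: K] by have /card_eqPle[] := UK.
  rewrite card_eq_le; apply/andP; split.
    have h : [set y | range (inl : U -> U + unit) y \/ y = new_point] #<= [set: K].
      apply: card_le_add1 => //; apply: card_le_trans UinfK.
      exact: card_image_le.
    apply: card_le_trans h; apply: subset_card_le => -[y|[]] _; last by right.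
    by left; exists y.
  have /card_eqPle[_ KU] := UK; apply: card_le_trans KU _.
  by apply: (@card_le_fun _ _ _ _ (inl : U -> U + unit)) => // ? ? _ _ [].
have [||||| N [g1 [g2 []]]] := ap (to_structure D) (to_structure D1)
   (to_structure D2) (inl : U -> U + unit) (inl : U -> U + unit).
- by split=> //; apply/models_good.
- by split=> //; apply/models_good.
- by split=> //; apply/models_good.
- exact/embeddingE.
- exact/embeddingE.
move: g1 g2; have [V [E ->]] := to_structure_surj N.
move=> g1 g2 /models_good gE /embeddingE g1P /embeddingE g2P /= g12.
have b1_pos : label_pos b1 := label_succ_pos b1_one.
pose pb1 : pos_label alpha := exist _ b1 b1_pos.
have [b b0E] : exists b, b0 = Some b.
  by case: b0 b0_zero b1_one => [b _ _|/negP[]]; [exists b|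
    apply: label_succ_pos (label_succ_alpha alpha)].
have bb1 : label_succ (Some b) (val pb1) by rewrite -b0E.
have L_new (E1 : interp alpha (U + unit)) g : interp_embedding E1 E g ->
    i_L E1 b1 new_point -> enumerated E b1 (g new_point).
  by move=> gP Ln; split=> [|/b1_top//]; apply/(e_L gP).
(* [F_0] has no other parameters than the [c_n], which are the same in all models *)
have below (E1 : interp alpha (U + unit)) g k :
    interp_embedding E1 E g -> i_L E1 b1 new_point ->
    (forall n, i_F E1 b new_point (i_c E1 n) (k n)) ->
    forall v, segment E pb1 (g new_point) v -> exists n, v = g (k n).
  move=> gP Ln Fk v; have [h t f s] := g_F gE bb1 (L_new _ _ gP Ln).
  move=> /s[y Fy]; have [/(g_L0 gE _)] := h _ _ Fy.
  rewrite -b0E => /(_ b0_zero)[n yE] _; exists n.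
  by apply: f Fy _; rewrite yE -(e_c gP); apply/(e_F gP).
have {}F1 n : i_F D1 b new_point (i_c D1 n) (k1 n) by apply: F1.
have {}F2 n : i_F D2 b new_point (i_c D2 n) (k2 n) by apply: F2.
have u1L := L_new _ _ g1P L1; have u2L := L_new _ _ g2P L2.
have u12 : g1 new_point = g2 new_point.
  have [_ _ _ c] := g_order gE pb1.
  have [//|u12|u21] := c _ _ u1L.1 u2L.1.
    have [|n] := below _ _ _ g2P L2 F2 (g1 new_point).
      by split; [exact: u1L.1|right].
    case: (k2 n) => [y|[->//]]; rewrite -g12 => /(e_inj g1P) //.
  have [|n] := below _ _ _ g1P L1 F1 (g2 new_point).
    by split; [exact: u2L.1|right].
  by case: (k1 n) => [y|[->//]]; rewrite g12 => /(e_inj g2P).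
have [_ _ f _] := g_F gE bb1 u1L.
have h1 : i_F E b (g1 new_point) (i_c E 0) (g1 new_point).
  by rewrite -(e_c g1P); apply/(e_F g1P)/(F1 0).
have h2 : i_F E b (g1 new_point) (i_c E 0) (g2 (inl (e 0))).
  by rewrite u12 -(e_c g2P); apply/(e_F g2P)/(F2 0).
by have := f _ _ _ h1 h2; rewrite u12 => /(e_inj g2P).
Qed.

End NewLastElement.

(** * Infinite alpha *)

Section FiniteLabels.

Variable alpha : cordinal.
Implicit Types b c : label alpha.

(** The finite ordinals, since omega is the least limit. *)
Definition label_fin b := forall c, label_limit c -> label_lt b c.

Lemma label_fin_lt b c : label_fin b -> label_lt c b -> label_fin c.
Proof. by move=> bf cb d /bf; apply: label_lt_trans. Qed.

Lemma label_fin_succ b c : label_succ b c -> label_fin b -> label_fin c.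
Proof. by move=> bc bf d dl; apply: label_limit_succ_lt (bf d dl) bc. Qed.

Lemma label_fin_limit b : label_fin b -> ~ label_limit b.
Proof. by move=> bf /bf/label_lt_irr. Qed.

Lemma label_fin_zero b : ~~ label_pos b -> label_fin b.
Proof. by move=> b0 c /label_limit_pos; apply: label_zero_lt. Qed.

(** Below omega, going down by predecessors ends after finitely many steps. *)
Lemma label_fin_below_finite b :
  label_fin b -> finite_set [set c | label_lt c b].
Proof.
elim/label_ind: b => b IH bf; case: (label_cases b) => [b0|[c cb]|bl].
- rewrite (_ : [set c | _] = set0); first exact: finite_set0.
  apply/seteqP; split=> // c cb; case/negP: b0; apply/label_posP.
  by exists c.
- have cltb := label_succ_lt cb.
  have fc := IH c cltb (label_fin_lt bf cltb).
  have : finite_set ([set d | label_lt d c] `|` [set c]).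
    by rewrite finite_setU; split.
  by apply: sub_finite_set => d; have /label_succP[_ h] := cb; apply: h.
- by case: (label_fin_limit bf).
Qed.

Lemma alpha0_not_fin : infinite_set [set: alpha] -> ~ label_fin (@alpha0 alpha).
Proof.
move=> ainf /label_fin_below_finite fb; apply: ainf.
apply: card_le_finite fb.
apply: (@card_le_fun _ _ _ _ (fun a => Some (Some a))) => //.
by move=> ? ? _ _ [].
Qed.

Lemma shift_exists : exists sh : label alpha -> label alpha,
  [/\ forall b, ~~ label_pos b -> sh b = b,
      forall b c, label_fin b -> label_succ c b -> sh b = c &
      forall b, ~ label_fin b -> sh b = b].
Proof.
have ex b : exists c, [/\ ~~ label_pos b -> c = b,
    forall d, label_fin b -> label_succ d b -> c = d & ~ label_fin b -> c = b].
  case: (label_cases b) => [b0|[c cb]|bl].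
  - exists b; split=> // d _ /label_succ_pos bp; case/negP: b0.
    exact: bp.
  - have [bf|nbf] := pselect (label_fin b).
      exists c; split=> //; last by move=> d _ db; apply: label_succ_inj cb db.
      by move=> /negP[]; apply: label_succ_pos cb.
    by exists b; split.
  - exists b; split=> // d bf; case: (label_fin_limit bf bl).
exists (fun b => projT1 (cid (ex b))); split=> b.
- by case: cid => c /= [].
- by case: cid => c /= [_ h _] d; apply: h.
- by case: cid => c /= [].
Qed.

End FiniteLabels.

Lemma model_infinite (alpha : cordinal) (U : Type) (D : interp alpha U) :
  good D -> infinite_set [set: U].
Proof. by move=> /g_c_inj ?; apply/infiniteP/card_leTP; exists (i_c D). Qed.

Lemma Spec_infinite (alpha : cordinal) (K : Type) :
  Spec (psi alpha) K -> infinite_set [set: K].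
Proof.
move=> [M []]; have [U [D ->]] := to_structure_surj M.
move=> /models_good/model_infinite/infiniteP NU /card_eqPle[UK _].
by apply/infiniteP; apply: card_le_trans UK.
Qed.

Section Shift.

Variables (alpha : cordinal) (U : Type) (D : interp alpha U).
Hypothesis gD : good D.
Hypothesis alpha0_inf : ~ label_fin (@alpha0 alpha).
Variable sh : label alpha -> label alpha.
Hypothesis sh0 : forall b, ~~ label_pos b -> sh b = b.
Hypothesis shS : forall b c, label_fin b -> label_succ c b -> sh b = c.
Hypothesis sh_inf : forall b, ~ label_fin b -> sh b = b.

Let c := i_c D.

(** Replacing [L_1] by [L_0], and [L_(k+1)] by [L_k] for positive finite [k],
    makes [L_1] countable. *)
Definition shift_interp : interp alpha U := Interp (i_zero D) c
  (fun b => i_L D (sh b))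
  (fun b y z => (exists p : pos_label alpha, val p = sh (val b) /\ i_lt D p y z) \/
     (~~ label_pos (sh (val b)) /\ exists i j, [/\ i < j, y = c i & z = c j]))
  (fun b u y z =>
     (~~ label_pos (Some b : label alpha) /\
       exists i n, [/\ u = c i, y = c n & z = c (minn n i)]) \/
     (label_pos (Some b : label alpha) /\
       exists2 b', Some b' = sh (Some b) & i_F D b' u y z))
  (i_G D) (i_S D) (i_V D) (i_T D).

Let D' := shift_interp.

Let sh_le b : sh b = b \/ label_lt (sh b) b.
Proof.
have [bf|/sh_inf] := pselect (label_fin b); last by left.
case: (label_cases b) => [/sh0|[d db]|/(label_fin_limit bf)//]; first by left.
by right; rewrite (shS bf db); apply: label_succ_lt.
Qed.

Let sh_alpha0 : sh (@alpha0 alpha) = @alpha0 alpha.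
Proof. exact: sh_inf. Qed.

Let top_inf : ~ label_fin (@alpha1 alpha).
Proof.
move=> h; apply/alpha0_inf/(label_fin_lt h).
exact: (label_succ_lt (label_succ_alpha alpha)).
Qed.

Let sh_top : sh None = None.
Proof. exact: sh_inf. Qed.

Let sh_topE b : sh b = None -> b = None.
Proof. by case: (sh_le b) => [->//|+ E]; rewrite E; case: b {E}. Qed.

Let lt_top y z : top_lt D' y z <-> top_lt D y z.
Proof.
split=> [[[p []]|[]]|yz].
- by rewrite [sh _]sh_top => /palpha1E->.
- rewrite [sh _]sh_top => /negP[]; exact: label_succ_pos (label_succ_alpha alpha).
- by left; exists (palpha1 alpha); rewrite [sh _]sh_top.
Qed.

Let nonmaxE y : nonmax D' y <-> nonmax D y.
Proof. by split=> -[z /lt_top ?]; exists z. Qed.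

Let L_top y : i_L D' None y <-> i_L D None y.
Proof. by rewrite /= sh_top. Qed.

Let enumeratedE b y : enumerated D' b y <-> enumerated D (sh b) y.
Proof.
split=> -[Ly ny]; split=> //.
  by move=> /sh_topE/ny/nonmaxE.
by move=> bN; apply/nonmaxE/ny; rewrite bN; apply: sh_top.
Qed.

Let lt_pos (b p : pos_label alpha) y z : val p = sh (val b) ->
  i_lt D' b y z <-> i_lt D p y z.
Proof.
move=> pb; split=> [[[q [qb]]|[]]|?]; last by left; exists p.
  by have -> : q = p by apply/val_inj; rewrite qb.
by rewrite -pb (valP p).
Qed.

Let linear_ext (L L' : U -> Prop) (lt lt' : U -> U -> Prop) :
  L = L' -> (forall y z, lt' y z <-> lt y z) ->
  linear_order L lt -> linear_order L' lt'.
Proof.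
move=> <- ltE; suff -> : lt' = lt by [].
by apply/funext => y; apply/funext => z; apply/propext.
Qed.

Let linear_c b (b0 : ~~ label_pos b) (lt : U -> U -> Prop) :
  (forall y z, lt y z <-> exists i j, [/\ i < j, y = c i & z = c j]) ->
  linear_order (i_L D b) lt.
Proof.
move=> ltE; split.
- move=> y z /ltE[i [j [_ -> ->]]].
  by split; apply/(g_L0 gD b0); [exists i|exists j].
- by move=> y /ltE[i [j [ij -> /(g_c_inj gD) E]]]; move: ij; rewrite E ltnn.
- move=> y z w /ltE[i [j [ij -> ->]]] /ltE[j' [k [jk /(g_c_inj gD) E ->]]].
  rewrite -E in jk.
  by apply/ltE; exists i, k; split=> //; apply: ltn_trans jk.
- move=> y z /(g_L0 gD b0)[i ->] /(g_L0 gD b0)[j ->].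
  case: (ltngtP i j) => [ij|ji|->]; last by constructor 1.
    by constructor 2; apply/ltE; exists i, j.
  by constructor 3; apply/ltE; exists j, i.
Qed.

Let linear (b : pos_label alpha) : linear_order (i_L D' (val b)) (i_lt D' b).
Proof.
have [p|np] := boolP (label_pos (sh (val b))).
  pose q : pos_label alpha := exist _ (sh (val b)) p.
  apply: (linear_ext _ _ (g_order gD q)) => // y z.
  exact: (@lt_pos b q).
apply: linear_c => // y z; split=> [[[p [pb _]]|[]//]|?]; last by right.
by case/negP: np; rewrite -pb; exact: (valP p).
Qed.

Let fin_cases (b : label alpha) :
  label_fin b -> ~~ label_pos b \/ exists d, label_succ d b.
Proof.
by move=> bf; case: (label_cases b) => [|?|/(label_fin_limit bf)//]; [left|right].
Qed.

Let succ_exists (b : label alpha) : label_fin b -> exists d, label_succ b d.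
Proof.
case: b => [b|/top_inf//] _; have [d ?] := label_succ_exists b; by exists (val d).
Qed.

Let F_good (b : osucc alpha) (b1 : pos_label alpha) :
  label_succ (Some b) (val b1) -> forall u, enumerated D' (val b1) u ->
  surjection (i_F D' b u) (i_L D' (Some b)) (segment D' b1 u).
Proof.
move=> bb1 u /enumeratedE ue.
have [bf|nbf] := pselect (label_fin (Some b : label alpha)); last first.
  have b1E : sh (val b1) = val b1.
    by apply: sh_inf => /label_fin_lt/(_ (label_succ_lt bb1)).
  have bE : sh (Some b) = Some b by apply: sh_inf.
  have bpos : label_pos (Some b : label alpha).
    by apply: contrapT => /negP/label_fin_zero.
  rewrite b1E in ue; have := g_F gD bb1 ue.
  congr surjection.
  - apply/funext => y; apply/funext => z; apply/propext; split=> [?|].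
      by right; split=> //; exists b.
    move=> [[b0]|[_ [b' E h]]]; first by case/negP: b0.
    by move: E h; rewrite bE => -[->].
  - by rewrite /= bE.
  - apply/funext => z; have E : i_lt D' b1 z u = i_lt D b1 z u.
      by apply/propext/lt_pos; rewrite b1E.
    by rewrite /segment E /= b1E.
have b1f := label_fin_succ bb1 bf.
have b1E : sh (val b1) = Some b by apply: shS.
rewrite b1E in ue; case: (fin_cases bf) => [b0|[d db]].
  have [i ui] : exists i, u = c i by case: ue => /(g_L0 gD b0).
  have FE y z : i_F D' b u y z <-> exists n, y = c n /\ z = c (minn n i).
    split=> [[[_ [j [n []]]]|[]]|[n [-> ->]]].
    - by rewrite ui => /(g_c_inj gD) <- -> ->; exists n.
    - by move: b0 => /negP.
    - by left; split=> //; exists i, n.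
  have LE z : i_L D' (Some b) z <-> exists n, z = c n.
    by rewrite /= sh0//; apply: (g_L0 gD).
  have segE z : segment D' b1 u z <-> exists2 n, n <= i & z = c n.
    rewrite /segment /= b1E; split.
      move=> [_ [->|]]; first by exists i.
      case=> [[p [/= pb _]]|[_ [k [j [kj -> zj]]]]].
        by case/negP: b0; rewrite -pb; exact: (valP p).
      exists k => //; move: zj; rewrite ui => /(g_c_inj gD)->; exact: ltnW.
    move=> [n ni ->]; split; first by apply/(g_L0 gD b0); exists n.
    move: ni; rewrite leq_eqVlt => /predU1P[->|ni]; first by left.
    by right; right; split=> //; exists n, i.
  split.
  - move=> y z /FE[n [-> ->]]; split; first by apply/LE; exists n.
    by apply/segE; exists (minn n i) => //; apply: geq_minr.
  - by move=> y /LE[n ->]; exists (c (minn n i)); apply/FE; exists n.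
  - move=> y z w /FE[n [-> ->]] /FE[m [/(g_c_inj gD)-> ->]] //.
  - move=> z /segE[n ni ->]; exists (c n); apply/FE; exists n.
    by rewrite (minn_idPl ni).
have bpos := label_succ_pos db.
have bE : sh (Some b) = d by apply: shS.
have [b' db'] : exists b', d = Some b'.
  by case: d db {bE} => [b' _|/label_succ_lt//]; exists b'.
rewrite db' in db bE; pose pb : pos_label alpha := exist _ (Some b) bpos.
have := g_F gD (b1 := pb) db ue.
congr surjection.
- apply/funext => y; apply/funext => z; apply/propext; split=> [?|].
    by right; split=> //; exists b'.
  move=> [[b0]|[_ [b2 E h]]]; first by case/negP: b0.
  by move: E h; rewrite bE => -[->].
- by rewrite /= bE.
- apply/funext => z; have E : i_lt D' b1 z u = i_lt D pb z u.
    by apply/propext/lt_pos; rewrite b1E.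
  by rewrite /segment E /= b1E.
Qed.

Lemma shift_good : good D'.
Proof.
split.
- exact: linear.
- by apply/L_top; apply: (g_zero gD).
- by move=> y /L_top/(g_min gD)[]; [left|right; apply/lt_top].
- move=> y z; apply: (iff_trans (g_S gD y z)).
  by split=> -[/lt_top yz nw]; split=> // -[w [/lt_top ? /lt_top ?]];
    apply: nw; exists w.
- by move=> y /nonmaxE/(g_succ gD).
- by move=> y /L_top Ly ny; apply: (g_max gD) => // /nonmaxE.
- by move=> a y /(g_VL gD)/L_top.
- by move=> a y b /(g_V_notL gD); apply.
- exact: (g_V_fun gD).
- move=> y _; case: (g_cover gD (x := y)) => // -[b Ly]; [left|by right; exists b].
  have [bf|nbf] := pselect (label_fin b); last by exists b; rewrite /= sh_inf.
  have [d bd] := succ_exists bf; exists d.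
  by rewrite /= (shS (label_fin_succ bd bf) bd).
- by move=> y z /(g_TV gD)[a [b [? ? ?]]]; exists a, b; split=> //; apply/lt_top.
- exact: (g_T_trans gD).
- exact: (g_T_tree gD).
- by move=> a b y Vy /lt_top; apply: (g_T_pred gD Vy).
- by move=> a y z /L_top La; apply: (g_T_limit gD La).
- by move=> a b y Vy /lt_top; apply: (g_T_pruned gD Vy).
- by move=> b b0 y; rewrite /= sh0//; apply: (g_L0 gD).
- exact: (g_c_inj gD).
- move=> b bl y; have nbf : ~ label_fin b by move=> /label_fin_limit.
  rewrite /= sh_inf//; apply: iff_trans (g_Llim gD bl y) _; split=> -[d db Ly].
    have [df|ndf] := pselect (label_fin d); last by exists d; rewrite ?sh_inf.
    have [e de] := succ_exists df; exists e.
      exact: label_limit_succ_lt db de.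
    by rewrite (shS (label_fin_succ de df) de).
  exists (sh d) => //; case: (sh_le d) => [->//|sd].
  exact: label_lt_trans sd db.
- move=> b b1 bb1 u y z h; apply/enumeratedE; case: h => -[bP].
    have bf := label_fin_zero bP.
    rewrite (shS (label_fin_succ bb1 bf) bb1) => -[i [n [-> _ _]]].
    by split=> //; apply/(g_L0 gD bP); exists i.
  move=> [b' b'E] h.
  have [bf|nbf] := pselect (label_fin (Some b : label alpha)).
    have [/negP//|[d db]] := fin_cases bf.
    rewrite (shS (label_fin_succ bb1 bf) bb1).
    have b'b : label_succ (Some b') (Some b : label alpha).
      by rewrite b'E (shS bf db).
    exact: (g_F_dom gD (b1 := exist _ (Some b) bP) b'b h).
  have nb1f : ~ label_fin (val b1).
    by move=> /label_fin_lt/(_ (label_succ_lt bb1)).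
  rewrite sh_inf//; apply: (g_F_dom gD bb1).
  by move: b'E h; rewrite sh_inf// => -[->] h; apply: h.
- exact: F_good.
- by move=> u y z /(g_G_dom gD)[Lu nu]; split; [apply/L_top|move=> /nu/nonmaxE].
- move=> u [/L_top Lu nu]; rewrite /= sh_alpha0; apply: (g_G gD); split=> //.
  by move=> /nu/nonmaxE.
Qed.

End Shift.

(** Shifting the finite indices does not change the size of a model, because
    [L_omega] is the same union. *)
Lemma ap_fails_infinite (alpha : cordinal) : infinite_set [set: alpha] ->
  forall K, Spec (psi alpha) K -> ~ AP (psi alpha) K.
Proof.
move=> ainf K SK; have Kinf := Spec_infinite SK; move: SK => [M []].
have [U [D ->]] := to_structure_surj M => /models_good gD UK.
have a0inf := alpha0_not_fin ainf.
have [sh [sh0 shS sh_inf]] := shift_exists alpha.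
have gD' := shift_good gD a0inf sh0 shS sh_inf.
have [b0 b0P] := label_zero_exists alpha; have b0f := label_fin_zero b0P.
have [b1 b01] : exists b1, label_succ b0 b1.
  case: b0 b0P {b0f} => [b _|/negP[]].
    by have [b1 ?] := label_succ_exists b; exists (val b1).
  exact: label_succ_pos (label_succ_alpha alpha).
have b1f := label_fin_succ b01 b0f.
apply: (ap_fails_of_countable_L1 gD' b0P b01 _ (e := i_c D)) => //.
  move=> b1N; apply: a0inf.
  apply: label_fin_lt (label_succ_lt (label_succ_alpha alpha)).
  by rewrite -[@alpha1 alpha]b1N.
by move=> y; rewrite /= (shS _ _ b1f b01); apply: (g_L0 gD).
Qed.

(** * Ranks of the labels for finite alpha *)

Section FiniteAlpha.

Variables (alpha : cordinal) (n : nat).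
Hypothesis alpha_n : [set: alpha] #= `I_n.

Let label_finite : finite_set [set: label alpha].
Proof.
have fa : finite_set [set: alpha] by apply/finite_setP; exists n.
have fs (T : Type) : finite_set [set: T] -> finite_set [set: option T].
  move=> fT; rewrite (_ : [set: option T] = range (@Some T) `|` [set None]).
    by rewrite finite_setU; split=> //; apply: finite_image.
  by apply/seteqP; split=> [[x|] _|//]; [left; exists x|right].
exact/fs/fs.
Qed.

(** Below a limit there is no last label, hence there are infinitely many. *)
Lemma finite_no_limit (b : label alpha) : ~ label_limit b.
Proof.
move=> bl; have bp := label_limit_pos bl.
have [b0 b0P] := label_zero_exists alpha.
case: (@infinite_of_no_last _ (fun c => label_lt c b) (@label_lt alpha)) => //.
- exact: label_lt_irr.
- exact: label_lt_trans.
- by exists b0; apply: label_zero_lt.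
move=> c cb; apply: contrapT => nd; case: (label_limit_succ (b := c) _ bl).
apply/asboolP; split=> // -[d [cd db]].
by apply: nd; exists d.
Qed.

Lemma rank_exists : exists rk : label alpha -> nat,
  [/\ forall b, ~~ label_pos b <-> rk b = 0,
      forall b c, label_succ b c -> rk c = (rk b).+1,
      rk (@alpha0 alpha) = n & rk None = n.+1].
Proof.
have ex (b : label alpha) : exists k, [set c | label_lt c b] #= `I_k.
  by apply/finite_setP; apply: sub_finite_set label_finite.
pose rk b := projT1 (cid (ex b)).
have rkP b : [set c | label_lt c b] #= `I_(rk b) by rewrite /rk; case: cid.
have rkE b k : [set c | label_lt c b] #= `I_k -> rk b = k.
  move=> bk; apply/card_eq_II; apply: card_eq_trans bk.
  by rewrite card_eq_sym.
have rkS b c : label_succ b c -> rk c = (rk b).+1.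
  move=> /label_succP[bc h]; apply: rkE; apply/eq_cardSP; exists b => //.
  rewrite (_ : _ `\` _ = [set c | label_lt c b])//.
  apply/seteqP; split=> d /=; first by move=> [/h[]].
  move=> db; split; first exact: label_lt_trans bc.
  by move=> E; move: db; rewrite E => /label_lt_irr.
have rk0 : rk (@alpha0 alpha) = n.
  apply: rkE; rewrite (_ : [set c | _] = range (fun a : alpha => Some (Some a))).
    apply: card_eq_trans alpha_n; apply: inj_card_eq => x y _ _.
    by case.
  apply/seteqP; split=> [[[a|]|]|] /=; try by [].
    by exists a.
  by move=> _ [a _ <-].
exists rk; split=> //; last by rewrite (rkS _ _ (label_succ_alpha alpha)) rk0.
move=> b; split=> [b0|bk].
  apply: rkE; rewrite (_ : [set c | _] = set0) ?II0//.
  apply/seteqP; split=> // c cb; case/negP: b0; apply/label_posP.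
  by exists c.
apply/negP => /label_posP[c cb]; have := rkP b; rewrite bk II0 card_eq0 => /eqP E.
by have : [set c | label_lt c b] c by []; rewrite E.
Qed.

End FiniteAlpha.

Lemma rank_le_alpha0 (alpha : cordinal) (rk : label alpha -> nat) :
  (forall b : label alpha, ~ label_limit b) ->
  (forall b c, label_succ b c -> rk c = (rk b).+1) ->
  forall b, b <> None -> rk b <= rk (@alpha0 alpha).
Proof.
move=> no_limit rkS b /label_le_alpha0[|->//].
suff h (d : label alpha) : forall d', label_lt d' d -> rk d' < rk d.
  by move=> /h/ltnW.
elim/label_ind: d => d IH d' d'd.
case: (label_cases d) => [/negP[]|[e ed]|/no_limit//].
  by apply/label_posP; exists d'.
have [_ /(_ _ d'd)[d'e|->]] := (label_succP _ _).1 ed; last by rewrite (rkS _ _ ed).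
by rewrite (rkS _ _ ed); apply: leqW; apply: IH d'e; apply: label_succ_lt.
Qed.

(** * Models built from a tree, for finite alpha *)

Lemma surjection_exists (U : Type) (A B : set U) : B !=set0 -> B #<= A ->
  exists R, surjection R A B.
Proof.
move=> [b0 Bb0] /(card_le_funE b0)[f [fA fI]].
exists (fun y z => A y /\ ((B z /\ f z = y) \/
                           ((~ exists2 b, B b & f b = y) /\ z = b0))).
split.
- by move=> y z [Ay [[]|[_ ->]]].
- move=> y Ay; have [[b Bb bE]|nb] := pselect (exists2 b, B b & f b = y).
    by exists b; split=> //; left.
  by exists b0; split=> //; right.
- move=> y z w [_ [[Bz zE]|[nb ->]]] [_ [[Bw wE]|[nb' ->]]] //.
  + by apply: fI; rewrite // zE wE.
  + by case: nb'; exists z.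
  + by case: nb; exists w.
- by move=> z Bz; exists (f z); split; [apply: fA|left].
Qed.

Lemma countable_range (U : Type) (B : set U) : B !=set0 -> B #<= [set: nat] ->
  exists e : nat -> U, forall y, B y <-> exists n, y = e n.
Proof.
move=> [b0 Bb0] /(card_le_funE 0)[f [_ fI]].
have ex n : exists u, B u /\ forall b, B b -> f b = n -> u = b.
  have [[b Bb bE]|nb] := pselect (exists2 b, B b & f b = n).
    by exists b; split=> // b' Bb' b'E; apply: fI; rewrite // bE b'E.
  by exists b0; split=> // b Bb bE; case: nb; exists b.
exists (fun n => projT1 (cid (ex n))) => y; split=> [By|[n ->]].
  by exists (f y); case: cid => u [Bu /= uE]; rewrite (uE y).
by case: cid => u [].
Qed.

Section TreeModel.

Variables (alpha : cordinal) (p : nat) (rk : label alpha -> nat).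
Hypothesis no_limit : forall b : label alpha, ~ label_limit b.
Hypothesis rk0 : forall b, ~~ label_pos b <-> rk b = 0.
Hypothesis rkS : forall b c, label_succ b c -> rk c = (rk b).+1.
Hypothesis rk_alpha0 : rk (@alpha0 alpha) = p.+1.
Hypothesis rk_alpha1 : rk None = p.+2.

(* [W] carries the sets [L_b] for [b] at most alpha, [c] enumerates [L_0] *)
Variables (W : Type) (rW : rel W) (c : nat -> W).
Hypothesis W_initial : initial_order rW.
Hypothesis W_small : [set: W] #<= [set: aleph p].
Hypothesis c_inj : injective c.

(* [Mu] indexes the levels below the maximum; the branches, which form the level
   of the maximum, are given by the functions [bf k] *)
Variables (Mu : Type) (r : rel Mu) (i0 : Mu).
Hypothesis r_wo : well_order r.
Hypothesis r_nomax : forall i, exists j, slt r i j.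
Variables (Kb X : Type) (bf : Kb -> Mu -> X).
Variable k0 : Kb.
Hypothesis bf_inj : forall k k', (forall i, bf k i = bf k' i) -> k = k'.

Definition agree i k := [set k' | forall j, slt r j i -> bf k j = bf k' j].

Hypothesis seg_small : forall i, [set j | r j i] #<= [set: W].
Hypothesis level_small :
  forall i, [set S | exists k, S = agree i k] #<= [set: W].

(** A node at level [i] is a class of branches that agree below [i], not the
    element of a given tree that they share at level [i]: this ensures that at
    limit levels distinct nodes have distinct predecessors, and that every node
    lies on a branch. *)
Let Node := {q : Mu * set Kb | `[< exists k, q.2 = agree q.1 k >]}.

Let nl (q : Node) := (sval q).1.
Let nc (q : Node) := (sval q).2.

Inductive tree_model : Type :=
  | Lower of W
  | Level of Mu
  | MaxLevel
  | TNode of Node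
  | Branch of Kb.

Let U := tree_model.

Let agreeE i k k' : agree i k k' -> agree i k = agree i k'.
Proof.
move=> kk'; apply/seteqP; split=> k2 h j ji; first by rewrite -kk'// h.
by rewrite kk'// h.
Qed.

Let agree_le i j k : r j i -> agree i k `<=` agree j k.
Proof.
move=> ji k' h l lj; apply: h; apply/(slt_def r_wo).
have [lj' nlj] := (slt_def r_wo _ _).1 lj; split.
  exact: (wo_trans r_wo) ji.
by move=> E; apply: nlj; apply: (wo_antisym r_wo); rewrite // E.
Qed.

Let node_class (q : Node) : exists k, nc q = agree (nl q) k.
Proof. exact/asboolP/(valP q). Qed.

Let nodeP (q : Node) k : (nc q) k -> (nc q) = agree (nl q) k.
Proof. by have [k' ->] := node_class q; move=> /agreeE. Qed.

Let node_rep (q : Node) : exists k, (nc q) k.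
Proof. by have [k ->] := node_class q; exists k. Qed.

Let node i k : Node :=
  exist _ (i, agree i k)
    (asboolT (ex_intro (fun k' => agree i k = agree i k') k erefl)).

Let node_eq (q q' : Node) k : (nl q) = (nl q') -> (nc q) k ->
  (nc q') k -> q = q'.
Proof.
move=> E /nodeP qk /nodeP q'k; apply/val_inj.
rewrite [val q]surjective_pairing [val q']surjective_pairing.
rewrite -[(val q).1]/(nl q) -[(val q).2]/(nc q).
by rewrite -[(val q').1]/(nl q') -[(val q').2]/(nc q') E qk q'k E.
Qed.

Let lset k : set W := [set w | ~ ([set: aleph k] #<= below rW w)].

Let Lk k (u : U) : Prop :=
  match k, u with
  | 0, Lower w => exists j, w = c j
  | k.+1, Lower w => k <= p /\ lset k w
  | k.+1, (Level _ | MaxLevel) => k = p.+1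
  | _, _ => False
  end.

Let ltk k (u v : U) : Prop :=
  match u, v with
  | Lower w, Lower w' => [/\ Lk k u, Lk k v & slt rW w w']
  | Level i, Level j => k = p.+2 /\ slt r i j
  | Level _, MaxLevel => k = p.+2
  | _, _ => False
  end.

Let tlt := ltk p.+2.

Let enum k u := Lk k u /\ (k = p.+2 -> exists v, tlt u v).
Let seg k u : set U := [set v | Lk k v /\ (v = u \/ ltk k v u)].
Let lev u : set U := [set v | match u, v with
  | Level i, TNode q => (nl q) = i
  | MaxLevel, Branch _ => True
  | _, _ => False
  end].

Let Winf : infinite_set [set: W].
Proof. by apply/infiniteP/card_leTP; exists c. Qed.

Let rW_wo : well_order rW. Proof. by case: W_initial. Qed.

Let lset_all w : lset p w.
Proof.
have [_ init] := W_initial; move=> /= pw; apply: (init w).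
exact: card_le_trans pw.
Qed.

(** [lset k] will be [L_(k+1)]; its size is the minimum of [aleph k] and that of
    [W], because its complement, if nonempty, has a least element. *)
Let card_le_lset (T : Type) (A : set T) k : A #<= [set: W] ->
  A #<= [set: aleph k] -> A #<= lset k.
Proof.
move=> AW Ak; have [all|/existsNP nall] := pselect (forall w, lset k w).
  by rewrite (_ : lset k = setT)//; apply/seteqP; split=> // w _; apply: all.
have [w /contrapT wk wmin] := wo_least rW_wo nall.
apply: card_le_trans Ak (card_le_trans wk _).
apply: subset_card_le => v vw; apply: contrapT => /wmin.
by move: vw => /(sltNge rW_wo).
Qed.

(** All its initial segments are finite. *)
Let lset_countable : lset 0 #<= [set: nat].
Proof.
apply: (card_le_short_segments infinite_nat (le := rW)).
  by move=> ? ? _ _; apply: wo_total.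
move=> w w0.
have fin : finite_set [set y | lset 0 y /\ rW y w].
  apply: (@sub_finite_set _ _ (below rW w `|` [set w])).
    move=> y [_ yw]; have [->|nyw] := pselect (y = w); first by right.
    by left; apply/(slt_def rW_wo).
  by rewrite finite_setU; split=> //; apply/finite_setPn.
by move: fin => /finite_setPn.
Qed.

Let img_le (T T' : Type) (A : set T) (B : set T') (f : T -> U) (g : T' -> U)
  (A' B' : set U) : injective g ->
  (forall u, A' u -> exists2 t, A t & u = f t) -> (forall t, B t -> B' (g t)) ->
  A #<= B -> A' #<= B'.
Proof.
move=> gI AA BB /card_le_rel[R [Rt RI]]; apply/card_le_rel.
exists (fun u v => exists t t', [/\ A t, B t', R t t', u = f t & v = g t']).
split=> [u /AA[t At uE]|u u' v _ _].
  have [t' [Bt' Rtt']] := Rt _ At; exists (g t'); split; first exact: BB.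
  by exists t, t'.
move=> [t [t' [At _ Rt1 -> ->]]] [s [s' [As _ Rs1 -> /gI ts]]].
by rewrite (RI t s t') // ts.
Qed.

Let Lower_inj : injective Lower. Proof. by move=> ? ? []. Qed.

Let seg_le k u : k <= p.+1 -> enum k.+1 u -> seg k.+1 u #<= Lk k.
Proof.
move=> kp [Lu eu]; case: u Lu eu => // [w|i|].
- move=> /= [kp' ws] _.
  have segW : seg k.+1 (Lower w) `<=` [set Lower v | v in [set v | rW v w]].
    move=> [v|i||q|b] [_ [//|]] //=.
      by move=> [->]; exists w => //; apply: wo_refl.
    by move=> [_ _ /(sltW rW_wo)]; exists v.
  case: k kp kp' ws segW => [|k] kp kp' ws segW.
    apply: (@img_le _ _ [set v | rW v w] [set: nat] Lower (fun j => Lower (c j))).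
    + by move=> i j [/c_inj].
    + by move=> u /segW[v ? <-]; exists v.
    + by move=> j _; exists j.
    apply: finite_set_countable.
    apply: (@sub_finite_set _ _ (below rW w `|` [set w])).
      move=> y yw; have [->|nyw] := pselect (y = w); first by right.
      by left; apply/(slt_def rW_wo).
    by rewrite finite_setU; split=> //; apply/finite_setPn.
  apply: (@img_le _ _ [set v | rW v w] (lset k) Lower Lower) => //.
    by move=> u /segW[v ? <-]; exists v.
  apply: card_le_lset; first exact: card_leT.
  have := card_le_add1 (@aleph_infinite k) w (card_succ_le ws).
  apply: card_le_trans; apply: subset_card_le => v vw.
  have [->|nvw] := pselect (v = w); first by right.
  by left; apply/(slt_def rW_wo).
- move=> /= kE _; move: kp; rewrite kE => _.
  apply: (@img_le _ _ [set j | r j i] (lset p) Level Lower) => //.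
  + move=> [v|j||q|b] [_ [//|]] //=.
      by move=> [->]; exists i => //; apply: wo_refl.
    by move=> [_ /(sltW r_wo)]; exists j.
  + apply: card_le_trans (seg_small i) _; apply: subset_card_le => w _.
    exact: lset_all.
- by move=> /= kE; rewrite kE => /(_ erefl)[[]].
Qed.

Let lev_le i : lev (Level i) #<= Lk p.+1.
Proof.
apply: card_le_trans (_ : [set S | exists k, S = agree i k] #<= _).
  apply/card_le_rel.
  exists (fun u S => if u is TNode q then S = (nc q) else False); split.
    move=> [//|//|//|q|//] /= qi; exists (nc q); split=> //.
    by have [k /nodeP] := node_rep q; rewrite qi => ->; exists k.
  move=> [//|//|//|q|//] [//|//|//|q'|//] S /= qi q'i -> qq'; congr TNode.
  have [k qk] := node_rep q; apply: (node_eq (k := k)) => //; first by rewrite qi.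
  by rewrite -qq'.
apply: card_le_trans (level_small i) _.
apply: (@card_le_fun _ _ _ _ Lower) => [w _|w v _ _ []//].
by split=> //; apply: lset_all.
Qed.

Let segE k u : Lk k u -> seg k u !=set0.
Proof. by move=> Lu; exists u; split=> //; left. Qed.

Let F_exists : exists F : nat -> U -> U -> U -> Prop, forall k u, k <= p.+1 ->
  (forall y z, F k u y z -> enum k.+1 u) /\
  (enum k.+1 u -> surjection (F k u) (Lk k) (seg k.+1 u)).
Proof.
have ex k u : exists R : U -> U -> Prop, k <= p.+1 ->
    (forall y z, R y z -> enum k.+1 u) /\
    (enum k.+1 u -> surjection R (Lk k) (seg k.+1 u)).
  have [eu|neu] := pselect (enum k.+1 u); last by exists (fun _ _ => False).
  have [kp|nkp] := boolP (k <= p.+1); last by exists (fun _ _ => False).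
  have [||R Rs] := @surjection_exists _ (Lk k) (seg k.+1 u).
  - by apply: segE; case: eu.
  - exact: seg_le.
  by exists R.
by exists (fun k u => projT1 (cid (ex k u))) => k u; case: cid.
Qed.

Let G_exists : exists G : U -> U -> U -> Prop, forall u,
  (forall y z, G u y z -> enum p.+2 u) /\
  (enum p.+2 u -> surjection (G u) (Lk p.+1) (lev u)).
Proof.
have ex u : exists R : U -> U -> Prop,
    (forall y z, R y z -> enum p.+2 u) /\
    (enum p.+2 u -> surjection R (Lk p.+1) (lev u)).
  have [eu|neu] := pselect (enum p.+2 u); last by exists (fun _ _ => False).
  have [i uE] : exists i, u = Level i.
    case: u eu => [w|i||q|b] [Lu nu].
    - by case: Lu => h; rewrite ltnn in h.
    - by exists i.
    - by case: (nu erefl).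
    - by case: Lu.
    - by case: Lu.
  have [||R Rs] := @surjection_exists _ (Lk p.+1) (lev u).
  - by exists (TNode (node i k0)); rewrite uE.
  - by rewrite uE; apply: lev_le.
  by exists R.
by exists (fun u => projT1 (cid (ex u))) => u; case: cid.
Qed.

Let F := projT1 (cid F_exists).
Let G := projT1 (cid G_exists).

Let FP k u : k <= p.+1 ->
  (forall y z, F k u y z -> enum k.+1 u) /\
  (enum k.+1 u -> surjection (F k u) (Lk k) (seg k.+1 u)).
Proof. by rewrite /F; case: cid => F' /=; apply. Qed.

Let GP u :
  (forall y z, G u y z -> enum p.+2 u) /\
  (enum p.+2 u -> surjection (G u) (Lk p.+1) (lev u)).
Proof. by rewrite /G; case: cid => G' /=; apply. Qed.

Let imin : exists i, forall j, r i j.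
Proof.
have [|i _ h] := wo_least r_wo (P := setT); first by exists i0.
by exists i => j; apply: h.
Qed.

Let zero := projT1 (cid imin).
Let zeroP j : r zero j. Proof. by rewrite /zero; case: cid. Qed.

Definition tree_interp : interp alpha U := Interp (Level zero)
  (fun j => Lower (c j)) (fun b => Lk (rk b)) (fun b => ltk (rk (val b)))
  (fun b => F (rk (Some b))) G
  (fun u v => tlt u v /\ ~ exists w, tlt u w /\ tlt w v)
  (fun u => lev u)
  (fun u v => match u, v with
     | TNode q, TNode q' => slt r (nl q) (nl q') /\ (nc q') `<=` (nc q)
     | TNode q, Branch k => (nc q) k
     | _, _ => False
     end).

Let D := tree_interp.

Let rk_le (b : osucc alpha) : rk (Some b) <= p.+1.
Proof. by rewrite -rk_alpha0; apply: rank_le_alpha0. Qed.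

Let rk_top b : rk b = p.+2 <-> b = None.
Proof.
split=> [|->//]; case: b => // b E.
by have := rk_le b; rewrite E ltnn.
Qed.

Let tltE u v : top_lt D u v <-> tlt u v.
Proof. by rewrite /top_lt /= rk_alpha1. Qed.

Let tltEq : top_lt D = tlt. Proof. by rewrite /top_lt /tlt -rk_alpha1. Qed.

Let LE u : i_L D None u <-> Lk p.+2 u.
Proof. by rewrite /= rk_alpha1. Qed.

Let nonmaxE u : nonmax D u <-> exists v, tlt u v.
Proof. by split=> -[v /tltE ?]; exists v. Qed.

Let enumE b u : enumerated D b u <-> enum (rk b) u.
Proof.
split=> -[Lu nu]; split=> //.
  by move=> /rk_top/nu/nonmaxE.
by move=> /rk_top/nu/nonmaxE.
Qed.

Let linear k : linear_order (Lk k.+1) (ltk k.+1).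
Proof.
split.
- move=> [w|i||q|b] [w'|i'||q'|b'] //=.
  + by case.
  + by move=> [[->]].
  + by move=> [->].
- by move=> [w|i||q|b] //= [] *; [apply: (slt_wo_irr rW_wo)|
    apply: (slt_wo_irr r_wo)]; eassumption.
- move=> [w|i||q|b] [w'|i'||q'|b'] [w2|i2||q2|b2] //=.
  + by move=> [? _ h] [_ ? h']; split=> //; apply: (slt_wo_trans rW_wo) h'.
  + by move=> [? h] [_ h']; split=> //; apply: (slt_wo_trans r_wo) h'.
- move=> [w|i||q|b] [w'|i'||q'|b'] //=.
  + move=> lw lw'; case: (slt_wo_total rW_wo w w') => [?|->|?].
    * by constructor 2.
    * by constructor 1.
    * by constructor 3.
  + by move=> [kp _] kE; move: kp; rewrite kE ltnn.
  + by move=> [kp _] kE; move: kp; rewrite kE ltnn.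
  + by move=> kE [kp _]; move: kp; rewrite kE ltnn.
  + move=> -> _; case: (slt_wo_total r_wo i i') => [?|->|?].
    * by constructor 2.
    * by constructor 1.
    * by constructor 3.
  + by move=> ->; constructor 2.
  + by move=> kE [kp _]; move: kp; rewrite kE ltnn.
  + by move=> -> _; constructor 3.
  + by constructor 1.
Qed.

Let successor i : exists2 j, slt r i j & forall l, slt r i l -> r j l.
Proof. exact: (wo_least r_wo (P := slt r i) (r_nomax i)). Qed.

Let tree_limit i k k' : limit D (Level i) ->
  (forall j, slt r j i -> agree j k k') -> agree i k k'.
Proof.
move=> [i_nz i_ns] h j ji; have [l jl lmin] := successor j.
have [li|nli] := pselect (slt r l i); first exact: h jl.
case: i_ns; exists (Level j); split; first by split.
move=> [[w|l'||q|b] []] //= [_ jl'] [_ l'i].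
apply: nli; apply/(sltNge r_wo) => il.
have := lmin _ jl'; have /(sltNge r_wo) := l'i.
by move=> h1 /(wo_trans r_wo il).
Qed.

Lemma tree_good : good D.
Proof.
split.
- move=> [b bp]; rewrite /=; case E : (rk b) => [|k]; last exact: linear.
  by have := (rk0 b).2 E; rewrite bp.
- by apply/LE.
- move=> u /LE; case: u => // [w [/= h _]|i _|_]; first by rewrite ltnn in h.
    have [->|ni] := pselect (i = zero); first by left.
    right; apply/tltE; split=> //; apply/(slt_def r_wo).
    by split; [apply: zeroP|move=> E; apply: ni].
  by right; apply/tltE.
- by move=> u v; rewrite tltEq.
- move=> u /nonmaxE[v uv]; have [i uE] : exists i, u = Level i.
    case: u v uv => [w|i||q|b] [w'|i'||q'|b'] //= ; try by exists i.
    by move=> [[h _] _ _]; move: h; rewrite ltnn.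
  have [j ij jmin] := successor i; exists (Level j); rewrite uE; split=> //.
  move=> [[w|l||q|b] []] //= [_ il] [_ lj].
  by have := jmin _ il; apply/(sltNge r_wo).
- move=> u /LE; case: u => // [w [/= h _] _|i _ []|_ _].
  + by rewrite ltnn in h.
  + by apply/nonmaxE; exists MaxLevel.
  + split=> // -[[w|i||q|b] []] //= _ [].
    by have [j ij] := r_nomax i; exists (Level j).
- by move=> [//|i||//|//] [//|//|//|q|b] // _; apply/LE.
- by move=> [w|i||q|k] [w'|i'||q'|k'] b // _; rewrite /=; case: (rk b) => [|?] [].
- move=> [//|i||//|//] [//|i'||//|//] [//|//|//|q|k] //=.
  by move=> -> ->.
- move=> [w|i||q|k] _.
  + left; exists (@alpha0 alpha); rewrite /= rk_alpha0.
    by split=> //; have := lset_all w.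
  + by left; exists None; apply/LE.
  + by left; exists None; apply/LE.
  + by right; exists (Level (nl q)).
  + by right; exists MaxLevel.
- move=> [//|//|//|q|//] [//|//|//|q'|k] //=.
    move=> [qq' _]; exists (Level (nl q)), (Level (nl q')).
    by split=> //; apply/tltE.
  by move=> _; exists (Level (nl q)), MaxLevel; split=> //; apply/tltE.
- move=> [//|//|//|q1|//] [//|//|//|q2|//] [//|//|//|q3|k] //=.
    move=> [h12 s12] [h23 s23]; split; first exact: (slt_wo_trans r_wo) h23.
    exact: subset_trans s12.
  by move=> [_ s12]; apply: s12.
- have main (q1 q2 : Node) k : (nc q1) k -> (nc q2) k ->
      [\/ TNode q1 = TNode q2, i_T D (TNode q1) (TNode q2) |
          i_T D (TNode q2) (TNode q1)].
    move=> k1 k2; case: (slt_wo_total r_wo (nl q1) (nl q2)) => h.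
    + constructor 2; split=> //; rewrite (nodeP k1) (nodeP k2).
      exact/agree_le/(sltW r_wo).
    + by constructor 1; congr TNode; apply: node_eq k1 k2.
    + constructor 3; split=> //; rewrite (nodeP k1) (nodeP k2).
      exact/agree_le/(sltW r_wo).
  move=> [//|//|//|q1|//] [//|//|//|q2|//] [//|//|//|q3|k] //=.
    move=> [_ s1] [_ s2]; have [k k3] := node_rep q3.
    by apply: (main _ _ k); [apply: s1|apply: s2].
  exact: main.
- move=> a b y Vy /tltE ba; have [j bE] : exists j, b = Level j.
    by case: b a Vy ba => [w|i||q|k] [w'|i'||q'|k'] //= *; exists i.
  case: a y Vy ba => [//|i||//|//] [//|//|//|q|k] //= Vy; rewrite bE.
    move=> [_ ji]; have [k qk] := node_rep q; exists (TNode (node j k)).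
    split=> //; split; first by rewrite Vy.
    by rewrite (nodeP qk) Vy; apply/agree_le/(sltW r_wo).
  by move=> _; exists (TNode (node j k)).
- move=> [//|i||//|//] [//|//|//|q|k] [//|//|//|q'|k'] //= _ la Vx Vy xy.
    have [k qk] := node_rep q; have [k' q'k] := node_rep q'.
    congr TNode; apply: (node_eq (k := k')) => //; first by rewrite Vx Vy.
    rewrite (nodeP qk) Vx; apply: tree_limit la _ => j ji.
    have := (xy (TNode (node j k))).1; rewrite Vx Vy; case.
      by split=> //; rewrite (nodeP qk) Vx; apply/agree_le/(sltW r_wo).
    by move=> _; apply.
  congr Branch; apply: bf_inj => i; have [j ij] := r_nomax i.
  by have := (xy (TNode (node j k))).1; apply.
- move=> a b x Vx /tltE ab.
  case: a x Vx ab => [//|i||//|//] [//|//|//|q|k] //= Vx ab.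
  have [k qk] := node_rep q; case: b ab => [//|j||//|//] /= ab.
    exists (TNode (node j k)); split=> //; split; first by rewrite Vx; case: ab.
    by rewrite (nodeP qk) Vx; apply/agree_le/(sltW r_wo); case: ab.
  by exists (Branch k).
- move=> b /rk0 b0 u; rewrite /= b0; split; last by move=> [j ->]; exists j.
  by case: u => [w|i||q|k] // [j ->]; exists j.
- by move=> i j [/c_inj].
- by move=> b /no_limit.
- move=> b b1 bb1 u y z h; apply/enumE; rewrite (rkS bb1).
  exact: (FP u (rk_le b)).1 h.
- move=> b b1 bb1 u /enumE; rewrite (rkS bb1) => /(FP u (rk_le b)).2.
  congr surjection; apply/funext => v; rewrite /seg /segment /= (rkS bb1) //.
- move=> u y z h; apply/enumE; rewrite rk_alpha1; exact: (GP u).1 h.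
- move=> u /enumE; rewrite rk_alpha1 => /(GP u).2.
  by rewrite /= rk_alpha0.
Qed.

Lemma tree_L1_countable (b : label alpha) : rk b = 1 ->
  exists e : nat -> U, forall y, i_L D b y <-> exists n, y = e n.
Proof.
move=> b1; apply: countable_range; rewrite /= b1.
  have [|w _ wmin] := wo_least rW_wo (P := setT); first by exists (c 0).
  exists (Lower w); split=> //; rewrite /lset /= (_ : below rW w = set0).
    by rewrite card_le0 => /eqP E; have : [set: nat] 0 by []; rewrite E.
  by apply/seteqP; split=> // v /(sltNge rW_wo); apply; apply: wmin.
apply: card_le_trans lset_countable; apply/card_le_rel.
exists (fun u w => u = Lower w); split=> [[w|i||//|//] //=|u u' w _ _ -> ->//].
by move=> [_ lw]; exists w.
Qed.

Lemma tree_model_card (K : Type) : infinite_set [set: K] ->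
  [set: W] #<= [set: K] -> [set: Mu] #<= [set: K] -> [set: Kb] #<= [set: K] ->
  [set: tree_model] #<= [set: K].
Proof.
move=> Kinf /card_leTP[fW fWI] /card_leTP[fM fMI] /card_leTP[fB fBI].
have [d dI] := infinite_natP Kinf.
have NodeK : [set: Node] #<= [set: K].
  apply: card_le_trans (card_square Kinf); apply/card_le_rel.
  exists (fun q x => exists k, [/\ (nc q) k, x.1 = fM (nl q) & x.2 = fB k]).
  split=> [q _|q q' x _ _ [k [qk -> ->]] [k' [q'k /fMI E /fBI kE]]].
    by have [k qk] := node_rep q; exists (fM (nl q), fB k); split=> //; exists k.
  by apply: (node_eq (k := k)) => //; rewrite kE.
have [fN fNI] := (card_leTP _ _).1 NodeK.
apply: card_le_trans (card_square Kinf).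
apply: (@card_le_fun _ _ _ _ (fun u : tree_model => match u with
  | Lower w => (d 0, fW w) | Level i => (d 1, fM i) | MaxLevel => (d 2, d 0)
  | TNode q => (d 3, fN q) | Branch k => (d 4, fB k) end)) => // u v _ _.
case: u v => [w|i||q|k] [w'|i'||q'|k'] // []; try by move=> /dI.
- by move=> /fWI->.
- by move=> /fMI->.
- by move=> /fNI->.
- by move=> /fBI->.
Qed.

End TreeModel.

Section FiniteFailure.

Variables (alpha : cordinal) (p : nat).
Hypothesis alpha_p : [set: alpha] #= `I_p.+1.

Variable K : Type.
Hypothesis Kinf : infinite_set [set: K].

(** The sets [L_b] for [b] at most alpha are built inside a set [W] of size the
    minimum of [aleph p] and [K], which is as large as the levels require and keeps
    the size of the model at [K]. *)
Lemma ap_fails_of_tree (Mu : Type) (r : rel Mu) (i0 : Mu) (Kb X : Type)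
    (bf : Kb -> Mu -> X) (k0 : Kb) :
  well_order r -> (forall i, exists j, slt r i j) ->
  (forall k k', (forall i, bf k i = bf k' i) -> k = k') ->
  (forall i, [set j | r j i] #<= [set: aleph p]) ->
  (forall i, [set S | exists k, S = agree r bf i k] #<= [set: aleph p]) ->
  [set: Mu] #<= [set: K] -> [set: Kb] #<= [set: K] ->
  [set: K] #<= [set: Mu] \/ [set: K] #<= [set: Kb] ->
  ~ AP (psi alpha) K.
Proof.
move=> r_wo r_nomax bf_inj seg_small level_small MuK KbK KMuKb.
have [rk [rk0 rkS rka rk1]] := rank_exists alpha_p.
have no_limit := finite_no_limit alpha_p.
have [W [Winf Wp WK Wmax]] : exists W : Type, [/\ infinite_set [set: W],
    [set: W] #<= [set: aleph p], [set: W] #<= [set: K] &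
    forall (T : Type) (A : set T), A #<= [set: aleph p] -> A #<= [set: K] ->
      A #<= [set: W]].
  have [pK|Kp] := card_total (aleph p) K.
    by exists (aleph p); split=> //; apply: aleph_infinite.
  by exists K.
have [rW rWi] := initial_order_exists W.
have [c cI] := infinite_natP Winf.
have segK i : [set j | r j i] #<= [set: W].
  by apply: Wmax => //; apply: card_le_trans MuK; apply: card_leT.
have levelK i : [set S | exists k, S = agree r bf i k] #<= [set: W].
  apply: Wmax => //; apply: card_le_trans KbK; apply/card_le_rel.
  exists (fun S k => S = agree r bf i k); split=> [S [k ->]|S S' k _ _ -> ->//].
  by exists k.
have gD := tree_good no_limit rk0 rkS rka rk1 rWi Wp cI i0 r_wo r_nomax k0 bf_inj
  segK levelK.
have [b0 b0P] := label_zero_exists alpha.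
have [b b0E] : exists b, b0 = Some b.
  case: b0 b0P => [b _|/negP[]]; first by exists b.
  exact: label_succ_pos (label_succ_alpha alpha).
have [b1 bb1] := label_succ_exists b.
have b01 : label_succ b0 (val b1) by rewrite b0E.
have rkb1 : rk (val b1) = 1 by rewrite (rkS _ _ b01) ((rk0 b0).1 b0P).
have [e eP] := tree_L1_countable rWi Wp cI i0 r_wo k0 segK levelK rkb1.
apply: (ap_fails_of_countable_L1 gD b0P b01 _ eP) => //.
  by move=> E; move: rkb1; rewrite E rk1.
rewrite card_eq_le; apply/andP; split; first exact: tree_model_card.
case: KMuKb => [KM|KB].
  apply: card_le_trans KM _.
  by apply: (@card_le_fun _ _ _ _ (fun i => Level W r bf i)) => // ? ? _ _ [].
apply: card_le_trans KB _.
by apply: (@card_le_fun _ _ _ _ (fun k => Branch W r bf k)) => // ? ? _ _ [].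
Qed.

(** Below a last element there would be as many elements as in the whole set. *)
Lemma initial_order_nomax (Mu : Type) (r : rel Mu) : initial_order r ->
  infinite_set [set: Mu] -> forall i, exists j, slt r i j.
Proof.
move=> [wo init] Minf i; apply: contrapT => /forallNP nj.
have below_inf : infinite_set (below r i).
  move=> fin; apply: Minf; apply: (@sub_finite_set _ _ (below r i `|` [set i])).
    move=> j _; case: (slt_wo_total wo i j) => [/nj//|->|]; first by right.
    by left.
  by rewrite finite_setU.
apply: (init i); rewrite -(card_le_eqr (card_setT (below r i))).
apply: (@card_le_trans _ _ _ [set j | below r i j \/ j = i]).
  apply: subset_card_le => j _; case: (slt_wo_total wo i j) => [/nj//|->|].
    by right.
  by left.
apply: card_le_add1; last by rewrite (card_le_eqr (card_setT (below r i))).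
by apply/infiniteP; rewrite (card_le_eqr (card_setT (below r i))); apply/infiniteP.
Qed.

Lemma initial_order_seg (Mu : Type) (r : rel Mu) : initial_order r ->
  [set: Mu] #<= [set: aleph p.+1] ->
  forall i, [set j | r j i] #<= [set: aleph p].
Proof.
move=> [wo init] Mp i.
have h : below r i #<= [set: aleph p].
  by apply: card_succ_le => /(card_le_trans Mp); apply: init.
apply: card_le_trans (card_le_add1 (@aleph_infinite p) i h).
apply: subset_card_le => j ji; have [->|nji] := pselect (j = i); first by right.
by left; apply/(slt_def wo).
Qed.

(** A tree with a single branch, whose levels are indexed by [K] itself. *)
Lemma ap_fails_small : [set: K] #<= [set: aleph p.+1] -> ~ AP (psi alpha) K.
Proof.
move=> Kp; have [r ri] := initial_order_exists K; have [wo _] := ri.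
have [c _] := infinite_natP Kinf.
apply: (@ap_fails_of_tree K r (c 0) unit unit (fun _ _ => tt) tt) => //.
- exact: initial_order_nomax.
- by move=> [] [].
- exact: initial_order_seg.
- move=> i; apply: (card_le_countable (@aleph_infinite p)).
  apply: (card_le_trans _ (countable1 [set: unit])).
  apply: subset_card_le => S [k ->]; apply/seteqP; split=> // -[] _ j.
- apply: (card_le_countable Kinf); exact: countableP.
- by left.
Qed.

Section FromKurepaTree.

Variables (Mu X : Type) (r : rel Mu) (t : rel X).
Hypothesis r_wo : well_order r.
Hypothesis t_tree : tree_order t.

Let t_trans x y z : t x y -> t y z -> t x z.
Proof. by have [[[_ tr] _] _] := t_tree; apply: tr. Qed.

Let t_refl x : t x x.
Proof. by have [[[rf _] _] _] := t_tree; apply: rf. Qed.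

Let t_anti x y : t x y -> t y x -> x = y.
Proof. by have [[_ an] _] := t_tree => xy yx; apply: an; rewrite xy. Qed.

Lemma tree_order_below_total x y z : slt t y x -> slt t z x -> t y z \/ t z y.
Proof.
move=> yx zx; have [_ /(_ x) wo] := t_tree.
have [||m [[mA mmin] _]] := wo [pred u | `[< u = y \/ u = z >]].
- by move=> u /asboolP[]->; apply/mem_set.
- by exists y; apply/asboolP; left.
have yA : y \in [pred u | `[< u = y \/ u = z >]] by apply/asboolP; left.
have zA : z \in [pred u | `[< u = y \/ u = z >]] by apply/asboolP; right.
by move: mA => /asboolP[mE|mE]; [left; rewrite -mE; apply: mmin|
  right; rewrite -mE; apply: mmin].
Qed.

(** A maximal chain is closed downwards, so its element at a position has the
    corresponding level. *)
Lemma tree_branch_enum (B : set X) : tree_branch t r B ->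
  exists g : Mu -> X, [/\ forall x, B x <-> exists i, x = g i,
    forall i j, t (g i) (g j) = r i j,
    forall i y, slt t y (g i) -> exists j, y = g j &
    forall i, tree_level t r i (g i)].
Proof.
move=> [Btot Bmax [f [[fB fI fS] fr]]].
have ex i : exists x, B x /\ f x = i by have [x ? ?] := fS i I; exists x.
pose g i := projT1 (cid (ex i)).
have gB i : B (g i) by rewrite /g; case: cid => x [].
have fg i : f (g i) = i by rewrite /g; case: cid => x [].
have gf x : B x -> g (f x) = x.
  by move=> Bx; apply: fI; rewrite ?fg//; apply/mem_set.
have grt i j : t (g i) (g j) = r i j by rewrite fr// !fg.
have down x y : B x -> slt t y x -> B y.
  move=> Bx yx; have /andP[tyx _] := yx.
  have cmp z : B z -> t z y \/ t y z.
    move=> Bz; have [zx|xz] := Btot _ _ Bz Bx; last by right; apply: t_trans xz.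
    have [xz|nxz] := boolP (t x z); first by right; apply: t_trans xz.
    by apply: (@tree_order_below_total x) => //; rewrite /slt zx nxz.
  rewrite -(Bmax (B `|` [set y])); first by right.
    move=> u v [Bu|->] [Bv|->]; first exact: Btot.
    - exact: cmp.
    - by case: (cmp _ Bv); [right|left].
    - by left.
  by move=> u; left.
exists g; split=> //.
- by move=> x; split=> [Bx|[i ->]]; [exists (f x); rewrite gf|].
- by move=> i y /(down _ _ (gB i)) By; exists (f y); rewrite gf.
move=> i; exists f; split; last first.
  by move=> x y /(down _ _ (gB i)) Bx /(down _ _ (gB i)) By; apply: fr.
split.
- move=> x xi; have Bx := down _ _ (gB i) xi.
  by move: xi; rewrite /below /slt /= -(gf x)// !grt fg.
- move=> x y /set_mem/(down _ _ (gB i)) Bx /set_mem/(down _ _ (gB i)) By.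
  by apply: fI; apply/mem_set.
- move=> j ji; exists (g j); last exact: fg.
  by move: ji; rewrite /below /slt /= !grt.
Qed.

(** The node of a branch at a level determines the smaller nodes of the branch,
    because order isomorphisms between initial segments of well-orders are
    unique. *)
Lemma branch_agree (g g' : Mu -> X) :
  (forall i j, t (g i) (g j) = r i j) -> (forall i j, t (g' i) (g' j) = r i j) ->
  (forall i y, slt t y (g i) -> exists j, y = g j) ->
  (forall i y, slt t y (g' i) -> exists j, y = g' j) ->
  forall i, g i = g' i -> forall j, slt r j i -> g j = g' j.
Proof.
move=> gr gr' gd gd' i gi; have slt_g h : (forall i j, t (h i) (h j) = r i j) ->
    forall j, slt r j i -> slt t (h j) (h i).
  by move=> hr j; rewrite /slt !hr.
have g_inj h : (forall i j, t (h i) (h j) = r i j) -> injective h.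
  move=> hr j k jk; apply: (wo_antisym r_wo).
    by rewrite -hr jk t_refl.
  by rewrite -hr jk t_refl.
elim/(wo_ind r_wo) => j IH ji.
have [j1 gj] : exists j1, g j = g' j1 by apply: (gd' i); rewrite -gi; apply: slt_g.
have [j2 gj'] : exists j2, g' j = g j2 by apply: (gd i); rewrite gi; apply: slt_g.
have lt_i k : slt r k j -> slt r k i by move=> kj; apply: (slt_wo_trans r_wo) ji.
apply: t_anti.
  rewrite gj' gr; have [//|/(sltNge r_wo) j2j] := pselect (r j j2 : Prop).
  have := IH _ j2j (lt_i _ j2j); rewrite -gj' => /(g_inj _ gr') E.
  by move: j2j; rewrite -E => /(slt_wo_irr r_wo).
rewrite gj gr'; have [//|/(sltNge r_wo) j1j] := pselect (r j j1 : Prop).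
have := IH _ j1j (lt_i _ j1j); rewrite -gj => /(g_inj _ gr) E.
by move: j1j; rewrite E => /(slt_wo_irr r_wo).
Qed.

End FromKurepaTree.

(** The branches of the Kurepa tree form the level of the maximum.  By
    [branch_agree], there are no more classes of branches at a level than nodes of
    the Kurepa tree. *)
Lemma ap_fails_kurepa (Mu : Type) : [set: Mu] #<= [set: aleph p.+1] ->
  kurepa_tree_exists Mu (aleph p.+1) K -> ~ AP (psi alpha) K.
Proof.
move=> Mp [[Minf _ pK _] [r [X [t [ri tt _ lev br]]]]].
have [wo _] := ri; have [c _] := infinite_natP Kinf.
have [m _] := infinite_natP Minf.
have [B [Bbr BI]] := card_le_funE (set0 : set X) br.
have ex k := tree_branch_enum tt (Bbr k I).
pose g k := projT1 (cid (ex k)).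
have gP k : [/\ forall x, B k x <-> exists i, x = g k i,
    forall i j, t (g k i) (g k j) = r i j,
    forall i y, slt t y (g k i) -> exists j, y = g k j &
    forall i, tree_level t r i (g k i)] by rewrite /g; case: cid.
apply: (@ap_fails_of_tree Mu r (m 0) K X g (c 0)) => //.
- exact: initial_order_nomax.
- move=> k k' gg; apply: BI => //; apply/seteqP; split=> x.
    have [h _ _ _] := gP k; have [h' _ _ _] := gP k'.
    by move=> /h[i ->]; apply/h'; exists i.
  have [h _ _ _] := gP k; have [h' _ _ _] := gP k'.
  by move=> /h'[i ->]; apply/h; exists i.
- exact: initial_order_seg.
- move=> i; apply: card_le_trans (card_succ_le (lev i)); apply/card_le_rel.
  exists (fun S x => exists2 k, S = agree r g i k & x = g k i); split.
    by move=> S [k ->]; exists (g k i); split; [case: (gP k)|exists k].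
  move=> S S' x _ _ [k -> ->] [k' -> kk'].
  have [_ hr hd _] := gP k; have [_ hr' hd' _] := gP k'.
  have agr j : slt r j i -> g k j = g k' j.
    exact: (branch_agree wo tt hr hr' hd hd' kk').
  by apply/seteqP; split=> k2 h j ji; rewrite -h// ?agr.
- exact: card_le_trans pK.
- by right.
Qed.

End FiniteFailure.

(** * Sizes of models for finite alpha *)

Section Sizes.

Variables (alpha : cordinal) (n : nat) (rk : label alpha -> nat).
Hypothesis no_limit : forall b : label alpha, ~ label_limit b.
Hypothesis rk0 : forall b, ~~ label_pos b <-> rk b = 0.
Hypothesis rkS : forall b c, label_succ b c -> rk c = (rk b).+1.
Hypothesis rk_alpha0 : rk (@alpha0 alpha) = n.

Let rk_le_n (b : label alpha) : b <> None -> rk b <= n.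
Proof. by rewrite -rk_alpha0; apply: rank_le_alpha0. Qed.

Section OneModel.

Variables (U : Type) (D : interp alpha U).
Hypothesis gD : good D.

Lemma segment_card (b : osucc alpha) (b1 : pos_label alpha) x :
  label_succ (Some b) (val b1) -> enumerated D (val b1) x ->
  [set y | segment D b1 x y] #<= [set y | i_L D (Some b) y].
Proof.
move=> bb1 /(g_F gD bb1)[h t f s].
apply: (@card_le_surj _ _ _ _ (i_F D b x)) => [y /s[z yz]|]; last exact: f.
by exists z; split=> //; have [] := h _ _ yz.
Qed.

Lemma level_card x : nonmax D x ->
  [set y | i_V D x y] #<= [set y | i_L D (@alpha0 alpha) y].
Proof.
move=> /(top_G gD)[h t f s].
apply: (@card_le_surj _ _ _ _ (i_G D x)) => [y /s[z yz]|]; last exact: f.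
by exists z; split=> //; have [] := h _ _ yz.
Qed.

(** The initial segments of [L_(b+1)] are images of [L_b], so they are all shorter
    than the next cardinal. *)
Lemma enumerated_card (T : Type) (b : osucc alpha) (b1 : pos_label alpha) :
  infinite_set [set: T] -> label_succ (Some b) (val b1) ->
  [set y | i_L D (Some b) y] #<= [set: T] ->
  [set x | enumerated D (val b1) x] #<= [set: card_succ T].
Proof.
move=> Tinf bb1 LT.
have sT : infinite_set [set: card_succ T].
  apply/infiniteP; apply: card_le_trans (not_card_leW (card_succP T).1).
  exact/infiniteP.
apply: (card_le_short_segments sT (le := fun y x => y = x \/ i_lt D b1 y x)).
  have [_ _ _ c] := g_order gD b1.
  by move=> x y [Lx _] [Ly _]; case: (c x y Lx Ly) => [->|?|?];
    [left; left|left; right|right; right].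
move=> x ex; apply: card_succ_gt.
apply: card_le_trans LT; apply: card_le_trans (segment_card bb1 ex).
by apply: subset_card_le => y [[Ly _] yx].
Qed.

Lemma L_enumerated (b : label alpha) x : b <> None ->
  enumerated D b x <-> i_L D b x.
Proof. by move=> bN; split=> [[]|]. Qed.

Lemma L_card (b : label alpha) : b <> None ->
  [set y | i_L D b y] #<= [set: aleph (rk b)].
Proof.
elim/label_ind: b => b IH bN; case: (label_cases b) => [b0|[c cb]|/no_limit//].
  rewrite ((rk0 b).1 b0); apply: card_le_trans (card_image_le (i_c D) [set: nat]).
  by apply: subset_card_le => y /(g_L0 gD b0)[k ->]; exists k.
have bp := label_succ_pos cb.
case: c cb => [c|] cb; last by case: (alpha1_no_succ cb).
pose pb : pos_label alpha := exist _ b bp.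
have cN : (Some c : label alpha) <> None by [].
have := enumerated_card (b1 := pb) (@aleph_infinite _) cb (IH _ (label_succ_lt cb) cN).
rewrite (rkS cb); apply: card_le_trans; apply: subset_card_le => y.
by move=> /(L_enumerated _ bN).
Qed.

(** [L_b] has the largest size that [L_card] allows. *)
Definition full (b : label alpha) :=
  [set: aleph (rk b)] #<= [set y | i_L D b y].

(** By [enumerated_card], a smaller [L_c] would make [L_b] too small. *)
Lemma full_pred (b c : label alpha) : b <> None -> label_succ c b ->
  full b -> full c.
Proof.
move=> bN cb fb; apply: contrapT => nfc.
case: c cb nfc => [c|] cb nfc; last by case: (alpha1_no_succ cb).
case E : (rk (Some c)) => [|k].
  apply: nfc; rewrite /full E.
  apply: (@card_le_fun _ _ _ _ (i_c D)) => [j _|i j _ _ /(g_c_inj gD)//].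
  by apply/(g_L0 gD ((rk0 _).2 E)); exists j.
have bp := label_succ_pos cb.
pose pb : pos_label alpha := exist _ b bp.
have Lc : [set y | i_L D (Some c) y] #<= [set: aleph k].
  by apply: card_succ_le => h; apply: nfc; rewrite /full E.
have := enumerated_card (b1 := pb) (@aleph_infinite _) cb Lc.
rewrite -/(aleph k.+1) => Lb; move: fb; rewrite /full (rkS cb) E.
apply: card_succ_gt; apply: card_le_trans Lb.
by apply: subset_card_le => y /(L_enumerated _ bN).
Qed.

Lemma all_full : full (@alpha0 alpha) ->
  forall b, b <> None -> full b.
Proof.
move=> f0; suff h (b : label alpha) : b <> None -> full b ->
    forall c, label_lt c b -> full c.
  by move=> b /label_le_alpha0[bl|->//]; apply: (h (@alpha0 alpha)).
elim/label_ind: b => b IH bN fb c cb.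
case: (label_cases b) => [/negP[]|[d db]|/no_limit//].
  by apply/label_posP; exists c.
have fd := full_pred bN db fb.
have [_ /(_ _ cb)[cd|->//]] := (label_succP _ _).1 db.
apply: IH cd => //; first exact: label_succ_lt.
by move=> dN; move: db; rewrite dN => /alpha1_no_succ.
Qed.

Lemma part_card_le (T : Type) (A : set U) : infinite_set [set: T] ->
  (forall b, [set y | i_L D b y] #<= [set: T]) -> A #<= [set: T] ->
  (forall a, A a -> [set y | i_V D a y] #<= [set: T]) ->
  [set y | (exists b, i_L D b y) \/ exists2 a, A a & i_V D a y] #<= [set: T].
Proof.
move=> Tinf LT AT VT.
have h1 : \bigcup_(b in [set: label alpha]) [set y | i_L D b y] #<= [set: T].
  by apply: card_le_bigcup => //; apply/card_le_countable/countableP.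
have h2 : \bigcup_(a in A) [set y | i_V D a y] #<= [set: T].
  exact: card_le_bigcup.
apply: card_le_trans (card_le_setU Tinf h1 h2); apply: subset_card_le => y.
by move=> [[b Ly]|[a Aa Vy]]; [left; exists b|right; exists a].
Qed.

Lemma model_card_le (T : Type) : infinite_set [set: T] ->
  (forall b, [set y | i_L D b y] #<= [set: T]) ->
  (forall a, i_L D None a -> [set y | i_V D a y] #<= [set: T]) ->
  [set: U] #<= [set: T].
Proof.
move=> Tinf LT VT.
apply: card_le_trans (part_card_le (A := [set a | i_L D None a]) Tinf LT _ VT) => //.
apply: subset_card_le => y _.
case: (g_cover gD (x := y)) => // -[a Vy]; first by left; exists a.
by right; exists a => //; apply: (g_VL gD Vy).
Qed.

Definition ismax m := i_L D None m /\ ~ nonmax D m.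
Definition istop y := exists2 m, ismax m & i_V D m y.

Lemma nonmax_lt_max x m : nonmax D x -> ismax m -> top_lt D x m.
Proof.
move=> [y xy] [Lm nm]; have [Lx _] := top_ltL gD xy.
case: (top_lt_total gD Lx Lm) => // [E|mx]; case: nm; last by exists x.
by rewrite -E; exists y.
Qed.

Lemma ismax_uniq m m' : ismax m -> ismax m' -> m = m'.
Proof.
move=> [Lm nm] [Lm' nm']; case: (top_lt_total gD Lm Lm') => // h.
  by case: nm; exists m'.
by case: nm'; exists m.
Qed.

Lemma max_limit m : ismax m -> limit D m.
Proof. by case; apply: (g_max gD). Qed.

Lemma top_card_le (T : Type) : infinite_set [set: T] ->
  [set x | nonmax D x] #<= [set: T] -> [set y | i_L D None y] #<= [set: T].
Proof.
move=> Tinf AT; have [[m mm]|nm] := pselect (exists m, ismax m).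
  apply: card_le_trans (card_le_add1 Tinf m AT).
  apply: subset_card_le => y Ly; have [|ny] := pselect (nonmax D y); first by left.
  by right; apply: ismax_uniq.
apply: card_le_trans AT; apply: subset_card_le => y Ly; apply: contrapT => ny.
by apply: nm; exists y.
Qed.

Lemma same_predecessors y y' : istop y -> istop y' ->
  (forall z, (exists2 a, nonmax D a & i_V D a z) -> i_T D z y <-> i_T D z y') ->
  y = y'.
Proof.
move=> [m mm Vy] [m' mm' Vy'] yy'; rewrite -(ismax_uniq mm mm') in Vy'.
apply: (g_T_limit gD mm.1 (max_limit mm) Vy Vy') => z.
by split=> zy; apply/yy' => //; have [a [b [Va _ ab]]] := g_TV gD zy;
  exists a => //; exists b.
Qed.

End OneModel.

(** * Rigidity *)

Section Extension.

Variables (U V : Type) (D : interp alpha U) (E : interp alpha V) (f : U -> V).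
Hypothesis gD : good D.
Hypothesis gE : good E.
Hypothesis fP : interp_embedding D E f.

Lemma nonmax_image x : nonmax D x -> nonmax E (f x).
Proof. by move=> [y xy]; exists (f y); apply/(e_lt fP). Qed.

(** The enumeration of the segment below an old element is already in the smaller
    model. *)
Lemma segment_image (b : osucc alpha) (b1 : pos_label alpha) x y :
  label_succ (Some b) (val b1) ->
  (forall w, i_L E (Some b) w -> exists z, w = f z) ->
  enumerated D (val b1) x -> segment E b1 (f x) y -> exists y0, y = f y0.
Proof.
move=> bb1 Lim ex yx.
have ex' : enumerated E (val b1) (f x).
  by case: ex => Lx nx; split; [apply/(e_L fP)|move=> /nx/nonmax_image].
have [h _ F s] := g_F gE bb1 ex'; have [h' t _ _] := g_F gD bb1 ex.
have [w Fw] := s _ yx; have [/[dup] Lw /Lim[z wz] _] := h _ _ Fw.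
have [|y0 Fy0] := t z; first by apply/(e_L fP); rewrite -wz.
by exists y0; apply: F Fw _; rewrite wz; apply/(e_F fP).
Qed.

Hypothesis fullD : full D (@alpha0 alpha).

(** A new element of [L_b] cannot lie below an old one, whose segment is enumerated
    by the previous set, and an element above all the old ones would have too many
    predecessors. *)
Lemma L_rigid (b : label alpha) : b <> None ->
  forall y, i_L E b y -> exists x, y = f x.
Proof.
elim/label_ind: b => b IH bN y Ly.
case: (label_cases b) => [b0|[c cb]|/no_limit//].
  have [k ->] := (g_L0 gE b0 y).1 Ly; exists (i_c D k).
  by rewrite (e_c fP).
case: c cb => [c|] cb; last by case: (alpha1_no_succ cb).
have bp := label_succ_pos cb; pose pb : pos_label alpha := exist _ b bp.
have Lim w : i_L E (Some c) w -> exists z, w = f z.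
  by apply: IH => //; apply: label_succ_lt.
have [[x [Lx yx]]|nb] := pselect
    (exists x, i_L D b x /\ (y = f x \/ i_lt E pb y (f x))).
  by apply: (@segment_image c pb x); first exact: cb; [|apply/L_enumerated|].
have bound x : i_L D b x -> i_lt E pb (f x) y.
  move=> Lx; have [_ _ _ tot] := g_order gE pb.
  case: (tot (f x) y); [exact/(e_L fP)|exact: Ly| |by []|] => h; case: nb; exists x.
    by split=> //; left.
  by split=> //; right.
have : full D b by apply: all_full.
rewrite /full (rkS cb) => Db; case: (@card_succ_gt _ _ _ _ Db).
have : [set z | segment E pb y z] #<= [set: aleph (rk (Some c))].
  apply: card_le_trans (L_card gE _) => //.
  by apply: segment_card => //; apply/L_enumerated.
apply: card_le_trans; apply: (@card_le_fun _ _ _ _ f) => [x Lx|x x' _ _ /(e_inj fP)//].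
by split; [apply/(e_L fP)|right; apply: bound].
Qed.

Hypothesis big : ~ ([set: U] #<= [set: aleph n]).

(** The levels below the maximum do not grow either.  A new level [y] above them all
    would bound their number by [aleph n].  It would also bound the size of the
    level of an old maximum [m]: if [y] is below [m], distinct elements of that
    level have distinct predecessors at level [y], because [m] is a limit; and if
    [y] is not below [m], then [m] is no longer a maximum. *)
Lemma nonmax_rigid y : nonmax E y -> exists2 x, nonmax D x & y = f x.
Proof.
move=> ny; have a0N : @alpha0 alpha <> None by [].
have [[x nx yx]|nb] :=
    pselect (exists2 x, nonmax D x & y = f x \/ top_lt E y (f x)).
  have [|y0 yE] := @segment_image None (palpha1 alpha) x y (label_succ_alpha alpha)
      (L_rigid a0N) ((enumerated_top gD x).2 nx).
    split=> //; by have [z /(top_ltL gE)[]] := ny.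
  exists y0 => //; case: yx => [|yx]; first by rewrite yE => /(e_inj fP)->.
  by exists x; apply/(e_lt fP); rewrite -yE.
have Ly : i_L E None y by have [z /(top_ltL gE)[]] := ny.
have bound x : nonmax D x -> top_lt E (f x) y.
  move=> nx; have nfx := nonmax_image nx.
  have Lfx : i_L E None (f x) by have [z /(top_ltL gE)[]] := nfx.
  by case: (top_lt_total gE Lfx Ly) => // h; case: nb; exists x => //; [left|right].
have LE : [set z | i_L E (@alpha0 alpha) z] #<= [set: aleph n].
  by have := L_card gE a0N; rewrite rk_alpha0.
have LD : [set z | i_L D (@alpha0 alpha) z] #<= [set: aleph n].
  by have := L_card gD a0N; rewrite rk_alpha0.
have VE w : nonmax E w -> [set z | i_V E w z] #<= [set: aleph n].
  by move=> /(level_card gE)/card_le_trans; apply.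
have VDE a : nonmax E (f a) -> [set z | i_V D a z] #<= [set: aleph n].
  move=> /VE; apply: card_le_trans.
  apply: (@card_le_fun _ _ _ _ f) => [z Vz|z z' _ _ /(e_inj fP)//].
  exact/(e_V fP).
case: big; apply: (model_card_le gD (@aleph_infinite n)).
  case=> [b|].
    have bN : (Some b : label alpha) <> None by [].
    exact: card_le_trans (L_card gD bN) (aleph_le (rk_le_n bN)).
  apply: (top_card_le gD (@aleph_infinite n)).
  apply: card_le_trans LE.
  have := segment_card gE (b1 := palpha1 alpha) (label_succ_alpha alpha)
    ((enumerated_top gE y).2 ny).
  apply: card_le_trans.
  apply: (@card_le_fun _ _ _ _ f) => [x nx|x x' _ _ /(e_inj fP)//].
  split; last by right; apply: bound.
  by have [z /(top_ltL gE)[]] := nonmax_image nx.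
move=> m Lm; have [nm|nm] := pselect (nonmax D m).
  exact/VDE/nonmax_image.
have mm : ismax D m by [].
have Lfm : i_L E None (f m) by apply/(e_L fP).
have [E1|E1|yfm] := top_lt_total gE Lfm Ly.
- by apply: VDE; rewrite E1.
- by apply: VDE; exists y.
apply: card_le_trans (VE _ ny); apply/card_le_rel.
exists (fun v u => i_V E y u /\ i_T E u (f v)); split.
  move=> v Vv; have [|u [Vu uv]] := g_T_pred gE (a := f m) (y := f v) _ yfm.
    exact/(e_V fP).
  by exists u.
have pred u a z w w' : i_V E y u -> nonmax D a -> i_V D a z ->
    i_T E u (f w) -> i_T E u (f w') -> i_T D z w -> i_T D z w'.
  move=> Vu na Va uw uw' /(e_T fP) zw; apply/(e_T fP).
  have Vfa : i_V E (f a) (f z) by apply/(e_V fP).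
  have fay := bound _ na; case: (g_T_tree gE zw uw) => [zu|zu|uz].
  - by rewrite zu.
  - exact: g_T_trans gE _ _ _ zu uw'.
  - have [c [d [Vc Vd cd]]] := g_TV gE uz; case: (top_lt_irr gE (x := y)).
    apply: (top_lt_trans gE) fay.
    by rewrite (g_V_fun gE Vu Vc) (g_V_fun gE Vfa Vd).
move=> v v' u Vv Vv' [Vu uv] [_ uv']; apply: (same_predecessors gD).
- by exists m.
- by exists m.
- by move=> z [a na Va]; split; apply: pred Vu na Va _ _.
Qed.

Lemma nonmax_imageE x : nonmax E (f x) <-> nonmax D x.
Proof.
by split=> [/nonmax_rigid[x' nx' /(e_inj fP)->]//|]; apply: nonmax_image.
Qed.

Lemma level_rigid a y : nonmax E a -> i_V E a y -> exists x, y = f x.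
Proof.
move=> /nonmax_rigid[x nx ->] Vy; have nfx := nonmax_image nx.
have [h _ F s] := top_G gE nfx; have [_ t _ _] := top_G gD nx.
have [w Gw] := s _ Vy; have [Lw _] := h _ _ Gw.
have a0N : @alpha0 alpha <> None by [].
have [z wz] := L_rigid a0N Lw; have [|y0 Gy0] := t z.
  by apply/(e_L fP); rewrite -wz.
by exists y0; apply: F Gw _; rewrite wz; apply/(e_G fP).
Qed.

Lemma ismax_image x : ismax E (f x) <-> ismax D x.
Proof.
by split=> -[Lx nx]; split; try exact/(e_L fP); move=> /nonmax_imageE.
Qed.

Lemma istop_image x : istop E (f x) <-> istop D x.
Proof.
split=> [[m mm Vx]|[m mm Vx]]; last first.
  by exists (f m); [apply/ismax_image|apply/(e_V fP)].
case: (g_cover gD (x := x)) => // [[b Lx]|[a Va]].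
  by case: (g_V_notL gE Vx (b := b)); apply/(e_L fP).
exists a => //; apply/ismax_image.
by rewrite -(g_V_fun gE Vx ((e_V fP _ _).1 Va)).
Qed.

Lemma extension_cases y : [\/ exists x, y = f x, ismax E y | istop E y].
Proof.
case: (g_cover gE (x := y)) => // [[[b|] Ly]|[a Va]].
- by constructor 1; apply: (@L_rigid (Some b)).
- have [/nonmax_rigid[x _ ->]|ny] := pselect (nonmax E y).
    by constructor 1; exists x.
  by constructor 2.
- have [/level_rigid/(_ Va)|na] := pselect (nonmax E a); first by constructor 1.
  by constructor 3; exists a => //; split=> //; apply: (g_VL gE Va).
Qed.

Lemma F_range (b : osucc alpha) u y z : i_F E b u y z ->
  [/\ exists x, u = f x, exists x, y = f x & exists x, z = f x].
Proof.
have [b1 bb1] := label_succ_exists b => Fu.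
have eu := g_F_dom gE bb1 Fu; have [h _ _ _] := g_F gE bb1 eu.
have [Ly [Lz zu]] := h _ _ Fu.
have yr : exists x, y = f x by apply: L_rigid Ly.
have [b1N|b1N] := pselect (val b1 = None); last first.
  by split=> //; [apply: L_rigid b1N _ eu.1|apply: L_rigid b1N _ Lz].
rewrite b1N in eu; have nu := (enumerated_top gE _).1 eu.
rewrite (palpha1E b1N) in zu.
have nz : nonmax E z by case: zu => [->//|zu]; exists u.
split=> //.
- by have [x _ ?] := nonmax_rigid nu; exists x.
- by have [x _ ?] := nonmax_rigid nz; exists x.
Qed.

Lemma G_range u y z : i_G E u y z ->
  [/\ exists x, u = f x, exists x, y = f x & exists x, z = f x].
Proof.
move=> Gu; have /(enumerated_top gE) nu := g_G_dom gE Gu.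
have [h _ _ _] := top_G gE nu; have [Ly Vz] := h _ _ Gu.
split; last exact: level_rigid nu Vz.
  by have [x _ ?] := nonmax_rigid nu; exists x.
by apply: L_rigid Ly.
Qed.

Lemma S_range u v : i_S E u v -> (exists x, u = f x) /\ (exists x, v = f x).
Proof.
move=> uv; have [tuv _] := (g_S gE _ _).1 uv.
have nu : nonmax E u by exists v.
split; first by have [x _ ?] := nonmax_rigid nu; exists x.
have [|nv] := pselect (nonmax E v).
  by move=> /nonmax_rigid[x _ ?]; exists x.
have [_ []] : limit E v by apply: (g_max gE) nv; have [] := top_ltL gE tuv.
by exists u.
Qed.

Lemma T_range u v : i_T E u v -> exists x, u = f x.
Proof.
move=> /(g_TV gE)[a [b [Va _ ab]]]; apply: level_rigid Va.
by exists b.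
Qed.

End Extension.

Section MaximumLevel.

Variables (U V N : Type) (D : interp alpha U) (E : interp alpha V)
  (P : interp alpha N) (f : U -> V) (h : U -> N) (g : V -> N).
Hypothesis gD : good D.
Hypothesis gE : good E.
Hypothesis gP : good P.
Hypothesis fP : interp_embedding D E f.
Hypothesis hP : interp_embedding D P h.
Hypothesis fullD : full D (@alpha0 alpha).
Hypothesis big : ~ ([set: U] #<= [set: aleph n]).
Hypothesis gf : forall x, g (f x) = h x.
Hypothesis g_inj : injective g.
Hypothesis g_ismax : forall y, ismax E y -> ismax P (g y).
Hypothesis g_istop : forall y, istop E y -> istop P (g y).
Hypothesis gT : forall x y, istop E y -> i_T E (f x) y <-> i_T P (h x) (g y).

Let range_f u x : g u = h x -> u = f x.
Proof. by rewrite -gf => /g_inj. Qed.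

Let not_topL b y : istop E y -> ~ i_L P b (g y).
Proof. by move=> /g_istop[m _]; apply: (g_V_notL gP). Qed.

Let L_iff b y : i_L E b y <-> i_L P b (g y).
Proof.
have [[x ->]|my|ty] := extension_cases gD gE fP fullD big y.
- by rewrite gf; apply: (iff_trans (iff_sym (e_L fP b x))); apply: (e_L hP).
- have mgy := g_ismax my; have [->|bN] := pselect (b = None).
    by split=> _; [case: mgy|case: my].
  split=> Ly.
    have [x E1] := L_rigid gD gE fP fullD bN Ly; move: Ly; rewrite E1 gf.
    by move=> /(e_L fP)/(e_L hP).
  have [x /range_f E1] := L_rigid gD gP hP fullD bN Ly; move: Ly.
  by rewrite E1 gf => /(e_L hP)/(e_L fP).
- split=> [Ly|/(not_topL ty)//]; have [m _ Vy] := ty.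
  by case: (g_V_notL gE Vy Ly).
Qed.

Let nonmax_iff u : nonmax E u <-> nonmax P (g u).
Proof.
split=> [/(nonmax_rigid gD gE fP fullD big)[x nx ->]|].
  by rewrite gf; apply: nonmax_image hP _ nx.
move=> /(nonmax_rigid gD gP hP fullD big)[x nx /range_f->].
exact: nonmax_image fP _ nx.
Qed.

Let top_lt_iff u v : top_lt E u v <-> top_lt P (g u) (g v).
Proof.
suff h1 : nonmax E u -> top_lt E u v <-> top_lt P (g u) (g v).
  split=> [uv|uv]; first by apply/h1 => //; exists v.
  by apply/h1 => //; apply/nonmax_iff; exists (g v).
move=> nu; have ngu := (nonmax_iff u).1 nu.
have [nv|nv] := pselect (nonmax E v).
  have [x _ ->] := nonmax_rigid gD gE fP fullD big nu.
  have [y _ ->] := nonmax_rigid gD gE fP fullD big nv.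
  by rewrite !gf; apply: (iff_trans (iff_sym (e_lt fP _ x y))); apply: (e_lt hP).
split=> [uv|uv].
  have mv : ismax E v by split=> //; have [] := top_ltL gE uv.
  exact: (nonmax_lt_max gP ngu (g_ismax mv)).
have mv : ismax E v by split=> //; apply/L_iff; have [] := top_ltL gP uv.
exact: (nonmax_lt_max gE nu mv).
Qed.

Let V_imp a x : i_V E a x -> i_V P (g a) (g x).
Proof.
move=> Va; have [na|na] := pselect (nonmax E a).
  have [u uE] := level_rigid gD gE fP fullD big na Va.
  have [v _ vE] := nonmax_rigid gD gE fP fullD big na.
  by rewrite uE vE !gf; apply/(e_V hP)/(e_V fP); rewrite -uE -vE.
have ma : ismax E a by split=> //; apply: (g_VL gE Va).
have [m mm Vm] : istop P (g x) by apply: g_istop; exists a.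
by rewrite (ismax_uniq gP (g_ismax ma) mm).
Qed.

(** Extensions can only add a maximum and elements of its level, which are
    determined by their predecessors in the common tree. *)
Lemma embedding_of_branches : interp_embedding E P g.
Proof.
split.
- exact: g_inj.
- by rewrite -(e_zero fP) gf (e_zero hP).
- by move=> k; rewrite -(e_c fP) gf (e_c hP).
- exact: L_iff.
- move=> b u v; have [bN|bN] := pselect (val b = None).
    by rewrite (palpha1E bN); apply: top_lt_iff.
  split=> uv.
    have [hL _ _ _] := g_order gE b; have [Lu Lv] := hL _ _ uv.
    have [x uE] := L_rigid gD gE fP fullD bN Lu.
    have [y vE] := L_rigid gD gE fP fullD bN Lv.
    by rewrite uE vE !gf; apply/(e_lt hP)/(e_lt fP); rewrite -uE -vE.
  have [hL _ _ _] := g_order gP b; have [Lu Lv] := hL _ _ uv.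
  have [x /[dup] uE /range_f->] := L_rigid gD gP hP fullD bN Lu.
  have [y /[dup] vE /range_f->] := L_rigid gD gP hP fullD bN Lv.
  by apply/(e_lt fP)/(e_lt hP); rewrite -uE -vE.
- move=> b u y z; split=> Fu.
    have [[u0 uE] [y0 yE] [z0 zE]] := F_range gD gE fP fullD big Fu.
    by rewrite uE yE zE !gf; apply/(e_F hP)/(e_F fP); rewrite -uE -yE -zE.
  have [[u0 uE] [y0 yE] [z0 zE]] := F_range gD gP hP fullD big Fu.
  rewrite (range_f uE) (range_f yE) (range_f zE); apply/(e_F fP)/(e_F hP).
  by rewrite -uE -yE -zE.
- move=> u y z; split=> Gu.
    have [[u0 uE] [y0 yE] [z0 zE]] := G_range gD gE fP fullD big Gu.
    by rewrite uE yE zE !gf; apply/(e_G hP)/(e_G fP); rewrite -uE -yE -zE.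
  have [[u0 uE] [y0 yE] [z0 zE]] := G_range gD gP hP fullD big Gu.
  rewrite (range_f uE) (range_f yE) (range_f zE); apply/(e_G fP)/(e_G hP).
  by rewrite -uE -yE -zE.
- move=> u v; split=> Su.
    have [[u0 uE] [v0 vE]] := S_range gD gE fP fullD big Su.
    by rewrite uE vE !gf; apply/(e_S hP)/(e_S fP); rewrite -uE -vE.
  have [[u0 uE] [v0 vE]] := S_range gD gP hP fullD big Su.
  rewrite (range_f uE) (range_f vE); apply/(e_S fP)/(e_S hP).
  by rewrite -uE -vE.
- move=> a x; split=> [|Vx]; first exact: V_imp.
  case: (g_cover gE (x := x)) => // [[b /L_iff Lx]|[a' Va']].
    by case: (g_V_notL gP Vx Lx).
  by rewrite (g_inj (g_V_fun gP Vx (V_imp Va'))).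
- move=> u v; split=> Tuv.
    have [x uE] := T_range gD gE fP fullD big Tuv.
    have [[y vE]|mv|tv] := extension_cases gD gE fP fullD big v.
    + by rewrite uE vE !gf; apply/(e_T hP)/(e_T fP); rewrite -uE -vE.
    + have [a [b [_ Vv _]]] := g_TV gE Tuv; case: (g_V_notL gE Vv mv.1).
    + by rewrite uE gf; apply/gT => //; rewrite -uE.
  have [x /[dup] uE /range_f->] := T_range gD gP hP fullD big Tuv.
  have [[y vE]|mv|tv] := extension_cases gD gE fP fullD big v.
  + by rewrite vE; apply/(e_T fP)/(e_T hP); rewrite -!gf -vE gf -uE.
  + have [a [b [_ Vv _]]] := g_TV gP Tuv.
    by case: (g_V_notL gP Vv (g_ismax mv).1).
  + by apply/gT => //; rewrite -uE.
Qed.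

End MaximumLevel.
End Sizes.

(** * Amalgamation of branches *)

Section Amalgam.

Variables (alpha : cordinal) (n : nat) (rk : label alpha -> nat).
Hypothesis no_limit : forall b : label alpha, ~ label_limit b.
Hypothesis rk0 : forall b, ~~ label_pos b <-> rk b = 0.
Hypothesis rkS : forall b c, label_succ b c -> rk c = (rk b).+1.
Hypothesis rk_alpha0 : rk (@alpha0 alpha) = n.

Variables (U0 U1 U2 : Type) (D0 : interp alpha U0) (D1 : interp alpha U1)
  (D2 : interp alpha U2) (f1 : U0 -> U1) (f2 : U0 -> U2).
Hypothesis g0 : good D0.
Hypothesis g1 : good D1.
Hypothesis g2 : good D2.
Hypothesis f1P : interp_embedding D0 D1 f1.
Hypothesis f2P : interp_embedding D0 D2 f2.
Hypothesis full0 : full rk D0 (@alpha0 alpha).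
Hypothesis big : ~ ([set: U0] #<= [set: aleph n]).
Hypothesis max21 : (exists m, ismax D2 m) -> exists m, ismax D1 m.

Definition same_branch y1 y2 := forall e, i_T D1 (f1 e) y1 <-> i_T D2 (f2 e) y2.

Definition new_branch :=
  {y : U2 | `[< istop D2 y /\ forall y1, istop D1 y1 -> ~ same_branch y1 y >]}.

Let newP (y : new_branch) :
  istop D2 (val y) /\ forall y1, istop D1 y1 -> ~ same_branch y1 (val y).
Proof. exact/asboolP/(valP y). Qed.

Let Q := add_points new_branch D1.
Let gQ : good_on Q (fun v => exists u, v = inl u) := add_points_good new_branch g1.

(** The first model, together with the branches of the second one that the first
    one does not contain.  The branches with the same nodes must be identified, because
    the maximum is a limit. *)
Definition amalgam : interp alpha (U1 + new_branch) :=
  Interp (i_zero Q) (i_c Q) (i_L Q) (i_lt Q) (i_F Q) (i_G Q) (i_S Q)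
    (fun a v => i_V Q a v \/
       exists a' y, [/\ a = inl a', ismax D1 a' & v = inr y])
    (fun u v => i_T Q u v \/
       exists e y, [/\ u = inl (f1 e), v = inr y & i_T D2 (f2 e) (val y)]).

Let P := amalgam.

Let V_inl a v : i_V P (inl a) (inl v) <-> i_V D1 a v.
Proof. by split=> [[//|[? [? []]]]|]; [|left]. Qed.

Let V_inr w (y : new_branch) : i_V P w (inr y) <-> exists2 a, ismax D1 a & w = inl a.
Proof.
split=> [[|[a [_ [-> ma _]]]]|[a ma ->]]; first by case: w.
  by exists a.
by right; exists a, y.
Qed.

Let V_left a v : i_V P a v -> exists a', a = inl a'.
Proof. by case: a => [a _|z [|[? [? []]]]] //; exists a. Qed.

Let T_inl u v : i_T P (inl u) (inl v) <-> i_T D1 u v.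
Proof. by split=> [[//|[? [? []]]]|]; [|left]. Qed.

Let T_inr u (y : new_branch) :
  i_T P (inl u) (inr y) <-> exists2 e, u = f1 e & i_T D2 (f2 e) (val y).
Proof.
split=> [[//|[e [y' [[->] [->] ?]]]]|[e -> ?]]; first by exists e.
by right; exists e, y.
Qed.

Let T_left u v : i_T P u v -> exists u', u = inl u'.
Proof. by case: u => [u _|z [|[? [? []]]]] //; exists u. Qed.

Let top_lt_left u v : top_lt P u v ->
  exists u' v', [/\ u = inl u', v = inl v' & top_lt D1 u' v'].
Proof. by case: u v => [u|?] [v|?] // ?; exists u, v. Qed.

Let nonmax_inl u : nonmax P (inl u) <-> nonmax D1 u.
Proof. by split=> [[[w|?] //]|[w ?]]; [exists w|exists (inl w)]. Qed.

Let limit_inl u : limit P (inl u) <-> limit D1 u.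
Proof.
split=> -[u0 nw]; split.
- by move=> E; apply: u0; rewrite E.
- by move=> [w ?]; apply: nw; exists (inl w).
- by move=> [E]; apply: u0.
- by move=> [[w|?] // ?]; apply: nw; exists w.
Qed.

Let ismaxE u : ismax P u <-> exists2 u', u = inl u' & ismax D1 u'.
Proof.
split=> [[Lu nu]|[v -> [Lv nv]]]; last by split=> // /nonmax_inl.
by case: u Lu nu => [u|?] // Lu nu; exists u => //; split=> // /nonmax_inl.
Qed.

Let max_not_lt a b : ismax D1 a -> ~ top_lt D1 a b.
Proof. by move=> [_ na] ab; apply: na; exists b. Qed.

Let T2_node z y : i_T D2 z y -> exists2 a, nonmax D0 a &
  exists2 e, z = f2 e & i_V D0 a e.
Proof.
move=> /(g_TV g2)[a [b [Va _ ab]]]; have na : nonmax D2 a by exists b.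
have [e zE] := level_rigid no_limit rk0 rkS rk_alpha0 g0 g2 f2P full0 big na Va.
have [a0 na0 aE] := nonmax_rigid no_limit rk0 rkS rk_alpha0 g0 g2 f2P full0 big na.
by exists a0 => //; exists e => //; apply/(e_V f2P); rewrite -zE -aE.
Qed.

Let T1_node z y : i_T D1 z y -> exists e, z = f1 e.
Proof. exact: (T_range no_limit rk0 rkS rk_alpha0 g0 g1 f1P full0 big). Qed.

Lemma amalgam_good : good amalgam.
Proof.
split.
- exact: (g_order gQ).
- exact: (g_zero gQ).
- exact: (g_min gQ).
- exact: (g_S gQ).
- exact: (g_succ gQ).
- exact: (g_max gQ).
- by move=> a v Vv; have [a' aE] := V_left Vv; move: Vv; rewrite aE;
    case: v => [v /V_inl/(g_VL g1)|y /V_inr[m [Lm _] [->]]].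
- move=> a [v|y] b Vv; last by [].
  by have [a' aE] := V_left Vv; move: Vv; rewrite aE => /V_inl/(g_V_notL g1); apply.
- move=> a b v Va Vb; have [a' aE] := V_left Va; have [b' bE] := V_left Vb.
  move: Va Vb; rewrite aE bE; case: v => [v /V_inl Va /V_inl Vb|y].
    by rewrite (g_V_fun g1 Va Vb).
  by move=> /V_inr[m mm [->]] /V_inr[m' mm' [->]]; rewrite (ismax_uniq g1 mm mm').
- move=> [u|y] _.
    case: (g_cover g1 (x := u)) => // -[b h]; first by left; exists b.
    by right; exists (inl b); apply/V_inl.
  have [[m mm _] _] := newP y; have [|m1 mm1] := max21; first by exists m.
  by right; exists (inl m1); apply/V_inr; exists m1.
- move=> u v uv; have [u' uE] := T_left uv; move: uv; rewrite uE.
  case: v => [v /T_inl/(g_TV g1)[a [b [? ? ?]]]|y /T_inr[e -> ey]].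
    by exists (inl a), (inl b); split=> //; apply/V_inl.
  have [a na [e' /(e_inj f2P) <- Va]] := T2_node ey.
  have [[m mm _] _] := newP y; have [|m1 mm1] := max21; first by exists m.
  exists (inl (f1 a)), (inl m1); split.
  + exact/V_inl/(e_V f1P).
  + by apply/V_inr; exists m1.
  + exact: (nonmax_lt_max g1 (nonmax_image f1P na) mm1).
- move=> u v w uv vw; have [u' uE] := T_left uv; have [v' vE] := T_left vw.
  move: uv vw; rewrite uE vE => /T_inl uv; case: w => [w /T_inl vw|y].
    by apply/T_inl; apply: (g_T_trans g1) vw.
  move=> /T_inr[e vE' ey]; have [e' uE'] := T1_node uv.
  apply/T_inr; exists e' => //; apply: (g_T_trans g2) ey.
  by apply/(e_T f2P)/(e_T f1P); rewrite -uE' -vE'.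
- move=> u v w uw vw; have [u' uE] := T_left uw; have [v' vE] := T_left vw.
  move: uw vw; rewrite uE vE; case: w => [w /T_inl uw /T_inl vw|y].
    by case: (g_T_tree g1 uw vw) => [->|h|h];
      [constructor 1|constructor 2; apply/T_inl|constructor 3; apply/T_inl].
  move=> /T_inr[e -> ey] /T_inr[e' -> ey'].
  case: (g_T_tree g2 ey ey') => [/(e_inj f2P)->|h|h]; first by constructor 1.
    by constructor 2; apply/T_inl/(e_T f1P)/(e_T f2P).
  by constructor 3; apply/T_inl/(e_T f1P)/(e_T f2P).
- move=> a b v Va /top_lt_left[b' [a' [bE aE ba]]]; move: Va; rewrite aE bE.
  case: v => [v /V_inl/(g_T_pred g1)/(_ ba)[x [Vx xv]]|y].
    by exists (inl x); split; [apply/V_inl|apply/T_inl].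
  move=> /V_inr[m mm _].
  have nb : nonmax D1 b' by exists a'.
  have [b0 nb0 b0E] :=
    nonmax_rigid no_limit rk0 rkS rk_alpha0 g0 g1 f1P full0 big nb.
  have [[m2 mm2 Vy] _] := newP y.
  have lt2 := nonmax_lt_max g2 (nonmax_image f2P nb0) mm2.
  have [x [Vx xy]] := g_T_pred g2 Vy lt2.
  have [e xE] := level_rigid no_limit rk0 rkS rk_alpha0 g0 g2 f2P full0 big
    (nonmax_image f2P nb0) Vx.
  exists (inl (f1 e)); split.
    by rewrite b0E; apply/V_inl/(e_V f1P)/(e_V f2P); rewrite -xE.
  by apply/T_inr; exists e => //; rewrite -xE.
- move=> a v w; case: a => // a La /limit_inl la.
  have swap u (y : new_branch) : i_V P (inl a) (inl u) -> i_V P (inl a) (inr y) ->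
      (forall z, i_T P z (inl u) <-> i_T P z (inr y)) -> False.
    move=> /V_inl Vu /V_inr[m mm [aE]] uy; have [_ nsame] := newP y.
    apply: (nsame u); first by exists m => //; rewrite -aE.
    move=> e; split=> [/T_inl/uy/T_inr[e' /(e_inj f1P)->]//|ey].
    by apply/T_inl/uy/T_inr; exists e.
  case: v w => [v|y] [w|y'] Vv Vw vw.
  + congr inl; apply: (g_T_limit g1 La la); [exact/V_inl|exact/V_inl|].
    by move=> z; split=> [/T_inl/vw/T_inl|/T_inl/vw/T_inl].
  + by case: (swap _ _ Vv Vw vw).
  + by case: (swap _ _ Vw Vv (fun z => iff_sym (vw z))).
  + have [[m mm Vy] _] := newP y; have [[m' mm' Vy'] _] := newP y'.
    congr inr; apply/val_inj; apply: (same_predecessors g2).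
    * by exists m.
    * by exists m'.
    * have imp (u u' : new_branch) z :
          (forall z, i_T P z (inr u) -> i_T P z (inr u')) ->
          i_T D2 z (val u) -> i_T D2 z (val u').
        move=> uu' zu; have [_ _ [e zE _]] := T2_node zu.
        have /uu'/T_inr[e' /(e_inj f1P) <-] : i_T P (inl (f1 e)) (inr u).
          by apply/T_inr; exists e => //; rewrite -zE.
        by rewrite -zE.
      by move=> z _; split; apply: imp => u /vw.
- move=> a b v Va /top_lt_left[a' [b' [aE bE ab]]]; move: Va; rewrite aE bE.
  case: v => [v /V_inl/(g_T_pruned g1)/(_ ab)[y [Vy vy]]|y].
    by exists (inl y); split; [apply/V_inl|apply/T_inl].
  by move=> /V_inr[m mm [aE']]; case: (max_not_lt mm (b := b')); rewrite -aE'.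
- exact: (g_L0 gQ).
- exact: (g_c_inj gQ).
- exact: (g_Llim gQ).
- exact: (g_F_dom gQ).
- exact: (g_F gQ).
- exact: (g_G_dom gQ).
- move=> u eu; have := g_G gQ eu; congr surjection; apply/funext => v.
  apply/propext; split=> [|[//|[a' [y [uE ma _]]]]]; first by left.
  case: eu => Lu /(_ erefl); rewrite uE => /nonmax_inl na.
  by case: ma => _ [].
Qed.

Let h := (inl : U1 -> U1 + new_branch) \o f1.

Let inlP : interp_embedding D1 P inl.
Proof.
split=> //; first by move=> ? ? [].
- by move=> a x; apply: iff_sym (V_inl a x).
- by move=> a x; apply: iff_sym (T_inl a x).
Qed.

Let hP : interp_embedding D0 P h.
Proof.
split.
- by move=> x y [/(e_inj f1P)].
- by rewrite /h /= (e_zero f1P).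
- by move=> k; rewrite /h /= (e_c f1P).
- by move=> b x; apply: iff_trans (e_L f1P b x) (e_L inlP _ _).
- by move=> b x y; apply: iff_trans (e_lt f1P b x y) (e_lt inlP _ _ _).
- by move=> b x y z; apply: iff_trans (e_F f1P b x y z) (e_F inlP _ _ _ _).
- by move=> x y z; apply: iff_trans (e_G f1P x y z) (e_G inlP _ _ _).
- by move=> x y; apply: iff_trans (e_S f1P x y) (e_S inlP _ _).
- by move=> x y; apply: iff_trans (e_V f1P x y) (e_V inlP _ _).
- by move=> x y; apply: iff_trans (e_T f1P x y) (e_T inlP _ _).
Qed.

Let same_branch_uniq y1 y2 y2' : istop D2 y2 -> istop D2 y2' ->
  same_branch y1 y2 -> same_branch y1 y2' -> y2 = y2'.
Proof.
move=> t t' s s'; apply: (same_predecessors g2) => // z [a na Va].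
have [e ->] := level_rigid no_limit rk0 rkS rk_alpha0 g0 g2 f2P full0 big na Va.
by apply: (iff_trans (iff_sym (s e))); apply: s'.
Qed.

Let image_same_branch e : same_branch (f1 e) (f2 e).
Proof. by move=> e'; apply: iff_trans (iff_sym (e_T f1P _ _)) (e_T f2P _ _). Qed.

Let inr_istop (y : new_branch) : istop P (inr y).
Proof.
have [[m mm _] _] := newP y; have [|m1 mm1] := max21; first by exists m.
exists (inl m1); first by apply/ismaxE; exists m1.
by apply/V_inr; exists m1.
Qed.

Let inl_istop y : istop D1 y -> istop P (inl y).
Proof.
move=> [m mm Vy]; exists (inl m); last exact/V_inl.
by apply/ismaxE; exists m.
Qed.

(* [rel_g y v]: the element [y] of the second model becomes [v] in the amalgam *)
Let rel_g (y : U2) (v : U1 + new_branch) :=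
  [\/ exists2 e, y = f2 e & v = h e,
      [/\ forall e, y <> f2 e, ismax D2 y & ismax P v] |
      [/\ forall e, y <> f2 e, istop D2 y &
         (exists y1, [/\ v = inl y1, istop D1 y1 & same_branch y1 y]) \/
         exists2 y', v = inr y' & val y' = y]].

Let g_exists y : exists v, rel_g y v.
Proof.
have [[e ye]|ne] := pselect (exists e, y = f2 e).
  by exists (h e); constructor 1; exists e.
have {}ne e : y <> f2 e by move=> ye; apply: ne; exists e.
case: (extension_cases no_limit rk0 rkS rk_alpha0 g0 g2 f2P full0 big y).
- by move=> [e /ne].
- move=> my; have [|m1 mm1] := max21; first by exists y.
  by exists (inl m1); constructor 2; split=> //; apply/ismaxE; exists m1.
- move=> ty; have [[y1 [t1 s1]]|ns] :=
      pselect (exists y1, istop D1 y1 /\ same_branch y1 y).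
    by exists (inl y1); constructor 3; split=> //; left; exists y1.
  have yn : `[< istop D2 y /\ forall y1, istop D1 y1 -> ~ same_branch y1 y >].
    by apply/asboolP; split=> // y1 t1 s1; apply: ns; exists y1.
  exists (inr (exist _ y yn)); constructor 3; split=> //; right.
  by exists (exist _ y yn).
Qed.

Let g y := projT1 (cid (g_exists y)).
Let gP y : rel_g y (g y). Proof. by rewrite /g; case: cid. Qed.

Let gf e : g (f2 e) = h e.
Proof.
by case: (gP (f2 e)) => [[e' /(e_inj f2P)->]//|[/(_ e)]|[/(_ e)]].
Qed.

Let rel_g_istop y v : istop D2 y -> rel_g y v -> istop P v.
Proof.
move=> ty [[e yE ->]|[_ [Ly _] _]|[_ _ [[y1 [-> t1 _]]|[y' -> _]]]].
- apply/(istop_image no_limit rk0 rkS rk_alpha0 g0 amalgam_good hP full0 big).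
  apply/(istop_image no_limit rk0 rkS rk_alpha0 g0 g2 f2P full0 big).
  by rewrite -yE.
- by case: ty => m _ Vy; case: (g_V_notL g2 Vy Ly).
- exact: inl_istop.
- exact: inr_istop.
Qed.

Let rel_g_ismax y v : ismax D2 y -> rel_g y v -> ismax P v.
Proof.
move=> my [[e yE ->]|[_ _ //]|[_ [m _ Vy] _]].
- apply/(ismax_image no_limit rk0 rkS rk_alpha0 g0 amalgam_good hP full0 big).
  apply/(ismax_image no_limit rk0 rkS rk_alpha0 g0 g2 f2P full0 big).
  by rewrite -yE.
- by case: (g_V_notL g2 Vy my.1).
Qed.

Let rel_g_T x y v : istop D2 y -> rel_g y v ->
  i_T D2 (f2 x) y <-> i_T P (h x) v.
Proof.
move=> ty [[e -> ->]|[_ [Ly _] _]|[_ _ [[y1 [-> t1 s1]]|[y' -> yE]]]].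
- by apply: iff_trans (iff_sym (e_T f2P _ _)) (e_T hP _ _).
- by case: ty => m _ Vy; case: (g_V_notL g2 Vy Ly).
- by apply: (iff_trans (iff_sym (s1 x))); apply: iff_sym (T_inl _ _).
- split=> [xy|/T_inr[e /(e_inj f1P)->]]; last by rewrite yE.
  by apply/T_inr; exists x => //; rewrite yE.
Qed.

Let rel_g_inj y y' v : rel_g y v -> rel_g y' v -> y = y'.
Proof.
have mixed e u w : rel_g (f2 e) w -> rel_g u w -> (forall e, u <> f2 e) ->
    w = h e -> False.
  move=> _ ru nu wE; case: ru => [[e' /nu]//|[_ mu mw]|[_ tu h3]].
    rewrite wE in mw; have me : ismax D2 (f2 e).
      apply/(ismax_image no_limit rk0 rkS rk_alpha0 g0 g2 f2P full0 big).
      exact/(ismax_image no_limit rk0 rkS rk_alpha0 g0 amalgam_good hP full0 big).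
    by apply: (nu e); apply: (ismax_uniq g2).
  case: h3 => [[y1 [E t1 s1]]|[y2 E _]]; last by move: E; rewrite wE.
  move: E; rewrite wE => -[y1E]; apply: (nu e).
  apply: (same_branch_uniq (y1 := y1)) => //; last first.
    by rewrite -y1E; apply: image_same_branch.
  apply/(istop_image no_limit rk0 rkS rk_alpha0 g0 g2 f2P full0 big).
  apply/(istop_image no_limit rk0 rkS rk_alpha0 g0 g1 f1P full0 big).
  by rewrite y1E.
have top_max u w : istop D2 u -> rel_g u w -> ismax P w -> False.
  move=> tu ru [Lw _]; have [m _ Vw] := rel_g_istop tu ru.
  by case: (g_V_notL amalgam_good Vw Lw).
move=> ry ry'.
have [[e yE vE]|[ny my mv]|[ny ty sy]] := ry.
- have [[e' y'E v'E]|[ny' _ _]|[ny' _ _]] := ry'.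
  + by rewrite yE y'E; congr f2; apply: (e_inj hP); rewrite -vE.
  + by rewrite yE in ry; case: (mixed e y' v).
  + by rewrite yE in ry; case: (mixed e y' v).
- have [[e' y'E v'E]|[ny' my' _]|[ny' ty' _]] := ry'.
  + by rewrite y'E in ry'; case: (mixed e' y v).
  + exact: (ismax_uniq g2).
  + by case: (top_max _ _ ty' ry' mv).
- have [[e' y'E v'E]|[ny' my' mv]|[ny' ty' sy']] := ry'.
  + by rewrite y'E in ry'; case: (mixed e' y v).
  + by case: (top_max _ _ ty ry mv).
  + case: sy sy' => [[y1 [-> t1 s1]]|[w -> <-]] [[y1' [E t1' s1']]|[w' E <-]] //.
      by case: E => E; apply: same_branch_uniq s1 _ => //; rewrite E.
    by case: E => ->.
Qed.

Lemma amalgam_exists : exists (N : Type) (P : interp alpha N)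
    (h1 : U1 -> N) (h2 : U2 -> N),
  [/\ good P, interp_embedding D1 P h1, interp_embedding D2 P h2 &
      forall e, h1 (f1 e) = h2 (f2 e)].
Proof.
exists (U1 + new_branch)%type, amalgam, inl, g; split.
- exact: amalgam_good.
- exact: inlP.
- apply: (embedding_of_branches no_limit rk0 rkS rk_alpha0 g0 g2 amalgam_good
    f2P hP full0 big gf).
  + by move=> y y' E; apply: rel_g_inj (gP y) _; rewrite E; apply: gP.
  + by move=> y my; apply: rel_g_ismax my (gP y).
  + by move=> y ty; apply: rel_g_istop ty (gP y).
  + by move=> x y ty; apply: rel_g_T ty (gP y).
- by move=> e; rewrite gf.
Qed.

End Amalgam.

(** * Amalgamation for finite alpha *)

Section KurepaFromModel.

Variables (alpha : cordinal) (U : Type) (D : interp alpha U).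
Hypothesis gD : good D.
Variable m : U.
Hypothesis mm : ismax D m.

Let nonmaxL a : nonmax D a -> i_L D None a.
Proof. by move=> [b /(top_ltL gD)[]]. Qed.

Let nolast a : nonmax D a -> exists b, nonmax D b /\ top_lt D a b.
Proof.
move=> na; have [b ab] := g_succ gD na; have [tab _] := (g_S gD _ _).1 ab.
exists b; split=> //; apply: contrapT => nb.
have [_ []] : limit D b by apply: (g_max gD) nb; have [] := top_ltL gD tab.
by exists a.
Qed.

Let cofinal (C : set U) := (forall x, C x -> nonmax D x) /\
  forall a, nonmax D a -> exists2 c, C c & a = c \/ top_lt D a c.

Let least_cofinal : exists C : set U, cofinal C /\
  forall C', cofinal C' -> [set: C] #<= [set: C'].
Proof.
have cA : cofinal (nonmax D) by split=> // a na; exists a => //; left.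
have [[C Cc] Cmin] := @card_least {C | cofinal C} (exist _ _ cA)
  (fun C : {C | cofinal C} => set_type (sval C)).
by exists C; split=> // C' C'c; apply: (Cmin (exist _ C' C'c)).
Qed.

Let C := projT1 (cid least_cofinal).
Let Ccof : cofinal C. Proof. by rewrite /C; case: cid => ? []. Qed.
Let Cmin C' : cofinal C' -> [set: C] #<= [set: C'].
Proof. by rewrite /C; case: cid => ? [_] /= h; apply: h. Qed.

Let w := projT1 (cid (initial_order_exists C)).
Let w_init : initial_order w. Proof. by rewrite /w; case: cid. Qed.
Let w_wo : well_order w. Proof. by case: w_init. Qed.

(** The elements of [C] above all earlier ones: on them the well-order [w] agrees
    with the order of [L_(alpha+1)], and they are still cofinal. *)
Definition record_type :=
  {c : C | `[< forall c', slt w c' c -> top_lt D (val c') (val c) >]}.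

Let Mu := record_type.
Let pos (i : Mu) : U := val (val i).

Let recP (i : Mu) c' : slt w c' (val i) -> top_lt D (val c') (pos i).
Proof. by have /asboolP := valP i; apply. Qed.

Let C_nonmax (c : C) : nonmax D (val c).
Proof. by have [h _] := Ccof; apply: h; have /set_mem := valP c. Qed.

Let pos_nonmax i : nonmax D (pos i). Proof. exact: C_nonmax. Qed.

Let pos_cofinal a : nonmax D a -> exists i, a = pos i \/ top_lt D a (pos i).
Proof.
move=> na; have [_ h] := Ccof; have [c Cc ac] := h a na.
have [|b ab bmin] := wo_least w_wo
    (P := [set b : C | a = val b \/ top_lt D a (val b)]).
  by exists (SigSub (mem_set Cc)).
have brec : `[< forall c', slt w c' b -> top_lt D (val c') (val b) >].
  apply/asboolP => c' c'b; have nac' : ~ (a = val c' \/ top_lt D a (val c')).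
    by move=> /bmin bc'; move: c'b => /(sltNge w_wo).
  case: (top_lt_total gD (nonmaxL na) (nonmaxL (C_nonmax c'))) => [E|E|c'a].
  - by case: nac'; left.
  - by case: nac'; right.
  - by case: ab => [<-//|]; apply: (top_lt_trans gD c'a).
by exists (exist _ b brec).
Qed.

Let r : rel Mu := fun i j => w (val i) (val j).
Let r_wo : well_order r. Proof. exact: well_order_pullback val_inj. Qed.

Let r_lt i j : slt r i j <-> top_lt D (pos i) (pos j).
Proof.
split=> [ij|ij]; first exact: recP.
case: (slt_wo_total r_wo i j) => [//|E|/recP ji].
  by move: ij; rewrite E => /(top_lt_irr gD).
by case: (top_lt_irr gD (top_lt_trans gD ij ji)).
Qed.

Let pos_inj : injective pos. Proof. by move=> i j /val_inj/val_inj. Qed.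

(** By the minimality of [C], the records are as many as the elements of [C]. *)
Lemma record_initial : initial_order r.
Proof.
split=> // i Mi; have [_ init] := w_init; apply: (init (val i)).
apply: card_le_trans (_ : [set: Mu] #<= _); last first.
  apply: card_le_trans Mi _.
  by apply: (@card_le_fun _ _ _ _ val) => // ? ? _ _ /val_inj.
pose R := range pos.
have Rc : cofinal R.
  split=> [_ [j _ <-]//|a /pos_cofinal[j aj]].
  by exists (pos j) => //; exists j.
apply: card_le_trans (Cmin Rc) _; rewrite (card_le_eql (card_setT R)).
exact: card_image_le.
Qed.

Let r_nolast i : exists j, slt r i j.
Proof.
have [b [nb ib]] := nolast (pos_nonmax i); have [j bj] := pos_cofinal nb.
exists j; apply/r_lt; case: bj => [<-//|bj]; exact: top_lt_trans gD _ _ _ ib bj.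
Qed.

Lemma record_infinite : infinite_set [set: Mu].
Proof.
apply: (@infinite_of_no_last _ (fun=> True) (slt r)) => //.
- exact: slt_wo_irr.
- exact: slt_wo_trans.
- by have [i _] := pos_cofinal (zero_nonmax gD); exists i.
- by move=> i _; have [j] := r_nolast i; exists j.
Qed.

Lemma record_card : [set: Mu] #<= [set x | nonmax D x].
Proof.
apply: (@card_le_fun _ _ _ _ pos) => [i _|i j _ _ /pos_inj//].
exact: pos_nonmax.
Qed.

(* the nodes at the levels in the cofinal sequence *)
Definition record_node := {z : U | `[< exists i, i_V D (pos i) z >]}.

Let X := record_node.
Let t : rel X := fun x y => `[< x = y \/ i_T D (val x) (val y) >].

Let level_exists (x : X) : exists i, i_V D (pos i) (val x).
Proof. exact/asboolP/(valP x). Qed.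
Let lev x := projT1 (cid (level_exists x)).
Let levP x : i_V D (pos (lev x)) (val x). Proof. by rewrite /lev; case: cid. Qed.

Let lev_uniq x i : i_V D (pos i) (val x) -> lev x = i.
Proof. by move=> Vi; apply: pos_inj; apply: (g_V_fun gD (levP x) Vi). Qed.

Let T_lev x y : i_T D (val x) (val y) -> slt r (lev x) (lev y).
Proof.
move=> /(g_TV gD)[a [b [Va Vb ab]]]; apply/r_lt.
by rewrite (g_V_fun gD (levP x) Va) (g_V_fun gD (levP y) Vb).
Qed.

Let node i z (Vz : i_V D (pos i) z) : X :=
  exist _ z (asboolT (ex_intro (fun i => i_V D (pos i) z) i Vz)).

Let T_irr z : ~ i_T D z z.
Proof.
move=> /(g_TV gD)[a [b [Va Vb]]]; rewrite (g_V_fun gD Va Vb).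
exact: top_lt_irr gD _.
Qed.

Let T_levE x y z : i_T D (val x) z -> i_T D (val y) z -> t x y = r (lev x) (lev y).
Proof.
move=> xz yz; apply/asboolP/idP => [[->|/T_lev/(sltW r_wo)//]|xy].
  exact: wo_refl.
case: (g_T_tree gD xz yz) => [/val_inj|xy'|/T_lev/(sltNge r_wo)//]; [by left|by right].
Qed.

Let same_lev x y z : i_T D (val x) z -> i_T D (val y) z -> lev x = lev y -> x = y.
Proof.
move=> xz yz E; case: (g_T_tree gD xz yz) => [/val_inj//|/T_lev|/T_lev];
  by rewrite E => /(slt_wo_irr r_wo).
Qed.

Let lev_pred i z b : i_V D b z -> top_lt D (pos i) b ->
  exists2 x : X, lev x = i & i_T D (val x) z.
Proof.
move=> Vz ib; have [u [Vu uz]] := g_T_pred gD Vz ib.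
by exists (node Vu) => //; apply: lev_uniq.
Qed.

Let tP x y : slt t x y <-> i_T D (val x) (val y).
Proof.
split=> [/andP[/asboolP[->|//] /asboolP[]]|xy]; first by left.
apply/andP; split; first by apply/asboolP; right.
apply/asboolP => -[E|yx]; first by move: xy; rewrite E => /T_irr.
exact: (T_irr (g_T_trans gD xy yx)).
Qed.

Lemma record_tree_order : tree_order t.
Proof.
have t_anti x y : t x y -> t y x -> x = y.
  move=> /asboolP[//|xy] /asboolP[//|yx].
  by case: (T_irr (g_T_trans gD xy yx)).
split.
  split; last by move=> x y /andP[xy yx]; apply: t_anti.
  split; first by move=> x; apply/asboolP; left.
  move=> y x z /asboolP[->//|xy] /asboolP[<-|yz]; apply/asboolP; right => //.
  exact: g_T_trans gD _ _ _ xy yz.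
move=> x A Ax [a Aa].
have AT y : y \in A -> i_T D (val y) (val x).
  by move=> /Ax/set_mem/tP.
have [|_ [y Ay <-] ymin] := wo_least r_wo (P := [set lev y | y in [set y | y \in A]]).
  by exists (lev a); exists a.
exists y; split; first split=> //.
  move=> z Az; rewrite (T_levE (AT _ Ay) (AT _ Az)); apply: ymin.
  by exists z.
move=> z [Az zmin]; apply: t_anti; last exact: zmin.
by rewrite (T_levE (AT _ Ay) (AT _ Az)); apply: ymin; exists z.
Qed.

Lemma lev_iso (B : set X) (I : set Mu) z :
  (forall x, B x -> I (lev x) /\ i_T D (val x) z) ->
  (forall i, I i -> exists2 x, B x & lev x = i) -> order_iso t B r I.
Proof.
move=> BI IB; exists lev; split; last first.
  by move=> x y /BI[_ xz] /BI[_ yz]; apply: T_levE xz yz.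
split=> [x /BI[]//|x y /set_mem/BI[_ xz] /set_mem/BI[_ yz]|i /IB//].
exact: same_lev xz yz.
Qed.

Lemma below_iso x : order_iso t (below t x) r (below r (lev x)).
Proof.
apply: (lev_iso (z := val x)) => [y /tP yx|i /r_lt ix]; first by split=> //; apply: T_lev.
by have [y yi yx] := lev_pred (levP x) ix; exists y => //; apply/tP.
Qed.

(** A node has the order type of its level in only one way, since order
    isomorphisms between initial segments of well-orders are equalities. *)
Lemma tree_level_lev i x : tree_level t r i x <-> lev x = i.
Proof.
split=> [|<-]; last exact: below_iso.
move=> [F [[FB FI FS] Fr]].
have eq_below j k : (forall l, slt r l j <-> slt r l k) -> j = k.
  move=> jk; case: (slt_wo_total r_wo j k) => // h.
    by move/jk: h => /(slt_wo_irr r_wo).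
  by move/jk: h => /(slt_wo_irr r_wo).
have Fslt y z : slt t y x -> slt t z x -> slt r (F y) (F z) = slt t y z.
  by move=> yx zx; rewrite /slt !Fr.
have Flev j : forall y, slt t y x -> lev y = j -> F y = lev y.
  elim/(wo_ind r_wo): j => j IH y yx yj; apply: eq_below => k; split=> ky.
    have [|z zx zk] := FS k.
      by apply: (slt_wo_trans r_wo ky); apply: FB.
    move: ky; rewrite -zk Fslt// => /tP zy.
    by rewrite (IH (lev z))// -?yj; apply: T_lev.
  have [z zk /tP zy] := lev_pred (levP y) ((r_lt _ _).1 ky).
  have zx : slt t z x.
    by apply/tP; apply: (g_T_trans gD) (_ : i_T D (val y) _); apply/tP.
  rewrite -zk -(IH (lev z) _ z)//; last by rewrite zk -yj.
  by rewrite Fslt.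
apply: eq_below => l; split=> lx.
  have [z zl /tP zx] := lev_pred (levP x) ((r_lt _ _).1 lx).
  by rewrite -zl -(Flev (lev z))//; apply: FB.
have [z zx <-] := FS l lx.
by rewrite (Flev (lev z))//; apply: T_lev; apply/tP.
Qed.

Lemma record_height : tree_has_height t r.
Proof.
split=> [i|x]; last by exists (lev x); apply/tree_level_lev.
have [z Vz] := level_nonempty gD (pos_nonmax i).
by exists (node Vz); apply/tree_level_lev/lev_uniq.
Qed.

Lemma record_level_card i : tree_level t r i #<= [set y | i_V D (pos i) y].
Proof.
apply: (@card_le_fun _ _ _ _ val) => [x /tree_level_lev <-|x y _ _ /val_inj//].
exact: levP.
Qed.

Lemma record_branches : [set v | i_V D m v] #<= tree_branch t r.
Proof.
pose B v : set X := [set x | i_T D (val x) v].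
have lt_m i : top_lt D (pos i) m by apply: (nonmax_lt_max gD) mm.
apply: (@card_le_fun _ _ _ _ B) => [v Vv|v v' Vv Vv' BB].
  split.
  - move=> x y xv yv; rewrite !(T_levE xv yv, T_levE yv xv).
    exact: wo_total.
  - move=> F Ftot BF; apply/seteqP; split=> // x Fx.
    have [y yx yv] := lev_pred Vv (lt_m (lev x)).
    have := Ftot _ _ Fx (BF _ yv); case=> /asboolP[E|/T_lev].
    + by rewrite E.
    + by rewrite yx => /(slt_wo_irr r_wo).
    + by rewrite -E.
    + by rewrite yx => /(slt_wo_irr r_wo).
  - apply: (lev_iso (z := v)) => // i _.
    by have [x xi xv] := lev_pred Vv (lt_m i); exists x.
have imp u u' z : i_V D m u -> B u = B u' -> (exists2 a, nonmax D a & i_V D a z) ->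
    i_T D z u -> i_T D z u'.
  move=> Vu Buu' [a na Va] zu; have [b [nb ab]] := nolast na.
  have [i bi] := pos_cofinal nb.
  have ai : top_lt D a (pos i) by case: bi => [<-//|]; apply: (top_lt_trans gD ab).
  have [x xi xu] := lev_pred Vu (lt_m i).
  have xu' : B u' x by rewrite -Buu'.
  suff zx : i_T D z (val x) by apply: (g_T_trans gD zx).
  case: (g_T_tree gD zu xu) => [zx|//|xz].
    by move: Va; rewrite zx => /(g_V_fun gD (levP x)) E;
      move: ai; rewrite -E xi => /(top_lt_irr gD).
  have [c [d [Vc Vd cd]]] := g_TV gD xz.
  have cE := g_V_fun gD (levP x) Vc; have dE := g_V_fun gD Va Vd.
  rewrite -cE -dE xi in cd.
  by case: (top_lt_irr gD (top_lt_trans gD ai cd)).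
apply: (same_predecessors gD); [by exists m|by exists m|].
by move=> z za; split; apply: imp za.
Qed.

(** The elements of the level of the maximum [m] are branches of the tree restricted
    to a cofinal sequence of levels, of length the cofinality of the set of levels
    below [m]. *)
Lemma kurepa_of_model (n : nat) (K : Type) :
  [set: aleph n.+1] #<= [set: K] ->
  [set x | nonmax D x] #<= [set: aleph n] ->
  (forall a, nonmax D a -> ~ ([set: aleph n] #<= [set y | i_V D a y])) ->
  [set: K] #<= [set v | i_V D m v] ->
  exists Mu : Type, [set: Mu] #<= [set: aleph n] /\
    kurepa_tree_exists Mu (aleph n) K.
Proof.
move=> nK An Vn KV; exists Mu; have Mn := card_le_trans record_card An.
split=> //; split.
  split=> //; first exact: record_infinite.
    exact: card_le_trans (aleph_leS n) nK.
  by move=> KM; apply: (card_succ_gt Mn); apply: card_le_trans nK KM.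
exists r, X, t; split.
- exact: record_initial.
- exact: record_tree_order.
- exact: record_height.
- by move=> i /card_le_trans/(_ (record_level_card i)); apply: Vn.
- exact: card_le_trans record_branches.
Qed.

End KurepaFromModel.

Section FiniteAmalgamation.

Variables (alpha : cordinal) (p : nat).
Hypothesis alpha_p : [set: alpha] #= `I_p.+1.

Variable K : Type.
Hypothesis pK : [set: aleph p.+2] #<= [set: K].

Let a0N : @alpha0 alpha <> None. Proof. by []. Qed.

(** The extensions then only add branches and perhaps a maximum.  If only one of
    them has a maximum, it has to be the first model of [amalgam_exists]. *)
Lemma ap_of_full :
  (forall (U : Type) (D : interp alpha U), good D -> [set: U] #= [set: K] ->
     [set: aleph p.+1] #<= [set y | i_L D (@alpha0 alpha) y]) ->
  AP (psi alpha) K.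
Proof.
move=> full_all; have [rk [rk0 rkS rka rk1]] := rank_exists alpha_p.
have no_limit := finite_no_limit alpha_p.
move=> M0 M1 M2; have [U0 [D0 ->]] := to_structure_surj M0.
have [U1 [D1 ->]] := to_structure_surj M1.
have [U2 [D2 ->]] := to_structure_surj M2.
move=> f1 f2 [/models_good g0 U0K] [/models_good g1 _] [/models_good g2 _].
move=> /embeddingE f1P /embeddingE f2P.
have full0 : full rk D0 (@alpha0 alpha) by rewrite /full rka; apply: full_all.
have big : ~ ([set: U0] #<= [set: aleph p.+1]).
  move=> /(card_succ_gt (T := aleph p.+1)); apply; apply: card_le_trans pK _.
  by have /card_eqPle[] := U0K.
have [max1|nmax1] := pselect (exists m, ismax D1 m).
  have [N [P [h1 [h2 [gP h1P h2P hh]]]]] := amalgam_exists no_limit rk0 rkS rka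
    g0 g1 g2 f1P f2P full0 big (fun=> max1).
  exists (to_structure P), h1, h2; split=> //; first exact/models_good.
    exact/embeddingE.
  exact/embeddingE.
have [N [P [h2 [h1 [gP h2P h1P hh]]]]] := amalgam_exists no_limit rk0 rkS rka
  g0 g2 g1 f2P f1P full0 big (fun max1 => False_ind _ (nmax1 max1)).
exists (to_structure P), h1, h2; split=> //; first exact/models_good.
  exact/embeddingE.
exact/embeddingE.
Qed.

(** Everything outside of the level of the maximum has size at most
    [aleph p.+1], so this level has to make up the size of the model. *)
Lemma small_model (U : Type) (D : interp alpha U) : good D ->
  [set: U] #= [set: K] ->
  ~ ([set: aleph p.+1] #<= [set y | i_L D (@alpha0 alpha) y]) ->
  [/\ [set x | nonmax D x] #<= [set: aleph p.+1],
      forall a, nonmax D a -> [set y | i_V D a y] #<= [set: aleph p] &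
      exists2 m, ismax D m & [set: K] #<= [set v | i_V D m v]].
Proof.
move=> gD UK /card_succ_le Lp; have [rk [rk0 rkS rka rk1]] := rank_exists alpha_p.
have no_limit := finite_no_limit alpha_p.
have An : [set x | nonmax D x] #<= [set: aleph p.+1].
  have := enumerated_card gD (b1 := palpha1 alpha) (@aleph_infinite p)
    (label_succ_alpha alpha) Lp.
  by apply: card_le_trans; apply: subset_card_le => x /(enumerated_top gD).
have Vp a : nonmax D a -> [set y | i_V D a y] #<= [set: aleph p].
  by move=> /(level_card gD)/card_le_trans; apply.
have pinf := @aleph_infinite p.+1.
have Ln b : [set y | i_L D b y] #<= [set: aleph p.+1].
  case: b => [b|]; last exact: top_card_le.
  have bN : (Some b : label alpha) <> None by [].
  apply: card_le_trans (L_card no_limit rk0 rkS gD bN) (aleph_le _).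
  by rewrite -rka; apply: rank_le_alpha0.
have big : ~ ([set: U] #<= [set: aleph p.+1]).
  move=> /(card_succ_gt (T := aleph p.+1)); apply; apply: card_le_trans pK _.
  by have /card_eqPle[] := UK.
have Vn a : nonmax D a -> [set y | i_V D a y] #<= [set: aleph p.+1].
  by move=> /Vp/card_le_trans; apply; apply: aleph_leS.
split=> //; apply: contrapT => nm; apply: big.
apply: (model_card_le gD pinf Ln) => m Lm.
have [/Vn//|nmm] := pselect (nonmax D m).
have [VT|TV] := card_le_totalset [set v | i_V D m v] [set: aleph p.+1]; first exact: VT.
case: nm; exists m => //; have /card_eqPle[_ KU] := UK.
apply: card_le_trans KU _.
pose Y : set U := [set y | (exists b, i_L D b y) \/
  exists2 a, nonmax D a & i_V D a y].
apply: (@card_lt_setU (aleph p.+1) _ Y) => //.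
- apply/seteqP; split=> // y _.
  case: (g_cover gD (x := y)) => // [[b Ly]|[a Va]]; first by left; left; exists b.
  have [na|na] := pselect (nonmax D a); first by left; right; exists a.
  right; rewrite /= (_ : m = a)//; apply: (ismax_uniq gD) => //.
  by split=> //; apply: (g_VL gD Va).
- exact: card_le_trans TV (card_leT _).
- exact: part_card_le.
move=> UT; apply: (card_succ_gt (T := aleph p.+1) UT).
apply: card_le_trans pK _; by have /card_eqPle[] := UK.
Qed.

Lemma ap_holds_no_kurepa :
  ~ (exists Mu : Type, [set: Mu] #<= [set: aleph p.+1] /\
       kurepa_tree_exists Mu (aleph p.+1) K) -> AP (psi alpha) K.
Proof.
move=> nk; apply: ap_of_full => U D gD UK; apply: contrapT => nfull.
have [An Vp [m mm KV]] := small_model gD UK nfull; apply: nk.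
apply: (kurepa_of_model gD mm pK An) KV => a /Vp.
exact: card_succ_gt.
Qed.

(** The elements of the level of the maximum are determined by their predecessors,
    which form a subset of a set of size at most [aleph p.+1]. *)
Lemma ap_holds_large : ~ ([set: K] #<= [set: set (aleph p.+1)]) ->
  AP (psi alpha) K.
Proof.
move=> Klarge; apply: ap_of_full => U D gD UK; apply: contrapT => nfull.
have [An Vp [m mm KV]] := small_model gD UK nfull; apply: Klarge.
apply: card_le_trans KV _; have pinf := @aleph_infinite p.+1.
have Nn : \bigcup_(a in [set a | nonmax D a]) [set y | i_V D a y]
    #<= [set: aleph p.+1].
  apply: card_le_bigcup => // a /Vp/card_le_trans; apply.
  exact: aleph_leS.
have [c _] := infinite_natP pinf.
have [k [_ kI]] := card_le_funE (c 0) Nn.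
pose node z := exists2 a, nonmax D a & i_V D a z.
apply: (@card_le_fun _ _ _ _ (fun v => [set k z | z in [set z | node z /\ i_T D z v]])).
  by [].
move=> v v' Vv Vv' E; apply: (same_predecessors gD); [by exists m|by exists m|].
have imp u u' z : [set k z | z in [set z | node z /\ i_T D z u]] =
    [set k z | z in [set z | node z /\ i_T D z u']] -> node z ->
    i_T D z u -> i_T D z u'.
  move=> uu' nz zu.
  have [z' [nz' z'u'] kz] : [set k z | z in [set z | node z /\ i_T D z u']] (k z).
    by rewrite -uu'; exists z.
  by rewrite (kI z z').
by move=> z nz; split; apply: imp nz.
Qed.

End FiniteAmalgamation.

Theorem theorem5p4 (alpha : cordinal) :
  (forall K : Type, Spec (psi alpha) K -> ~ JEP (psi alpha) K) /\
  (forall n : nat, (0 < n)%N -> [set: alpha] #= `I_n ->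
   forall K : Type, infinite_set [set: K] -> Spec (psi alpha) K ->
     ([set: K] #<= [set: aleph n] -> ~ AP (psi alpha) K) /\
     ([set: aleph n.+1] #<= [set: K] -> [set: K] #<= [set: set (aleph n)] ->
        ((exists Mu : Type, [set: Mu] #<= [set: aleph n] /\
            kurepa_tree_exists Mu (aleph n) K) -> ~ AP (psi alpha) K) /\
        (~ (exists Mu : Type, [set: Mu] #<= [set: aleph n] /\
            kurepa_tree_exists Mu (aleph n) K) -> AP (psi alpha) K)) /\
     (~ ([set: K] #<= [set: set (aleph n)]) -> AP (psi alpha) K)) /\
  (infinite_set [set: alpha] ->
   forall K : Type, Spec (psi alpha) K -> ~ AP (psi alpha) K).
Proof.
split; first exact: jep_fails.
split; last exact: ap_fails_infinite.
case=> // p _ alpha_p K Kinf _; split; first exact: (ap_fails_small alpha_p Kinf).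
split=> [pK _|Klarge]; last first.
  apply: (ap_holds_large alpha_p) => //.
  apply: card_le_trans ((card_succP _).2 _ (@card_powerset_gt _)) _.
  exact: not_card_leW.
split=> [[Mu [Mp Mk]]|nk]; first exact: (ap_fails_kurepa alpha_p Kinf Mp Mk).
exact: (ap_holds_no_kurepa alpha_p).
Qed.
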